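(* Let $Z_1,Z_2,\ldots$ be independent real random variables with a common cumulative distribution function $V$, with $E(Z_n)=0$ and $E(Z_n^2)=\sigma^2>0$. Suppose that (A) there is $A>0$ such that $\int_{-\infty}^{\infty}e^{hy}\,dV(y)$ converges for all real $|h|<A$; and (B) in the decomposition $V=\beta U_1+(1-\beta)U_2$ of $V$ into its absolutely continuous part $U_1$ and singular part $U_2$ (see context) one has $\beta>0$. Let $F_n(x)=\mathrm{Prob}(Z_1+\cdots+Z_n\le \sigma x\sqrt n)$. Then there is a positive number $C_1$ (finite or $+\infty$), namely the one defined in the context, such that for every $c$ in the interval $0<c<C_1$ there are real coefficients $b_0,b_1,b_2,\ldots$, independent of $n$ but depending on $c$, with $b_0>0$, such that for every positive integer $k$, as $n\to\infty$, $$1-F_n(c\sqrt n)=\frac{1}{\sqrt n}e^{-\alpha n}\left[b_0+\frac{b_1}{n}+\cdots+\frac{b_{k-1}}{n^{k-1}}+O\left(\frac{1}{n^k}\right)\right],$$ where $\alpha=h\bar m(h)-\log R(h)$ and $h$ is the unique positive root of the equation $\bar m(h)=\sigma c$ in the interval $0<h<A_1$ (with $R$, $\bar m$, $A_1$ as in the context).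
   Context: Decomposition of $V$: every cumulative distribution function $V$ can be written in the form $V(x)=\beta U_1(x)+(1-\beta)U_2(x)$ with a uniquely determined $0\le\beta\le1$, where $U_1,U_2$ are cumulative distribution functions, $U_1$ is absolutely continuous, $U_1(x)=\int_{-\infty}^xU_1'(y)\,dy$, and $U_2'(x)=0$ for almost every $x$. Put $R(h)=\int_{-\infty}^\infty e^{hy}\,dV(y)$, and let $A_1\in(0,+\infty]$ and $-A_2\in[-\infty,0)$ be the supremum and infimum of the real $h$ for which this integral converges. For $-A_2<h<A_1$ put $\bar m(h)=\frac{d}{dh}\log R(h)$; this is a continuous, strictly increasing function of $h$ vanishing at $h=0$. The number $C_1\in(0,+\infty]$ is defined by $\lim_{h\to A_1-0}\bar m(h)=\sigma C_1$. For $0<c<C_1$ the equation $\bar m(h)=\sigma c$ has exactly one root $h$ in $(-A_2,A_1)$, and this root is positive. *)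

(* Defs.v *)
From HB Require Import structures.
From mathcomp Require Import all_boot all_order all_algebra finmap.
From mathcomp Require Import all_classical all_reals all_analysis.

Set Implicit Arguments.
Unset Strict Implicit.
Unset Printing Implicit Defensive.

Import Order.TTheory GRing.Theory Num.Theory.
Import numFieldNormedType.Exports.

Local Open Scope classical_set_scope.
Local Open Scope ring_scope.

(* The type [cumulativeBounded (0 : R) (1 : R)] is that of cumulative
   distribution functions: nondecreasing right-continuous functions R -> R
   with limits 0 at -oo and 1 at +oo.  Accordingly, a random variable X has
   cumulative distribution function x |-> Prob(X <= x). *)

Definition mutually_independent (I : choiceType) d (T : measurableType d)
    (R : realType) (P : probability T R) (X : I -> {RV P >-> R}) : Prop :=
  forall (J : {fset I}) (B : I -> set R),
    (forall i, i \in J -> measurable (B i)) ->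
    P (\bigcap_(i in [set` J]) (X i @^-1` B i)) =
    (\prod_(i <- J) P (X i @^-1` B i))%E.

Section decomposition.
Context {R : realType}.

Definition absolutely_continuous (f : R -> R) : Prop :=
  forall e : R, 0 < e -> exists2 delta : R, 0 < delta &
    forall (n : nat) (a b : 'I_n -> R),
      (forall i, a i <= b i) ->
      trivIset setT (fun i => `]a i, b i[%classic) ->
      \sum_(i < n) (b i - a i) < delta ->
      \sum_(i < n) `|f (b i) - f (a i)| < e.

(* U1 is differentiable almost everywhere, and derive1 U1 is 0 at the points where
   U1 is not differentiable. *)
Definition ac_singular_decomposition (V : R -> R) (beta : R)
    (U1 U2 : cumulativeBounded (0 : R) (1 : R)) : Prop :=
  [/\ 0 <= beta <= 1,
      forall x, V x = beta * U1 x + (1 - beta) * U2 x,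
      absolutely_continuous U1,
      forall x, (U1 x)%:E =
        (\int[lebesgue_measure]_(y in `]-oo, x]) (derive1 U1 y)%:E)%E
    & {ae (@lebesgue_measure R), forall x : R, is_derive x (1 : R) U2 (0 : R)}].

End decomposition.

Section transform.
Context {R : realType} (V : cumulativeBounded (0 : R) (1 : R)).

(* The integrand is positive, so the integral always exists in [0, +oo] and it
   converges exactly when it is less than +oo. *)
Definition exp_integral (h : R) : \bar R :=
  (\int[lebesgue_stieltjes_measure V]_y (expR (h * y))%:E)%E.

Definition Rtransform (h : R) : R := fine (exp_integral h).

Definition A1 : \bar R :=
  ereal_sup [set h%:E | h in [set h : R | (exp_integral h < +oo)%E]].

Definition mbar : R -> R := derive1 (fun h => ln (Rtransform h)).

End transform.

(* The filter of the one-sided limit h -> a - 0 along real h, for an extended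
   real a; there is no real number below -oo, whence the improper filter. *)
Definition at_left_ereal {R : realType} (a : \bar R) : set_system R :=
  match a with
  | r%:E => r^'-
  | +oo%E => pinfty_nbhs R
  | -oo%E => [set: set R]
  end.

(* The sequence is indexed from 0, so Z 0 is the first summand. *)
Definition cdf_sum d (T : measurableType d) (R : realType)
    (P : probability T R) (Z : nat -> {RV P >-> R}) (sigma : R) (n : nat)
    (x : R) : R :=
  fine (P [set t | \sum_(i < n) Z i t <= sigma * x * Num.sqrt n%:R]).

(* Main.v *)
Require Import Defs.
From HB Require Import structures.
From mathcomp Require Import all_boot all_order all_algebra finmap.
From mathcomp Require Import all_classical all_reals all_analysis.
From mathcomp Require Import measurable_realfun.
From mathcomp Require Import complex zify ring lra.

Set Implicit Arguments.
Unset Strict Implicit.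
Unset Printing Implicit Defensive.

Import Order.TTheory GRing.Theory Num.Theory.
Import numFieldNormedType.Exports.

Local Open Scope classical_set_scope.
Local Open Scope ring_scope.

(* For z = h + i t with h > 0 one has, up to the constant 2 pi,
   max(u, 0) = \int e^{z u} / z ^ 2 dt.  By Fubini and independence, with
   S = Z_1 + ... + Z_n, m = sigma c, and h the root of mbar h = m,
   E (S - n m - a)_+ = e^{- alpha n} \int phi(t) ^ n e^{- z a} / z ^ 2 dt,
   where phi is the characteristic function of the law of Z_1 - m tilted by
   e^{h y}: this law is centred by the choice of h.  The difference quotients of
   the left-hand side at a = 0 with steps +-n^{-k-1} bracket P (S > n m), so that up
   to a relative error O(n^{-k}) the tail is e^{- alpha n} \int phi(t) ^ n / z dt.
   The absolutely continuous part of V forces |phi| <= rho < 1 away from t = 0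
   (Cramer's condition), and near 0 Laplace's method yields the expansion in powers
   of 1 / n: phi(t) ^ n = e^{- n s t ^ 2 / 2} (1 + w(t)) ^ n with w(t) = O(t ^ 3), which
   is expanded by the binomial theorem and integrated against Gaussian moments; the
   odd moments vanish, whence only integral powers of 1 / n appear. *)

(** * Integration *)

(** The integral of phi(t) ^ n / z need not converge absolutely: |phi| stays below some rho < 1 away
    from 0, but need not decay at infinity, since V may have a singular part. Passing to the
    positive part replaces 1 / z by 1 / z ^ 2, which is integrable in t, so that Fubini's theorem
    applies for every n. The price is the step e of the difference quotient: the quotient of the
    weights differs from 1 / z by O(e) near t = 0 and is only O(1 / (e |z| ^ 2)) elsewhere. With e =
    n^{-k-1} the first error is small enough even after multiplication by sqrt n, while rho ^ n
    beats 1 / e. As e depends on k, each order yields its own polynomial in 1 / n; one sequence b_i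
    results because the values at the points 1 / n determine the coefficients below the order of the
    error. Cramer's condition is used as a lower bound for the mass, under V, of a bounded set where
    cos (t y - th) <= 1 - eta. In this form it passes to the tilted law, whose density relative to V
    is bounded below on bounded sets, and it also yields the positivity of the tilted variance. *)

Section integration.
Context d (T : measurableType d) (R : realType) (mu : {measure set T -> \bar R}).
Implicit Types (D : set T) (f g : T -> R).

Lemma integrable_le D f g : measurable D -> measurable_fun D f ->
  (forall x, D x -> `|f x| <= g x) ->
  mu.-integrable D (EFin \o g) -> mu.-integrable D (EFin \o f).
Proof.
move=> mD mf fg; apply: le_integrable => //; first exact/measurable_EFinP.
by move=> x Dx; rewrite /= lee_fin (le_trans (fg _ Dx))// ler_norm.
Qed.

Lemma integrable_lin D (a b : R) f g : measurable D ->
  mu.-integrable D (EFin \o f) -> mu.-integrable D (EFin \o g) ->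
  mu.-integrable D (EFin \o (fun x => a * f x + b * g x)).
Proof.
move=> mD fi gi.
have := integrableD mD (integrableZl mD a fi) (integrableZl mD b gi).
by apply: eq_integrable.
Qed.

Lemma Rintegral_lin D (a b : R) f g : measurable D ->
  mu.-integrable D (EFin \o f) -> mu.-integrable D (EFin \o g) ->
  \int[mu]_(x in D) (a * f x + b * g x) =
  a * (\int[mu]_(x in D) f x) + b * (\int[mu]_(x in D) g x).
Proof.
move=> mD fi gi; rewrite RintegralD ?RintegralZl//.
- by have := integrableZl mD a fi; apply: eq_integrable.
- by have := integrableZl mD b gi; apply: eq_integrable.
Qed.

Lemma le_norm_Rintegral D f g : measurable D -> measurable_fun D f ->
  (forall x, D x -> `|f x| <= g x) -> mu.-integrable D (EFin \o g) ->
  `|\int[mu]_(x in D) f x| <= \int[mu]_(x in D) g x.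
Proof.
move=> mD mf fg gi; have fi := integrable_le mD mf fg gi.
apply: (le_trans (le_normr_Rintegral mD fi)); apply: le_Rintegral => //.
exact: integrable_norm.
Qed.

Lemma integrable_sumf D (n : nat) (f : nat -> T -> R) : measurable D ->
  (forall i, (i < n)%N -> mu.-integrable D (EFin \o f i)) ->
  mu.-integrable D (EFin \o (fun x => \sum_(i < n) f i x)).
Proof.
move=> mD; elim: n => [|n IH] fi.
  have := @integrable0 _ _ _ mu D; apply: eq_integrable => // x _ /=.
  by rewrite big_ord0.
have fi' i : (i < n)%N -> mu.-integrable D (EFin \o f i).
  by move=> lin; apply: fi; exact: ltnW.
have := integrableD mD (IH fi') (fi n (ltnSn n)).
by apply: eq_integrable => // x _ /=; rewrite big_ord_recr.
Qed.

Lemma Rintegral_sum D (n : nat) (f : nat -> T -> R) : measurable D ->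
  (forall i, (i < n)%N -> mu.-integrable D (EFin \o f i)) ->
  \int[mu]_(x in D) (\sum_(i < n) f i x) = \sum_(i < n) \int[mu]_(x in D) f i x.
Proof.
move=> mD; elim: n => [|n IH] fi.
  rewrite big_ord0; under eq_Rintegral do rewrite big_ord0.
  by rewrite /Rintegral integral0.
have fi' i : (i < n)%N -> mu.-integrable D (EFin \o f i).
  by move=> lin; apply: fi; exact: ltnW.
rewrite big_ord_recr -IH//=; under eq_Rintegral do rewrite big_ord_recr /=.
by rewrite RintegralD//; [exact: integrable_sumf|exact: fi].
Qed.

End integration.

(** * Dilations of Lebesgue measure, dominating functions, integrals of derivatives *)

Section lebesgue_scaling.
Context {R : realType}.
Local Notation mu := (@lebesgue_measure R).

(** The image of Lebesgue measure under x -> l x, multiplied by |l|, gives half-open intervals their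
    length, hence is Lebesgue measure. For l < 0 the preimage of ]a, b] is closed on the left and
    open on the right, which does not change its length. *)
Lemma ge0_integral_scale (l : R) (f : R -> \bar R) : l != 0 ->
  measurable_fun setT f -> (forall x, 0 <= f x)%E ->
  (\int[mu]_x f (l * x)%R = (`|l|^-1)%:E * \int[mu]_x f x)%E.
Proof.
move=> l0 mf f0.
have nl0 : 0 <= `|l| by [].
have mphi : measurable_fun [set: measurableTypeR R]
    (fun x : R => (l * x : measurableTypeR R)).
  exact: (measurable_funM (measurable_cst l) (@measurable_id _ _ setT)).
have key (A : set (measurableTypeR R)) : measurable A ->
    mu A = mscale (NngNum nl0) (pushforward mu (fun x : R => (l * x : measurableTypeR R))) A.
  move=> mA; apply: lebesgue_measure_unique => //= _ [[a b]] _ <-.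
  rewrite /mscale /= /pushforward.
  case: (ltgtP l 0) => [ln|lp|l00]; last by rewrite l00 eqxx in l0.
  - rewrite (_ : _ @^-1` _ = `[b / l, a / l[%classic); last first.
      apply/seteqP; split => x; rewrite /= !in_itv/= => /andP[H1 H2]; apply/andP; split.
      + by rewrite ler_ndivrMr// mulrC.
      + by rewrite ltr_ndivlMr// mulrC.
      + by move: H2; rewrite ltr_ndivlMr// mulrC.
      + by move: H1; rewrite ler_ndivrMr// mulrC.
    rewrite !lebesgue_measure_itv/= !lte_fin.
    rewrite ltr_nM2r ?invr_lt0//; case: ifP => _; last by rewrite mule0.
    rewrite -!EFinD -EFinM ltr0_norm//; congr (_%:E).
    by field; rewrite lt_eqF.
  - rewrite (_ : _ @^-1` _ = `]a / l, b / l]%classic); last first.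
      apply/seteqP; split => x; rewrite /= !in_itv/= => /andP[H1 H2]; apply/andP; split.
      + by rewrite ltr_pdivrMr// mulrC.
      + by rewrite ler_pdivlMr// mulrC.
      + by move: H1; rewrite ltr_pdivrMr// mulrC.
      + by move: H2; rewrite ler_pdivlMr// mulrC.
    rewrite !lebesgue_measure_itv/= !lte_fin.
    rewrite ltr_pM2r ?invr_gt0//; case: ifP => _; last by rewrite mule0.
    rewrite -!EFinD -EFinM gtr0_norm//; congr (_%:E).
    by field; rewrite gt_eqF.
have -> : (\int[mu]_x f x = `|l|%:E * \int[mu]_x f (l * x)%R)%E.
  rewrite (@eq_measure_integral _ _ _ _ (mscale (NngNum nl0)
    (pushforward mu (fun x : R => (l * x : measurableTypeR R))))); last first.
    by move=> A mA _; exact: key.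
  rewrite ge0_integral_mscale//= ge0_integral_pushforward//=.
by rewrite muleA -EFinM mulVf ?normr_eq0// mul1e.
Qed.

Lemma integrable_scale (l : R) (f : R -> R) : l != 0 ->
  mu.-integrable setT (EFin \o f) ->
  mu.-integrable setT (EFin \o (fun x => f (l * x))).
Proof.
move=> l0 /integrableP[mf fi]; apply/integrableP; split.
  apply: (measurableT_comp mf).
  exact: (measurable_funM (measurable_cst l) (@measurable_id _ _ setT)).
have := @ge0_integral_scale l (fun x => `|(f x)%:E|%E) l0.
move=> /(_ _ _) -> //; last by apply: measurableT_comp.
by rewrite lte_mul_pinfty// lee_fin.
Qed.

Lemma Rintegral_scale (l : R) (f : R -> R) : l != 0 ->
  mu.-integrable setT (EFin \o f) ->
  \int[mu]_x f (l * x) = `|l|^-1 * \int[mu]_x f x.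
Proof.
move=> l0 fi; have mf := measurable_int _ fi.
have ml : measurable_fun (setT : set (measurableTypeR R)) (fun x : R => l * x).
  exact: (measurable_funM (measurable_cst l) (@measurable_id _ _ setT)).
rewrite (_ : `|l|^-1 = fine (`|l|^-1)%:E)// -fineM//; last exact: integrable_fin_num.
congr fine.
rewrite [LHS]integralE [in RHS]integralE.
have := @ge0_integral_scale l ((EFin \o f)^\+)%E l0.
have := @ge0_integral_scale l ((EFin \o f)^\-)%E l0.
move=> /(_ _ _)/= E1 /(_ _ _)/= E2.
rewrite (_ : (_ ^\+)%E = fun x => ((EFin \o f)^\+)%E (l * x))//.
rewrite (_ : ((fun x => (f (l * x))%:E) ^\-)%E = fun x => ((EFin \o f)^\-)%E (l * x))//.
rewrite E1 ?E2//.
- by rewrite [RHS]muleBr//; apply: (integrable_add_def measurableT fi).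
- exact: measurable_funepos.
- exact: measurable_funeneg.
- exact: (funeneg_comp (EFin \o f) ( *%R l)).
- exact: (funepos_comp (EFin \o f) ( *%R l)).
Qed.

Lemma integrable_oneDsqrV : mu.-integrable setT (EFin \o (fun t : R => (1 + t ^+ 2)^-1)).
Proof.
have c0 : continuous (fun t : R => (1 + t ^+ 2)^-1) := @continuous_oneDsqrV R.
have p0 (x : R) : 0 <= (1 + x ^+ 2)^-1 by rewrite invr_ge0 addr_ge0// sqr_ge0.
apply/integrableP; split.
  by apply/measurable_EFinP; exact: continuous_measurable_fun.
under eq_integral => x _ do rewrite gee0_abs ?lee_fin//.
rewrite ge0_symfun_integralT//; last by move=> x /=; rewrite sqrrN.
rewrite -set_itvcy (_ : integral _ _ _ = (pi / 2)%:E) ?ltry//.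
exact: integral0y_oneDsqr.
Qed.

(** Induction on k: half of the exponential is left to the previous power, and the other half
    absorbs one factor y by 1 + x <= e ^ x. *)
Lemma pow_expR_bounded (k : nat) (c : R) : 0 < c ->
  exists2 K : R, 0 <= K & forall y : R, 0 <= y -> y ^+ k * expR (- (c * y)) <= K.
Proof.
elim: k c => [|k IH] c c0.
  by exists 1 => // y y0; rewrite expr0 mul1r -expR0 ler_expR oppr_le0 mulr_ge0// ltW.
have c20 : 0 < c / 2 by rewrite divr_gt0.
have [K K0 HK] := IH _ c20.
exists (K * (2 / c)) => [|y y0]; first by rewrite mulr_ge0// divr_ge0// ltW.
have -> : y ^+ k.+1 * expR (- (c * y)) =
    (y ^+ k * expR (- (c / 2 * y))) * (y * expR (- (c / 2 * y))).
  rewrite exprSr mulrACA -expRD; congr (_ * expR _); by field.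
apply: ler_pM; rewrite ?mulr_ge0 ?exprn_ge0 ?expR_ge0//; first exact: HK.
rewrite expRN ler_pdivrMr ?expR_gt0//.
apply: (@le_trans _ _ (2 / c * (1 + c / 2 * y))); last first.
  by rewrite ler_wpM2l ?expR_ge1Dx// divr_ge0// ltW.
have -> : 2 / c * (1 + c / 2 * y) = 2 / c + y by field; rewrite gt_eqF.
by rewrite lerDr divr_ge0// ltW.
Qed.

Lemma integrable_gauss_moment (a : nat) (c : R) : 0 < c ->
  mu.-integrable setT (EFin \o (fun t : R => `|t| ^+ a * expR (- (c * t ^+ 2)))).
Proof.
move=> c0.
have [K1 K10 H1] := pow_expR_bounded 0 c0.
have [K2 K20 H2] := pow_expR_bounded 1 c0.
have [K3 K30 H3] := pow_expR_bounded a c0.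
have [K4 K40 H4] := pow_expR_bounded a.+1 c0.
pose K := K1 + K2 + K3 + K4.
apply: (@integrable_le _ _ R mu setT _ (fun t => K * (1 + t ^+ 2)^-1)) => //.
- apply: measurable_funM.
    by apply: measurable_funX; exact: normr_measurable.
  apply: measurableT_comp => //; apply: measurableT_comp => //.
  by apply: measurable_funM => //; exact: measurable_funX.
- move=> t _; have t20 : 0 <= t ^+ 2 := sqr_ge0 t.
  rewrite ger0_norm; last by rewrite mulr_ge0 ?exprn_ge0 ?expR_ge0.
  rewrite ler_pdivlMr; last by rewrite ltr_pwDl.
  have ta : `|t| ^+ a <= 1 + (t ^+ 2) ^+ a.
    rewrite -exprM mulnC exprM -normrX -(real_normK (x := t ^+ a)) ?num_real//.
    have := sqr_ge0 (`|t ^+ a| - 1); have := normr_ge0 (t ^+ a); nra.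
  apply: (@le_trans _ _ ((1 + (t ^+ 2) ^+ a) * expR (- (c * t ^+ 2)) * (1 + t ^+ 2))).
    by rewrite ler_wpM2r ?ler_wpM2r ?expR_ge0// addr_ge0.
  have := H1 _ t20; have := H2 _ t20; have := H3 _ t20; have := H4 _ t20.
  rewrite expr0 expr1 exprS /K; set e := expR _; set u := (_ ^+ 2) ^+ a.
  set v := t ^+ 2; lra.
- have := integrableZl measurableT K integrable_oneDsqrV.
  by apply: eq_integrable.
Qed.

(** The fundamental theorem of calculus on [-n, n], followed by dominated convergence. Limits of [F]
    along the integers suffice, since integrability of [f] identifies the limit of the integrals
    over [-n, n]. *)
Lemma Rintegral_derive0 (F f : R -> R) :
  (forall x : R, is_derive x (1 : R) F (f x)) -> continuous f ->
  mu.-integrable setT (EFin \o f) ->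
  F n%:R @[n --> \oo] --> (0 : R) -> F (- n%:R) @[n --> \oo] --> (0 : R) ->
  \int[mu]_x f x = 0.
Proof.
move=> dF cf fi F1 F2.
pose I n := `[- n%:R, n%:R]%classic : set (measurableTypeR R).
have mf : measurable_fun (setT : set (measurableTypeR R)) f.
  exact: continuous_measurable_fun.
have cvg1 : (\int[mu]_x (((f \_ (I n)) x)%:E))%E @[n --> \oo] --> (\int[mu]_x (f x)%:E)%E.
  have [|||||] := @dominated_convergence _ _ _ mu setT measurableT
    (fun n x => ((f \_ (I n)) x)%:E) (EFin \o f) (EFin \o (Num.norm \o f)).
  - move=> n; apply/measurable_EFinP; apply/measurable_restrict => //.
      exact: measurable_itv.
    exact: measurable_funS mf.
  - exact/measurable_EFinP.
  - apply: aeW => /= x _; apply: cvg_near_cst.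
    near=> n; rewrite patchE mem_set//; rewrite /I /= in_itv /= -ler_norml.
    near: n; exact: nbhs_infty_ger.
  - exact: integrable_norm.
  - apply: aeW => x n _ /=; rewrite lee_fin patchE; case: ifP => // _.
    by rewrite normr0.
  - by [].
have E n : (0 < n)%N -> (\int[mu]_x (((f \_ (I n)) x)%:E))%E = (F n%:R - F (- n%:R))%:E.
  move=> n0; have -> : (\int[mu]_x (((f \_ (I n)) x)%:E) =
      \int[mu]_(x in I n) (f x)%:E)%E.
    by rewrite [RHS]integral_mkcond restrict_EFin.
  rewrite (@continuous_FTC2 _ f F)//.
  - by rewrite ltrNl (@lt_trans _ _ 0) ?oppr_lt0 ?ltr0n.
  - exact: continuous_subspaceT.
  - split.
    + by move=> x _; have := dF x => -[].
    + apply: cvg_at_right_filter; apply: differentiable_continuous.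
      by apply/derivable1_diffP; have := dF (- n%:R) => -[].
    + apply: cvg_at_left_filter; apply: differentiable_continuous.
      by apply/derivable1_diffP; have := dF n%:R => -[].
  - by move=> x _; rewrite derive1E; have := dF x => H; rewrite derive_val.
have cvg2 : (\int[mu]_x (((f \_ (I n)) x)%:E))%E @[n --> \oo] --> (0 : R)%:E.
  have FE : ((F n%:R - F (- n%:R))%:E @[n --> \oo] --> (0 : R)%:E)%E.
    apply: cvg_EFin; first exact: nearW.
    rewrite -[X in _ --> X](subrr (0 : R)); exact: (cvgB F1 F2).
  apply: cvg_trans FE; apply: near_eq_cvg; near=> n; rewrite E//.
  by near: n; exact: nbhs_infty_gt.
by rewrite /Rintegral (cvg_unique _ cvg1 cvg2).
Unshelve. all: by end_near. Qed.

End lebesgue_scaling.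

(** * Complex numbers in coordinates; the truncated binomial formula *)

Section complex_facts.
Context {R : realType}.
Implicit Types z w : R[i].
Local Notation nc := ComplexField.Normc.normc.
Local Open Scope complex_scope.

Lemma normc_ge0 z : 0 <= nc z.
Proof. by case: z => a b; exact: sqrtr_ge0. Qed.

Lemma normc_re z : `|complex.Re z| <= nc z.
Proof.
by case: z => a b /=; rewrite -sqrtr_sqr ler_sqrt ?addr_ge0 ?sqr_ge0// lerDl sqr_ge0.
Qed.

Lemma normc_im z : `|complex.Im z| <= nc z.
Proof.
by case: z => a b /=; rewrite -sqrtr_sqr ler_sqrt ?addr_ge0 ?sqr_ge0// lerDr sqr_ge0.
Qed.

Lemma normc_le z : nc z <= `|complex.Re z| + `|complex.Im z|.
Proof.
case: z => a b /=; rewrite -(ler_pXn2r (n := 2)) ?nnegrE ?addr_ge0 ?sqrtr_ge0//.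
rewrite sqr_sqrtr ?addr_ge0 ?sqr_ge0// sqrrD !real_normK ?num_real//.
by rewrite addrAC lerDl mulrn_wge0// mulr_ge0.
Qed.

Lemma normc_sqr z : nc z ^+ 2 = complex.Re z ^+ 2 + complex.Im z ^+ 2.
Proof. by case: z => a b /=; rewrite sqr_sqrtr// addr_ge0 ?sqr_ge0. Qed.

Lemma normcX z n : nc (z ^+ n) = nc z ^+ n.
Proof.
elim: n => [|n IH]; first by rewrite !expr0 ComplexField.Normc.normc1.
by rewrite !exprS ComplexField.Normc.normcM IH.
Qed.

Lemma normc_real (x : R) : nc x%:C = `|x|.
Proof. by rewrite /= expr0n /= addr0 sqrtr_sqr. Qed.

Lemma ReD z w : complex.Re (z + w) = complex.Re z + complex.Re w.
Proof. by case: z w => ? ? [? ?]. Qed.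

Lemma ImD z w : complex.Im (z + w) = complex.Im z + complex.Im w.
Proof. by case: z w => ? ? [? ?]. Qed.

Lemma ReM z w : complex.Re (z * w) =
  complex.Re z * complex.Re w - complex.Im z * complex.Im w.
Proof. by case: z w => ? ? [? ?]. Qed.

Lemma ImM z w : complex.Im (z * w) =
  complex.Re z * complex.Im w + complex.Im z * complex.Re w.
Proof. by case: z w => ? ? [? ?]. Qed.

Lemma Re_sum (n : nat) (f : nat -> R[i]) :
  complex.Re (\sum_(i < n) f i) = \sum_(i < n) complex.Re (f i).
Proof. by elim: n => [|n IH]; rewrite ?big_ord0// !big_ord_recr/= ReD IH. Qed.

(** By Pascal's rule the remainder r(m, n) satisfies r(m + 1, n + 1) = r(m + 1, n) + w r(m, n),
    which carries the bound through a double induction. The factor (1 + |w|) ^ n is harmless where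
    the bound is applied, because part of a Gaussian weight absorbs it. *)
Lemma binomial_remainder (w : R[i]) (m n : nat) :
  nc ((1 + w) ^+ n - \sum_(j < m) 'C(n, j)%:R * w ^+ j) <=
  (n%:R * nc w) ^+ m * (1 + nc w) ^+ n.
Proof.
have nw := normc_ge0 w.
elim: m n => [|m IH] n.
  rewrite big_ord0 subr0 expr0 mul1r normcX lerXn2r ?nnegrE ?normc_ge0 ?addr_ge0//.
  by apply: (le_trans (le_normcD _ _)); rewrite ComplexField.Normc.normc1.
elim: n => [|n IHn].
  rewrite big_ord_recl /= bin0 expr0 big1; last by move=> i _; rewrite bin0n /= mul0r.
  by rewrite !expr0 mulr1 addr0 subrr ComplexField.Normc.normc0 mul0r expr0n /= mul0r.
have -> : (1 + w) ^+ n.+1 - \sum_(j < m.+1) 'C(n.+1, j)%:R * w ^+ j =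
   ((1 + w) ^+ n - \sum_(j < m.+1) 'C(n, j)%:R * w ^+ j) +
   w * ((1 + w) ^+ n - \sum_(j < m) 'C(n, j)%:R * w ^+ j).
  rewrite [in LHS]big_ord_recl [X in _ = _ - X + _]big_ord_recl /= !bin0.
  have -> : \sum_(i < m) 'C(n.+1, bump 0 i)%:R * w ^+ bump 0 i =
    \sum_(i < m) 'C(n, bump 0 i)%:R * w ^+ bump 0 i +
    w * \sum_(i < m) 'C(n, i)%:R * w ^+ i.
    rewrite mulr_sumr -big_split /=; apply: eq_bigr => i _.
    by rewrite /bump /= add1n binS natrD exprS; ring.
  by rewrite exprS; ring.
apply: (le_trans (le_normcD _ _)); rewrite ComplexField.Normc.normcM.
apply: (@le_trans _ _ ((n%:R * nc w) ^+ m.+1 * (1 + nc w) ^+ n +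
   nc w * ((n%:R * nc w) ^+ m * (1 + nc w) ^+ n))).
  by apply: lerD => //; rewrite ler_wpM2l.
set x := nc w in nw *.
have n0 : 0 <= n%:R :> R by [].
apply: (@le_trans _ _ (((n.+1)%:R * x) ^+ m.+1 * (1 + x) ^+ n)); last first.
  by rewrite ler_wpM2l ?exprn_ge0 ?mulr_ge0// exprS ler_peMl ?exprn_ge0 ?addr_ge0// lerDl.
(* What remains is n ^ (m + 1) + n ^ m <= (n + 1) ^ (m + 1), multiplied by x ^ (m + 1). *)
rewrite mulrA -mulrDl ler_wpM2r ?exprn_ge0 ?addr_ge0//.
rewrite [X in _ <= X]exprMn -natr1 [(n%:R + 1) ^+ _]exprS.
rewrite [X in X + _]exprMn [in X in _ + X]exprMn (exprS x) (exprS n%:R).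
have : n%:R ^+ m <= (n%:R + 1) ^+ m :> R by rewrite lerXn2r ?nnegrE ?addr_ge0// lerDl.
have : 0 <= x ^+ m by rewrite exprn_ge0.
have : 0 <= n%:R ^+ m :> R by rewrite exprn_ge0.
move: (_ ^+ m) (_ ^+ m) (_ ^+ m) => c b a a0 b0 ac.
rewrite -subr_ge0.
have -> : (n%:R + 1) * c * (x * b) - (n%:R * a * (x * b) + x * (a * b)) =
  (n%:R + 1) * (c - a) * (x * b) by ring.
apply: mulr_ge0; last exact: mulr_ge0.
by apply: mulr_ge0; [rewrite addr_ge0|rewrite subr_ge0].
Qed.

End complex_facts.

(** * Asymptotic expansions *)

Section small_polynomials.
Context {R : realType}.
Implicit Types p q : {poly R}.

Lemma horner_bounded p : exists2 B : R, 0 <= B &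
  forall t : R, `|t| <= 1 -> `|p.[t]| <= B.
Proof.
exists (\sum_(i < size p) `|p`_i|) => [|t t1]; first exact: sumr_ge0.
rewrite horner_coef; apply: (le_trans (ler_norm_sum _ _ _)); apply: ler_sum => i _.
by rewrite normrM normrX ler_piMr// exprn_ile1.
Qed.

Lemma le0_of_le_natV (a K : R) : (forall n, (0 < n)%N -> a <= K / n%:R) -> a <= 0.
Proof.
move=> H; rewrite leNgt; apply/negP => a0.
have K0 : 0 <= K by have := H 1%N isT; rewrite divr1; lra.
pose n := (Num.truncn (K / a)).+1.
have := H n isT; rewrite ler_pdivlMr ?ltr0n// leNgt => /negP; apply.
rewrite -ltr_pdivrMl// mulrC; exact: truncnS_gt.
Qed.

Lemma normV_nat_le1 n : (0 < n)%N -> `|n%:R^-1 : R| <= 1.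
Proof. by move=> n0; rewrite ger0_norm ?invr_ge0// invf_le1 ?ltr0n// ler1n. Qed.

(** The constant coefficient is the limit of p at 1 / n, hence 0; dividing by X lowers both the
    degree shift and the power of n by one. This uniqueness makes expansions of different orders
    compatible, and it also shows that Taylor polynomials inherit the order of vanishing of their
    function. *)
Lemma poly_small_coef p (N : nat) (K : R) :
  (forall n, (0 < n)%N -> `|p.[n%:R^-1]| <= K / n%:R ^+ N) ->
  forall i, (i < N)%N -> p`_i = 0.
Proof.
elim: N p => [//|N IH] p H.
have K0 : 0 <= K.
  by have := H 1%N isT; rewrite expr1n divr1; exact: le_trans.
have E : p = (p`_0)%:P + drop_poly 1 p * 'X.
  rewrite -{1}(poly_take_drop 1 p) expr1; congr (_ + _).
  by apply/polyP => -[|i]; rewrite coef_take_poly coefC.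
have [B B0 HB] := horner_bounded (drop_poly 1 p).
have p00 : p`_0 = 0.
  apply/normr0_eq0/eqP; rewrite eq_le normr_ge0 andbT.
  apply: (@le0_of_le_natV _ (K + B)) => n n0.
  have n0R : 0 < n%:R :> R by rewrite ltr0n.
  have h1 := H n n0.
  have h2 : `|p.[n%:R^-1] - p`_0| <= B / n%:R.
    rewrite E !hornerE /= coefD coefC coefMX /= addr0 addrAC subrr add0r normrM.
    rewrite ler_pM// ?HB ?normV_nat_le1// ger0_norm// invr_ge0 ltW//.
  have h3 : K / n%:R ^+ N.+1 <= K / n%:R.
    rewrite ler_wpM2l// lef_pV2 ?posrE ?exprn_gt0// exprS ler_peMr ?(ltW n0R)//.
    by rewrite exprn_ege1// ler1n.
  rewrite mulrDl; have := ler_normB (p.[n%:R^-1]) (p.[n%:R^-1] - p`_0).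
  by rewrite opprB addrC subrK; lra.
case=> [//|i] iN; rewrite -addn1 -coef_drop_poly; apply: IH => // n n0.
have n0R : 0 < n%:R :> R by rewrite ltr0n.
have h := H n n0; rewrite {1}E p00 !hornerE /= normrM in h.
have n0' : n%:R != 0 :> R by rewrite gt_eqF.
rewrite [X in _ * X]ger0_norm ?invr_ge0 ?(ltW n0R)// ler_pdivrMr// in h.
apply: (le_trans h); rewrite exprS invfM -mulrA [_^-1 * _ * _]mulrAC mulVf// mul1r.
by [].
Qed.

(** The polynomial may change with k, but two expansions agree below the smaller order, by
    [poly_small_coef], so that they patch together into one sequence. *)
Lemma asymptotic_coefficients (a : nat -> R) (v : R) :
  (forall k, exists p : {poly R}, p.[0] = v /\ exists K, forall n, (0 < n)%N ->
     `|a n - p.[n%:R^-1]| <= K / n%:R ^+ k) ->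
  exists b : nat -> R, b 0%N = v /\ forall k, exists K, forall n, (0 < n)%N ->
     `|a n - \sum_(i < k) b i / n%:R ^+ i| <= K / n%:R ^+ k.
Proof.
move=> /choice[P HP].
(* An error O(n^{-k}) fixes only the coefficients of index below k; hence b_i is read off at order i
   + 1. *)
exists (fun i => (P i.+1)`_i); split.
  by rewrite -horner_coef0; have [] := HP 1%N.
move=> k; have [_ [K HK]] := HP k.
have cP i : (i < k)%N -> (P k)`_i = (P i.+1)`_i.
  move=> ik; have [_ [K' HK']] := HP i.+1.
  apply/eqP; rewrite -subr_eq0 -coefB.
  apply/eqP/(@poly_small_coef _ i.+1 (K + K')) => // n n0.
  have n0R : 0 < n%:R :> R by rewrite ltr0n.
  have K0 : 0 <= K.
    by have := HK 1%N isT; rewrite expr1n divr1; exact: le_trans.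
  have h1 := HK n n0; have h2 := HK' n n0.
  have h3 : K / n%:R ^+ k <= K / n%:R ^+ i.+1.
    by rewrite ler_wpM2l// lef_pV2 ?posrE ?exprn_gt0// ler_weXn2l// ler1n.
  rewrite !hornerE mulrDl.
  have := ler_normB (a n - (P i.+1).[n%:R^-1]) (a n - (P k).[n%:R^-1]).
  have -> : a n - (P i.+1).[n%:R^-1] - (a n - (P k).[n%:R^-1]) =
    (P k).[n%:R^-1] - (P i.+1).[n%:R^-1] by ring.
  lra.
have [B B0 HB] := horner_bounded (drop_poly k (P k)).
exists (K + B) => n n0.
have n0R : 0 < n%:R :> R by rewrite ltr0n.
have h : `|(P k).[n%:R^-1] - \sum_(i < k) (P i.+1)`_i / n%:R ^+ i| <= B / n%:R ^+ k.
  rewrite -[in X in `|X - _|](poly_take_drop k (P k)) hornerD hornerM hornerXn.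
  have -> : (take_poly k (P k)).[n%:R^-1] = \sum_(i < k) (P i.+1)`_i / n%:R ^+ i.
    rewrite /take_poly horner_poly; apply: eq_bigr => i _.
    by rewrite cP// exprVn.
  rewrite addrAC subrr add0r normrM ler_pM// ?HB ?normV_nat_le1//.
  by rewrite exprVn ger0_norm// invr_ge0 exprn_ge0// ltW.
rewrite mulrDl (le_trans _ (lerD (HK n n0) h))// (le_trans _ (ler_normD _ _))//.
by rewrite addrA subrK.
Qed.

End small_polynomials.

(** * Taylor polynomials of exp, cos and sin by repeated integration *)

Section taylor_polynomials.
Context {R : realType}.

Definition primitive_poly (p : {poly R}) (c : R) : {poly R} :=
  \poly_(i < (size p).+1) (if i is j.+1 then p`_j / j.+1%:R else c).

Lemma deriv_primitive_poly p c : (primitive_poly p c)^`() = p.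
Proof.
apply/polyP => i; rewrite coef_deriv coef_poly ltnS /=.
case: ltnP => ip; last by rewrite mul0rn nth_default.
by rewrite -[LHS]mulr_natr mulfVK// pnatr_eq0.
Qed.

Lemma primitive_poly0 p c : (primitive_poly p c).[0] = c.
Proof. by rewrite horner_coef0 coef_poly. Qed.

(** The mean value theorem writes F x as f z times x with |z| <= |x|, which gains one power of |x|.
    The factor 1 / (N + 1) of an actual integration is given up, as sharp Taylor constants have no
    influence on the expansion. *)
Lemma derive_bound (F f : R -> R) (K : R) (N : nat) (x : R) :
  (forall y : R, is_derive y (1 : R) F (f y)) -> F 0 = 0 ->
  (forall y, `|y| <= `|x| -> `|f y| <= K * `|y| ^+ N) ->
  `|F x| <= K * `|x| ^+ N.+1.
Proof.
move=> dF F0 H.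
have cF : continuous F.
  move=> y; apply: differentiable_continuous; apply/derivable1_diffP.
  by have := dF y => -[].
have KN y : `|y| <= `|x| -> `|f y| <= K * `|x| ^+ N.
  move=> yx; apply: (le_trans (H _ yx)).
  have [x0|x0] := eqVneq x 0.
    by move: yx; rewrite x0 normr0 normr_le0 => /eqP ->; rewrite normr0.
  apply: ler_wpM2l; last by rewrite lerXn2r ?nnegrE.
  have : 0 <= K * `|x| ^+ N by apply: le_trans (H x _).
  by rewrite pmulr_lge0// exprn_gt0 ?normr_gt0.
suff [z zx E] : exists2 z, `|z| <= `|x| & F x = f z * x.
  by rewrite E normrM exprSr mulrA ler_wpM2r// KN.
have [x0|x0] := leP 0 x.
  have [z] := @MVT_segment _ F f 0 x x0 (fun y _ => dF y) (continuous_subspaceT cF).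
  rewrite in_itv/= F0 !subr0 => /andP[z0 zx] E; exists z => //.
  by rewrite !ger0_norm.
have [z] := @MVT_segment _ F f x 0 (ltW x0) (fun y _ => dF y) (continuous_subspaceT cF).
rewrite in_itv/= F0 !sub0r => /andP[zx z0] E; exists z.
  by rewrite !ler0_norm ?(ltW x0)// lerN2.
by rewrite -[LHS]opprK E mulrN opprK.
Qed.

Lemma primitive_taylor (f g : R -> R) (p : {poly R}) (K : R) (N : nat) (x : R) :
  (forall y : R, is_derive y (1 : R) f (g y)) ->
  (forall y, `|y| <= `|x| -> `|g y - p.[y]| <= K * `|y| ^+ N) ->
  `|f x - (primitive_poly p (f 0)).[x]| <= K * `|x| ^+ N.+1.
Proof.
move=> df H.
apply: (@derive_bound (fun y => f y - (primitive_poly p (f 0)).[y]) _ K N x _ _ H).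
  move=> y; have := is_deriveB (df y) (is_derive_poly (primitive_poly p (f 0)) y).
  by rewrite deriv_primitive_poly.
by rewrite primitive_poly0 subrr.
Qed.

Lemma expR_taylor (N : nat) : exists p : {poly R}, forall x,
  `|expR x - p.[x]| <= expR `|x| * `|x| ^+ N.
Proof.
elim: N => [|N [p Hp]].
  by exists 0 => x; rewrite horner0 subr0 expr0 mulr1 ger0_norm ?expR_ge0// ler_expR ler_norm.
exists (primitive_poly p (expR 0)) => x.
apply: (@primitive_taylor expR expR) => y yx.
apply: (le_trans (Hp y)); rewrite ler_wpM2r ?exprn_ge0//.
by rewrite ler_expR.
Qed.

Lemma cos_sin_taylor (N : nat) : exists p q : {poly R},
  (forall x, `|cos x - p.[x]| <= `|x| ^+ N) /\
  (forall x, `|sin x - q.[x]| <= `|x| ^+ N).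
Proof.
elim: N => [|N [p [q [Hp Hq]]]].
  exists 0, 0; split=> x; rewrite horner0 subr0 expr0.
    by rewrite ler_norml cos_geN1 cos_le1.
  by rewrite ler_norml sin_geN1 sin_le1.
exists (primitive_poly (- q) (cos 0)), (primitive_poly p (sin 0)); split=> x.
  have := @primitive_taylor cos (fun y => - sin y) (- q) 1 N x.
  rewrite mul1r; apply => y _; rewrite mul1r.
  by rewrite hornerN -opprD normrN.
have := @primitive_taylor sin cos p 1 N x.
by rewrite mul1r; apply => y _; rewrite mul1r.
Qed.

Lemma sin_bound1 (x : R) : `|sin x| <= `|x|.
Proof.
have := @derive_bound sin cos 1 0 x; rewrite mul1r expr1; apply; last 2 first.
- by rewrite sin0.
- by move=> y _; rewrite mul1r expr0 ler_norml cos_geN1 cos_le1.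
Qed.

Lemma cos_bound2 (x : R) : `|cos x - 1| <= `|x| ^+ 2.
Proof.
have := @derive_bound (fun y => cos y - 1) (fun y => - sin y) 1 1 x.
rewrite mul1r; apply.
- by move=> y; apply: trigger_derive; rewrite subr0.
- by rewrite cos0 subrr.
- by move=> y _; rewrite mul1r expr1 normrN sin_bound1.
Qed.

Lemma sin_bound3 (x : R) : `|sin x - x| <= `|x| ^+ 3.
Proof.
have := @derive_bound (fun y => sin y - y) (fun y => cos y - 1) 1 2 x.
rewrite mul1r; apply.
- by rewrite sin0 subrr.
- by move=> y _; rewrite mul1r cos_bound2.
Qed.

Lemma cos_bound3 (x : R) : `|cos x - 1 + 2^-1 * x ^+ 2| <= `|x| ^+ 3.
Proof.
have cos_bound1 (y : R) : `|cos y - 1| <= `|y|.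
  have := @derive_bound (fun z => cos z - 1) (fun z => - sin z) 1 0 y.
  rewrite mul1r expr1; apply.
  - by move=> z; apply: trigger_derive; rewrite subr0.
  - by rewrite cos0 subrr.
  - by move=> z _; rewrite mul1r expr0 normrN ler_norml sin_geN1 sin_le1.
have sin_bound2 (y : R) : `|sin y - y| <= `|y| ^+ 2.
  have := @derive_bound (fun z => sin z - z) (fun z => cos z - 1) 1 1 y.
  rewrite mul1r; apply.
  - by rewrite sin0 subrr.
  - by move=> z _; rewrite mul1r cos_bound1.
have := @derive_bound (fun z => cos z - 1 + 2^-1 * z ^+ 2) (fun z => z - sin z) 1 2 x.
rewrite mul1r; apply.
- move=> z; apply: trigger_derive; rewrite /GRing.scale /=; by field.
- by rewrite cos0 subrr expr0n /= mulr0 addr0.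
- by move=> y _; rewrite mul1r distrC sin_bound2.
Qed.

End taylor_polynomials.

(** * Functions with Taylor expansions of every order at 0 *)

Section taylor_germs.
Context {R : realType}.
Implicit Types f g : R -> R.

(** Expansions of every order on [-1, 1], without mention of derivatives: this form is stable under
    sums and products, and for a characteristic function it follows from the existence of
    moments. *)
Definition taylor0 f := forall N : nat, exists p : {poly R}, exists2 K : R,
  0 <= K & forall t, `|t| <= 1 -> `|f t - p.[t]| <= K * `|t| ^+ N.

Lemma taylor0_horner (p : {poly R}) : taylor0 (horner p).
Proof. by move=> N; exists p, 0 => // t _; rewrite subrr normr0 mul0r. Qed.

Lemma taylor0_bounded f : taylor0 f ->
  exists2 B : R, 0 <= B & forall t, `|t| <= 1 -> `|f t| <= B.
Proof.
move=> /(_ 0%N)[p [K K0 H]]; have [B B0 HB] := horner_bounded p.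
exists (K + B) => [|t t1]; first exact: addr_ge0.
have := H t t1; rewrite expr0 mulr1 => h.
by rewrite -[f t](subrK p.[t]) (le_trans (ler_normD _ _))// lerD// HB.
Qed.

Lemma taylor0D f g : taylor0 f -> taylor0 g -> taylor0 (fun t => f t + g t).
Proof.
move=> F G N; have [p [K K0 H]] := F N; have [q [L L0 HL]] := G N.
exists (p + q), (K + L) => [|t t1]; first exact: addr_ge0.
rewrite hornerD opprD addrACA (le_trans (ler_normD _ _))// mulrDl.
by rewrite lerD ?H ?HL.
Qed.

Lemma taylor0M f g : taylor0 f -> taylor0 g -> taylor0 (fun t => f t * g t).
Proof.
move=> F G N; have [p [K K0 H]] := F N; have [q [L L0 HL]] := G N.
have [B B0 HB] := taylor0_bounded F; have [C C0 HC] := horner_bounded q.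
exists (p * q), (B * L + K * C) => [|t t1]; first by rewrite addr_ge0 ?mulr_ge0.
rewrite hornerM.
have -> : f t * g t - p.[t] * q.[t] = f t * (g t - q.[t]) + (f t - p.[t]) * q.[t] by ring.
rewrite (le_trans (ler_normD _ _))// [(_ + _) * `|t| ^+ _]mulrDl !normrM lerD//.
  by rewrite -mulrA ler_pM ?HB ?HL.
by rewrite mulrAC ler_pM ?HC ?H.
Qed.

Lemma taylor0_eq f g : f =1 g -> taylor0 f -> taylor0 g.
Proof. by move=> /funext ->. Qed.

Lemma taylor0N f : taylor0 f -> taylor0 (fun t => - f t).
Proof.
move=> F; have := taylor0M (taylor0_horner (-1)%:P) F; apply: taylor0_eq => t.
by rewrite hornerC mulN1r.
Qed.

Lemma taylor0_cst (c : R) : taylor0 (fun=> c).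
Proof. by have := taylor0_horner c%:P; apply: taylor0_eq => t; rewrite hornerC. Qed.

Lemma taylor0_id : taylor0 id.
Proof. by have := taylor0_horner 'X; apply: taylor0_eq => t; rewrite hornerX. Qed.

Lemma taylor0_gauss (c : R) : taylor0 (fun t => expR (c * t ^+ 2)).
Proof.
move=> N; have [p Hp] := @expR_taylor R N.
exists (p \Po (c *: 'X^2)), (expR `|c| * `|c| ^+ N) => [|t t1].
  by rewrite mulr_ge0 ?expR_ge0 ?exprn_ge0.
rewrite horner_comp hornerZ hornerXn (le_trans (Hp _))// normrM.
rewrite exprMn mulrA; apply: ler_pM; rewrite ?mulr_ge0 ?expR_ge0 ?exprn_ge0//.
  rewrite ler_wpM2r ?exprn_ge0// ler_expR ler_piMr// normrX exprn_ile1//.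
apply: lerXn2r; rewrite ?nnegrE// normrX expr2; exact: ler_piMr.
Qed.

Definition ctaylor0 (f : R -> R[i]) :=
  taylor0 (fun t => complex.Re (f t)) /\ taylor0 (fun t => complex.Im (f t)).

Lemma ctaylor0M (f g : R -> R[i]) : ctaylor0 f -> ctaylor0 g ->
  ctaylor0 (fun t => f t * g t).
Proof.
move=> [F1 F2] [G1 G2]; split.
  have := taylor0D (taylor0M F1 G1) (taylor0N (taylor0M F2 G2)).
  by apply: taylor0_eq => t; rewrite ReM.
have := taylor0D (taylor0M F1 G2) (taylor0M F2 G1).
by apply: taylor0_eq => t; rewrite ImM.
Qed.

Lemma ctaylor0D (f g : R -> R[i]) : ctaylor0 f -> ctaylor0 g ->
  ctaylor0 (fun t => f t + g t).
Proof.
move=> [F1 F2] [G1 G2]; split.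
  by have := taylor0D F1 G1; apply: taylor0_eq => t; rewrite ReD.
by have := taylor0D F2 G2; apply: taylor0_eq => t; rewrite ImD.
Qed.

Lemma ctaylor0_real f : taylor0 f -> ctaylor0 (fun t => (f t)%:C%C).
Proof. by move=> F; split; [apply: taylor0_eq F|exact: taylor0_cst]. Qed.

Lemma ctaylor0X (f : R -> R[i]) n : ctaylor0 f -> ctaylor0 (fun t => f t ^+ n).
Proof.
move=> F; elim: n => [|n IH]; first exact: (ctaylor0_real (taylor0_cst 1)).
have := ctaylor0M F IH.
by rewrite (_ : (fun t => f t * f t ^+ n) = (fun t => f t ^+ n.+1))//; apply/funext => t; rewrite exprS.
Qed.

Lemma ctaylor0_bounded (f : R -> R[i]) : ctaylor0 f ->
  exists2 B : R, 0 <= B & forall t, `|t| <= 1 -> ComplexField.Normc.normc (f t) <= B.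
Proof.
move=> [F1 F2]; have [B B0 HB] := taylor0_bounded F1; have [C C0 HC] := taylor0_bounded F2.
exists (B + C) => [|t t1]; first exact: addr_ge0.
by rewrite (le_trans (normc_le _))// lerD ?HB ?HC.
Qed.

End taylor_germs.

(** * Gaussian moments, complete and truncated *)

Section gauss_moments.
Context {R : realType}.
Local Notation mu := (@lebesgue_measure R).

Definition gauss_moment (a : nat) (c : R) : R :=
  \int[mu]_t (`|t| ^+ a * expR (- (c * t ^+ 2))).

Lemma gauss_moment0_gt0 (c : R) : 0 < c -> 0 < gauss_moment 0 c.
Proof.
move=> c0; have l0 : Num.sqrt c != 0 by rewrite gt_eqF// sqrtr_gt0.
have := Rintegral_scale l0 (@integrableT_gauss R).
rewrite /Rintegral integralT_gauss /= => E.
rewrite /gauss_moment (@eq_Rintegral _ _ _ mu setT (fun t => gauss_fun (Num.sqrt c * t))).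
  by rewrite /Rintegral E mulr_gt0// ?invr_gt0 ?normr_gt0// sqrtr_gt0 pi_gt0.
by move=> t _; rewrite /gauss_fun expr0 mul1r exprMn sqr_sqrtr// ltW.
Qed.

Lemma gauss_moment_ge0 a c : 0 <= gauss_moment a c.
Proof. by apply: Rintegral_ge0 => x _; rewrite mulr_ge0 ?exprn_ge0 ?expR_ge0. Qed.

Lemma sqrtn_gt0 n : (0 < n)%N -> 0 < Num.sqrt n%:R :> R.
Proof. by move=> n0; rewrite sqrtr_gt0 ltr0n. Qed.

Lemma gauss_integrandE (a n : nat) (c t : R) : (0 < n)%N ->
  `|t| ^+ a * expR (- (n%:R * c * t ^+ 2)) = (Num.sqrt n%:R ^+ a)^-1 *
    (`|Num.sqrt n%:R * t| ^+ a * expR (- (c * (Num.sqrt n%:R * t) ^+ 2))).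
Proof.
move=> n0; have s0 : 0 < Num.sqrt n%:R :> R := sqrtn_gt0 n0.
rewrite normrM (gtr0_norm s0) !exprMn sqr_sqrtr// !mulrA mulVf ?expf_neq0 ?gt_eqF//.
by rewrite mul1r [c * _]mulrC.
Qed.

Lemma integrable_gauss_scaled (a n : nat) (c : R) : (0 < n)%N -> 0 < c ->
  mu.-integrable setT (EFin \o (fun t : R => `|t| ^+ a * expR (- (n%:R * c * t ^+ 2)))).
Proof. by move=> n0 c0; apply: integrable_gauss_moment; rewrite mulr_gt0// ltr0n. Qed.

Lemma gauss_moment_scaled (a n : nat) (c : R) : (0 < n)%N -> 0 < c ->
  \int[mu]_t (`|t| ^+ a * expR (- (n%:R * c * t ^+ 2))) =
  gauss_moment a c / Num.sqrt n%:R ^+ a.+1.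
Proof.
move=> n0 c0; have s0 : 0 < Num.sqrt n%:R :> R := sqrtn_gt0 n0.
have s0' : Num.sqrt n%:R != 0 :> R by rewrite gt_eqF.
under eq_Rintegral do rewrite gauss_integrandE//.
rewrite RintegralZl//; last first.
  exact: (integrable_scale s0' (integrable_gauss_moment a c0)).
rewrite (Rintegral_scale s0' (integrable_gauss_moment a c0)).
rewrite gtr0_norm// exprSr invfM /gauss_moment; ring.
Qed.

(** The substitution t -> -t, applied to the function restricted to the symmetric interval, shows
    that the integral equals its opposite. *)
Lemma gauss_moment_odd (a n : nat) (c de : R) : odd a -> 0 < de -> (0 < n)%N -> 0 < c ->
  \int[mu]_(t in `[- de, de]) (t ^+ a * expR (- (n%:R * c * t ^+ 2))) = 0.
Proof.
move=> oa de0 n0 c0.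
rewrite Rintegral_mkcond; set f := (X in Rintegral _ _ X).
have fi : mu.-integrable setT (EFin \o f).
  apply: (@integrable_le _ _ R mu setT _ (fun t : R => `|t| ^+ a * expR (- (n%:R * c * t ^+ 2)))) => //.
  - rewrite /f; apply/measurable_restrict => //.
    apply: measurable_funTS; apply: measurable_funM; first exact: measurable_funX.
    apply: measurableT_comp => //; apply: measurableT_comp => //.
    by apply: measurable_funM => //; exact: measurable_funX.
  - move=> t _; rewrite /f patchE; case: ifP => _.
      by rewrite normrM normrX [X in _ * X]ger0_norm ?expR_ge0.
    by rewrite normr0 mulr_ge0 ?exprn_ge0 ?expR_ge0.
  - exact: integrable_gauss_scaled.
have n1 : (-1 : R) != 0 by rewrite oppr_eq0 oner_eq0.
have := Rintegral_scale n1 fi.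
rewrite normrN1 invr1 mul1r (@eq_Rintegral _ _ _ mu setT (fun t => (-1) * f t)); last first.
  move=> t _; rewrite /f !patchE !mulN1r (_ : (- t \in _) = (t \in `[- de, de]%classic)).
    case: ifP => _; last by rewrite oppr0.
    by rewrite sqrrN exprNn -signr_odd oa expr1 mulN1r mulNr.
  by apply/idP/idP; rewrite !inE/= !in_itv/= => /andP[h1 h2]; apply/andP; split; lra.
rewrite RintegralZl// mulN1r; lra.
Qed.

(** Where |t| > de one has 1 <= (|t| / de) ^ (2 L), so that the missing part is at most a complete
    moment of order a + 2 L, whose scaling in n gains n^{-L}. Any power of decay is obtained in this
    way without estimating Gaussian tails. *)
Lemma gauss_moment_trunc (a L n : nat) (c de : R) : ~~ odd a -> 0 < de -> (0 < n)%N -> 0 < c ->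
  `|Num.sqrt n%:R * (\int[mu]_(t in `[- de, de]) (t ^+ a * expR (- (n%:R * c * t ^+ 2)))) -
    gauss_moment a c / n%:R ^+ a./2| <=
  gauss_moment (a + 2 * L) c / de ^+ (2 * L) / n%:R ^+ L.
Proof.
move=> ea de0 n0 c0; have s0 : 0 < Num.sqrt n%:R :> R := sqrtn_gt0 n0.
have n0R : 0 < n%:R :> R by rewrite ltr0n.
have sE m : Num.sqrt n%:R ^+ (2 * m) = n%:R ^+ m :> R by rewrite exprM sqr_sqrtr.
have aE : a = (2 * a./2)%N by rewrite mul2n -[LHS]odd_double_half (negPf ea).
pose g (t : R) := `|t| ^+ a * expR (- (n%:R * c * t ^+ 2)).
pose G (t : R) := (de ^+ (2 * L))^-1 * (`|t| ^+ (a + 2 * L) * expR (- (n%:R * c * t ^+ 2))).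
have absE (t : R) : `|t| ^+ a = t ^+ a by rewrite aE !exprM real_normK ?num_real.
have -> : \int[mu]_(t in `[- de, de]) (t ^+ a * expR (- (n%:R * c * t ^+ 2))) =
    \int[mu]_(t in `[- de, de]) g t.
  by apply: eq_Rintegral => t _; rewrite /g absE.
have gi : mu.-integrable setT (EFin \o g) by exact: integrable_gauss_scaled.
have Gi : mu.-integrable setT (EFin \o G).
  have := integrableZl measurableT (de ^+ (2 * L))^-1 (integrable_gauss_scaled (a + 2 * L) n0 c0).
  by apply: eq_integrable.
have -> : gauss_moment a c / n%:R ^+ a./2 = Num.sqrt n%:R * \int[mu]_t g t.
  rewrite /g gauss_moment_scaled// exprS (_ : _ ^+ a = n%:R ^+ a./2); last by rewrite {1}aE sE.
  by field; rewrite !gt_eqF ?exprn_gt0.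
rewrite -mulrBr normrM gtr0_norm//.
have mI : measurable (`[- de, de]%classic : set (measurableTypeR R)) by exact: measurable_itv.
rewrite Rintegral_mkcond -RintegralB//; last first.
  by rewrite -restrict_EFin; apply/(integrable_mkcond _ mI).1; exact: integrableS gi.
have : `|\int[mu]_t ((g \_ `[- de, de]) t - g t)| <= \int[mu]_t G t.
  apply: le_norm_Rintegral => //.
    have mg : measurable_fun setT g by apply/measurable_EFinP; exact: (measurable_int mu).
    apply: measurable_funB => //; apply/measurable_restrict => //.
    exact: measurable_funS mg.
  move=> t _; rewrite patchE.
  case: ifPn => [_|]; first by rewrite subrr normr0 /G !mulr_ge0 ?invr_ge0 ?exprn_ge0 ?expR_ge0// ltW.
  move=> tde; rewrite sub0r normrN ger0_norm /g /G; last by rewrite mulr_ge0 ?exprn_ge0 ?expR_ge0.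
  rewrite [leRHS]mulrA; apply: ler_wpM2r; first exact: expR_ge0.
  rewrite exprD mulrCA; apply: ler_peMr; first exact: exprn_ge0.
  rewrite mulrC ler_pdivlMr ?exprn_gt0// mul1r; apply: lerXn2r; rewrite ?nnegrE ?(ltW de0)//.
  rewrite leNgt; apply/negP => tl; move/negP: tde; apply.
  by rewrite inE/= in_itv/= -ler_norml ltW.
move=> H; apply: (le_trans (ler_wpM2l (ltW s0) H)).
rewrite /G RintegralZl//; last exact: integrable_gauss_scaled.
rewrite gauss_moment_scaled// exprS.
have -> : Num.sqrt n%:R * ((de ^+ (2 * L))^-1 *
  (gauss_moment (a + 2 * L) c / (Num.sqrt n%:R * Num.sqrt n%:R ^+ (a + 2 * L)))) =
  gauss_moment (a + 2 * L) c / de ^+ (2 * L) / Num.sqrt n%:R ^+ (a + 2 * L).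
  by field; rewrite !gt_eqF ?exprn_gt0.
rewrite ler_wpM2l ?divr_ge0 ?gauss_moment_ge0 ?exprn_ge0 ?(ltW de0)//.
rewrite lef_pV2 ?posrE ?exprn_gt0// aE -mulnDr sE ler_weXn2l ?ler1n// leq_addl//.
Qed.

End gauss_moments.

(** * Expansions in powers of 1 / n *)

Section inverse_power_expansions.
Context {R : realType}.
Local Notation mu := (@lebesgue_measure R).

(** The leading coefficient [v] is recorded apart because the positivity of b_0 is read off it. The
    degree of the polynomial is free: its terms of degree k and above are of the size of the
    error. *)
Definition inv_expansion (k : nat) (a : nat -> R) (v : R) :=
  exists p : {poly R}, p.[0] = v /\ exists K : R, forall n, (0 < n)%N ->
    `|a n - p.[n%:R^-1]| <= K / n%:R ^+ k.

Lemma inv_expansionW k l (a : nat -> R) v : (k <= l)%N ->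
  inv_expansion l a v -> inv_expansion k a v.
Proof.
move=> kl [p [pv [K H]]]; exists p; split => //; exists K => n n0.
apply: (le_trans (H n n0)).
have K0 : 0 <= K by have := H 1%N isT; rewrite expr1n divr1; exact: le_trans.
by rewrite ler_wpM2l// lef_pV2 ?posrE ?exprn_gt0 ?ltr0n// ler_weXn2l// ler1n.
Qed.

Lemma inv_expansion_approx k (a b : nat -> R) v (L : R) : inv_expansion k a v ->
  (forall n, (0 < n)%N -> `|b n - a n| <= L / n%:R ^+ k) -> inv_expansion k b v.
Proof.
move=> [p [pv [K H]]] ab; exists p; split => //; exists (L + K) => n n0.
by rewrite -[b n](subrK (a n)) -addrA (le_trans (ler_normD _ _))// mulrDl lerD ?ab ?H.
Qed.

Lemma inv_expansionD k (a b : nat -> R) v w : inv_expansion k a v ->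
  inv_expansion k b w -> inv_expansion k (fun n => a n + b n) (v + w).
Proof.
move=> [p [pv [K H]]] [q [qw [L HL]]]; exists (p + q); split.
  by rewrite hornerD pv qw.
exists (K + L) => n n0.
by rewrite hornerD opprD addrACA (le_trans (ler_normD _ _))// mulrDl lerD ?H ?HL.
Qed.

Lemma inv_expansion0 k : inv_expansion k (fun=> 0) 0.
Proof.
exists 0; split; first by rewrite horner0.
by exists 0 => n n0; rewrite horner0 subrr normr0 mul0r.
Qed.

Lemma inv_expansion_sum k (m : nat) (a : nat -> nat -> R) (v : nat -> R) :
  (forall j, (j < m)%N -> inv_expansion k (a j) (v j)) ->
  inv_expansion k (fun n => \sum_(j < m) a j n) (\sum_(j < m) v j).
Proof.
elim: m => [|m IH] H.
  rewrite (_ : (fun=> _) = fun=> 0) ?big_ord0; first exact: inv_expansion0.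
  by apply/funext => n; rewrite big_ord0.
rewrite (_ : (fun=> _) = fun n => \sum_(j < m) a j n + a m n); last first.
  by apply/funext => n; rewrite big_ord_recr.
rewrite big_ord_recr /=; apply: inv_expansionD; last exact: H.
by apply: IH => j jm; apply: H; exact: ltnW.
Qed.

(** From (j + 1) C(n, j + 1) = (n - j) C(n, j): the ratio C(n, j) / n ^ j gains the factor (1 - j /
    n) / (j + 1) at each step. For n <= j both sides of the recurrence vanish. *)
Lemma binomial_inv_poly (j : nat) : exists p : {poly R},
  (j = 0%N -> p = 1) /\ forall n, (0 < n)%N -> 'C(n, j)%:R = n%:R ^+ j * p.[n%:R^-1].
Proof.
elim: j => [|j [p [_ Hp]]].
  by exists 1; split => // n n0; rewrite bin0 expr0 hornerC mulr1.
exists (p * ((j.+1%:R)^-1 *: (1 - j%:R *: 'X))); split => // n n0.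
have n0R : n%:R != 0 :> R by rewrite pnatr_eq0 -lt0n.
have j0R : j.+1%:R != 0 :> R by rewrite pnatr_eq0.
rewrite hornerM hornerZ hornerD hornerN hornerZ hornerX hornerC.
have -> : n%:R ^+ j.+1 * (p.[n%:R^-1] * (j.+1%:R^-1 * (1 - j%:R / n%:R))) =
  j.+1%:R^-1 * ((n%:R - j%:R) * (n%:R ^+ j * p.[n%:R^-1])).
  by rewrite exprS; field; rewrite n0R addrC natr1 j0R.
rewrite -Hp//; apply: (mulfI j0R); rewrite mulVKf// -natrM mul_bin_left natrM.
have [nj|jn] := ltnP n j; first by rewrite (bin_small nj) !mulr0.
by rewrite natrB.
Qed.

(** The binomial coefficient contributes n ^ j and the moment n^{-i/2}. As q vanishes for i < 3 j
    and odd powers integrate to 0, only even i >= 3 j remain: i / 2 - j is then a natural number,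
    and it is 0 only for i = j = 0. *)
Lemma binomial_gauss_expansion (k j i : nat) (q c de : R) : 0 < c -> 0 < de ->
  ((i < 3 * j)%N -> q = 0) ->
  inv_expansion k (fun n => 'C(n, j)%:R * q * (Num.sqrt n%:R *
     \int[mu]_(t in `[- de, de]) (t ^+ i * expR (- (n%:R * c * t ^+ 2)))))
   (if (j == 0%N) && (i == 0%N) then q * gauss_moment 0 c else 0).
Proof.
move=> c0 de0 q0.
have zero_case : (forall n, (0 < n)%N -> 'C(n, j)%:R * q * (Num.sqrt n%:R *
     \int[mu]_(t in `[- de, de]) (t ^+ i * expR (- (n%:R * c * t ^+ 2)))) = 0) ->
   (if (j == 0%N) && (i == 0%N) then q * gauss_moment 0 c else 0) = 0 ->
   inv_expansion k (fun n => 'C(n, j)%:R * q * (Num.sqrt n%:R *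
     \int[mu]_(t in `[- de, de]) (t ^+ i * expR (- (n%:R * c * t ^+ 2)))))
   (if (j == 0%N) && (i == 0%N) then q * gauss_moment 0 c else 0).
  move=> H ->; apply: (@inv_expansion_approx _ (fun=> 0) _ _ 0); first exact: inv_expansion0.
  by move=> n n0; rewrite H// subrr normr0 mul0r.
have [ij|ij] := ltnP i (3 * j).
  apply: zero_case => [n n0|]; first by rewrite q0// mulr0 mul0r.
  by rewrite q0// mul0r if_same.
have [oi|ei] := boolP (odd i).
  apply: zero_case => [n n0|]; first by rewrite gauss_moment_odd// !mulr0.
  by case: (i) oi => [//|i' _]; rewrite andbF.
have [p [p1 Hp]] := binomial_inv_poly j.
have [B B0 HB] := horner_bounded p.
have ij2 : (j <= i./2)%N.
  by have := even_halfK ei; lia.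
pose d := (i./2 - j)%N.
have id : i./2 = (j + d)%N by rewrite subnKC.
exists ((q * gauss_moment i c) *: (p * 'X^d)); split.
  rewrite hornerZ hornerM hornerXn.
  have [d0|d0] := posnP d.
    have i0 : i = 0%N by have := even_halfK ei; lia.
    have j0 : j = 0%N by lia.
    by rewrite d0 p1// j0 i0 !eqxx hornerC expr0 !mulr1.
  rewrite expr0n (gtn_eqF d0) !mulr0.
  by case: ifP => // /andP[/eqP j0 /eqP i0]; move: d0; rewrite /d j0 i0.
exists (B * `|q| * (gauss_moment (i + 2 * (j + k)) c / de ^+ (2 * (j + k)))) => n n0.
have n0R : 0 < n%:R :> R by rewrite ltr0n.
(* The truncation error is taken of order j + k because the binomial coefficient costs n ^ j. *)
have := @gauss_moment_trunc R i (j + k) n c de ei de0 n0 c0.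
set A := Num.sqrt _ * _; set M := _ / de ^+ _ => H.
rewrite Hp// hornerZ hornerM hornerXn.
have -> : n%:R ^+ j * p.[n%:R^-1] * q * A -
    q * gauss_moment i c * (p.[n%:R^-1] * n%:R^-1 ^+ d) =
   n%:R ^+ j * p.[n%:R^-1] * q * (A - gauss_moment i c / n%:R ^+ i./2).
  rewrite id exprD exprVn; field.
  by rewrite !expf_neq0 ?gt_eqF.
rewrite !normrM (ger0_norm (exprn_ge0 j (ltW n0R))).
apply: (@le_trans _ _ (n%:R ^+ j * B * `|q| * (M / n%:R ^+ (j + k)))).
  apply: ler_pM; rewrite ?mulr_ge0 ?exprn_ge0 ?(ltW n0R)//.
  by rewrite ler_wpM2r// ler_wpM2l ?exprn_ge0 ?(ltW n0R)// HB// normV_nat_le1.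
rewrite exprD le_eqVlt; apply/orP; left; apply/eqP; field.
by rewrite !expf_neq0 ?gt_eqF.
Qed.

End inverse_power_expansions.

(** * Laplace's method for integrals of n-th powers *)

Section laplace_method.
Context {R : realType}.
Local Notation mu := (@lebesgue_measure R).
Local Notation nc := ComplexField.Normc.normc.
Local Open Scope complex_scope.

(** With y = s2 t ^ 2 / 2, phi e ^ y - 1 = (phi - (1 - y)) e ^ y + ((1 - y) e ^ y - 1). The first
    summand is O(t ^ 3) by hypothesis, and the second is at most y ^ 2 e ^ y in absolute value,
    which is of order t ^ 4. *)
Lemma gauss_correction (s2 K : R) (phi : R -> R[i]) : 0 < s2 -> 0 <= K ->
  (forall t, `|t| <= 1 -> nc (phi t - (1 - s2 / 2 * t ^+ 2)%:C) <= K * `|t| ^+ 3) ->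
  forall t, `|t| <= 1 -> nc (phi t * (expR (s2 / 2 * t ^+ 2))%:C - 1) <=
    (K + (s2 / 2) ^+ 2) * expR (s2 / 2) * `|t| ^+ 3.
Proof.
move=> s0 K0 H t t1; set y := s2 / 2 * t ^+ 2.
have y0 : 0 <= y by rewrite mulr_ge0 ?sqr_ge0// divr_ge0// ltW.
have t21 : t ^+ 2 <= 1 by rewrite -real_normK ?num_real// exprn_ile1.
have ys : y <= s2 / 2 by rewrite ler_piMr// divr_ge0// ltW.
have e1 : expR y <= expR (s2 / 2) by rewrite ler_expR.
have -> : phi t * (expR y)%:C - 1 =
  (phi t - (1 - y)%:C) * (expR y)%:C + ((1 - y) * expR y - 1)%:C.
  by rewrite mulrBl -rmorphM rmorphB rmorph1 addrA subrK.
apply: (le_trans (le_normcD _ _)).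
have -> : (K + (s2 / 2) ^+ 2) * expR (s2 / 2) * `|t| ^+ 3 =
  K * expR (s2 / 2) * `|t| ^+ 3 + (s2 / 2) ^+ 2 * expR (s2 / 2) * `|t| ^+ 3 by ring.
rewrite lerD//.
  rewrite ComplexField.Normc.normcM normc_real ger0_norm ?expR_ge0// mulrAC.
  by apply: ler_pM; rewrite ?normc_ge0 ?expR_ge0// H.
rewrite normc_real.
have ey : (1 + y) <= expR y := expR_ge1Dx y.
have eny : (1 - y) * expR y <= 1.
  have := expR_ge1Dx (- y); rewrite expRN => h.
  by rewrite -ler_pdivlMr ?expR_gt0// mul1r.
rewrite ler0_norm ?subr_le0// opprB.
apply: (@le_trans _ _ (y ^+ 2 * expR y)).
  (* The left-hand side is 1 + y ^ 3, so that 1 <= e ^ y (1 - y + y ^ 2). *)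
  have : (1 + y) * (1 - y + y ^+ 2) <= expR y * (1 - y + y ^+ 2).
    by rewrite ler_wpM2r//; have := sqr_ge0 (y - 1); have := sqr_ge0 y; nra.
  have : 0 <= y ^+ 3 by rewrite exprn_ge0.
  nra.
rewrite /y exprMn -/y.
have s20 : 0 <= s2 / 2 by rewrite divr_ge0// ltW.
rewrite [leRHS]mulrAC; apply: ler_pM; rewrite ?(mulr_ge0 (sqr_ge0 _) (sqr_ge0 _)) ?expR_ge0//.
rewrite ler_wpM2l ?sqr_ge0// -(real_normK (num_real t)) -exprM.
by rewrite ler_wiXn2l.
Qed.

Lemma measurable_reimX (f : R -> R[i]) n :
  measurable_fun setT (fun t => complex.Re (f t)) ->
  measurable_fun setT (fun t => complex.Im (f t)) ->
  measurable_fun setT (fun t => complex.Re (f t ^+ n)) /\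
  measurable_fun setT (fun t => complex.Im (f t ^+ n)).
Proof.
move=> mr mi; elim: n => [|n [IH1 IH2]]; first by split; exact: measurable_cst.
split.
- rewrite (_ : (fun=> _) = fun t => complex.Re (f t) * complex.Re (f t ^+ n) -
     complex.Im (f t) * complex.Im (f t ^+ n)).
    by apply: measurable_funB; exact: measurable_funM.
  by apply/funext => t; rewrite exprS ReM.
- rewrite (_ : (fun=> _) = fun t => complex.Re (f t) * complex.Im (f t ^+ n) +
     complex.Im (f t) * complex.Re (f t ^+ n)).
    by apply: measurable_funD; exact: measurable_funM.
  by apply/funext => t; rewrite exprS ImM.
Qed.

Lemma measurable_reM (f g : R -> R[i]) :
  measurable_fun setT (fun t => complex.Re (f t)) ->
  measurable_fun setT (fun t => complex.Im (f t)) ->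
  measurable_fun setT (fun t => complex.Re (g t)) ->
  measurable_fun setT (fun t => complex.Im (g t)) ->
  measurable_fun setT (fun t => complex.Re (f t * g t)).
Proof.
move=> f1 f2 g1 g2.
rewrite (_ : (fun=> _) = fun t => complex.Re (f t) * complex.Re (g t) -
  complex.Im (f t) * complex.Im (g t)).
  by apply: measurable_funB; exact: measurable_funM.
by apply/funext => t; rewrite ReM.
Qed.

Lemma laplace_expansion (phi g : R -> R[i]) (s2 K : R) : 0 < s2 ->
  measurable_fun setT (fun t => complex.Re (phi t)) ->
  measurable_fun setT (fun t => complex.Im (phi t)) ->
  measurable_fun setT (fun t => complex.Re (g t)) ->
  measurable_fun setT (fun t => complex.Im (g t)) ->
  ctaylor0 phi -> ctaylor0 g -> 0 <= K ->
  (forall t, `|t| <= 1 -> nc (phi t - (1 - s2 / 2 * t ^+ 2)%:C) <= K * `|t| ^+ 3) ->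
  exists de : R, 0 < de <= 1 /\ forall k, inv_expansion k (fun n => Num.sqrt n%:R *
      \int[mu]_(t in `[- de, de]) complex.Re (g t * phi t ^+ n))
    (complex.Re (g 0) * gauss_moment 0 (s2 / 2)).
Proof.
move=> s0 mp1 mp2 mg1 mg2 Tphi Tg K0 Hphi.
have c0 : 0 < s2 / 2 by rewrite divr_gt0.
have c20 : 0 < s2 / 4 by rewrite divr_gt0.
pose w t := phi t * (expR (s2 / 2 * t ^+ 2))%:C - 1.
pose K3 := (K + (s2 / 2) ^+ 2) * expR (s2 / 2).
have K30 : 0 <= K3 by rewrite mulr_ge0 ?expR_ge0// addr_ge0 ?sqr_ge0.
have Hw t : `|t| <= 1 -> nc (w t) <= K3 * `|t| ^+ 3 by exact: gauss_correction.
clearbody K3.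
have Tw : ctaylor0 w.
  apply: ctaylor0D; last by split; exact: taylor0_cst.
  by apply: ctaylor0M => //; apply: ctaylor0_real; exact: taylor0_gauss.
(* With K3 de <= s2 / 4 the factor (1 + |w t|) ^ n is at most exp (n s2 t ^ 2 / 4) on [-de, de]:
   half of the Gaussian exponent is spent on the remainder, and the other half is left for the
   integration. *)
pose de := Num.min 1 (s2 / (4 * (K3 + 1))).
have K31 : 0 < K3 + 1 by rewrite ltr_wpDl.
have de0 : 0 < de by rewrite lt_min ltr01 divr_gt0// mulr_gt0.
have de1 : de <= 1 by rewrite ge_min lexx.
have deK : K3 * de <= s2 / 4.
  have : de <= s2 / (4 * (K3 + 1)) by rewrite ge_min lexx orbT.
  rewrite ler_pdivlMr ?mulr_gt0// => h.
  by rewrite ler_pdivlMr//; apply: le_trans h; nra.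
exists de; split; first by rewrite de0.
(* For k >= 1 the index j = 0 occurs among the j < m and the error |t| ^ (6 k) vanishes at t = 0;
   both serve to identify the leading coefficient. *)
move=> k0; have [k [k1 k0k]] : exists k, (0 < k)%N /\ (k0 <= k)%N by exists k0.+1.
apply: (inv_expansionW k0k) => {k0 k0k}.
(* The remainder after m terms is O(n ^ m |t| ^ (3 m)), which the Gaussian integral and the factor
   sqrt n turn into O(n^{-m/2}); hence m = 2 k, and Taylor order 3 m = 6 k. *)
pose m := (2 * k)%N.
have [Bg Bg0 HBg] := ctaylor0_bounded Tg.
have Tj j : taylor0 (fun t => complex.Re (g t * w t ^+ j)).
  by have [] := ctaylor0M Tg (ctaylor0X j Tw).
have /choice[Q HQ'] : forall j, exists q : {poly R}, exists2 L : R, 0 <= L &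
    forall t, `|t| <= 1 -> `|complex.Re (g t * w t ^+ j) - q.[t]| <= L * `|t| ^+ (6 * k).
  by move=> j; exact: Tj.
have /choice[KQ HQ] : forall j, exists L : R, 0 <= L /\
    forall t, `|t| <= 1 -> `|complex.Re (g t * w t ^+ j) - (Q j).[t]| <= L * `|t| ^+ (6 * k).
  by move=> j; have [L L0 HL] := HQ' j; exists L.
have wj j t : `|t| <= 1 -> `|complex.Re (g t * w t ^+ j)| <= Bg * K3 ^+ j * `|t| ^+ (3 * j).
  move=> t1; apply: (le_trans (normc_re _)).
  rewrite ComplexField.Normc.normcM normcX -mulrA; apply: ler_pM; rewrite ?normc_ge0 ?exprn_ge0 ?normc_ge0 ?HBg//.
  rewrite [X in _ <= _ * X]exprM -exprMn.
  by apply: lerXn2r; rewrite ?nnegrE ?normc_ge0 ?Hw// mulr_ge0 ?exprn_ge0.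
(* Since w = O(t ^ 3), g w ^ j vanishes to order 3 j at 0, and so does its Taylor polynomial;
   [binomial_gauss_expansion] relies on this. *)
have Qsmall j : (j < m)%N -> forall i, (i < 3 * j)%N -> (Q j)`_i = 0.
  move=> jm; apply: (@poly_small_coef _ _ _ (Bg * K3 ^+ j + KQ j)) => n n0.
  have n1 := @normV_nat_le1 R n n0.
  have [L0 HL] := HQ j; have h1 := HL _ n1; have h2 := wj j _ n1.
  have nE i : `|n%:R^-1| ^+ i = (n%:R ^+ i)^-1 :> R.
    by rewrite ger0_norm ?invr_ge0// exprVn.
  rewrite -[_.[_]](subKr (complex.Re (g n%:R^-1 * w n%:R^-1 ^+ j))).
  apply: (le_trans (ler_normB _ _)); rewrite mulrDl -nE lerD//.
  apply: (le_trans h1); apply: ler_wpM2l => //; apply: ler_wiXn2l => //.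
  by move: jm; rewrite /m; clear; lia.
have Q00 : (Q 0%N)`_0 = complex.Re (g 0).
  have [L0 HL] := HQ 0%N; have := HL 0 _; rewrite normr0 => /(_ ler01).
  rewrite expr0n muln_eq0 /= (gtn_eqF k1) mulr0 expr0 mulr1 normr_le0 subr_eq0 => /eqP ->.
  by rewrite horner_coef0.
have /choice[BC HBC] : forall j, exists B : R, 0 <= B /\ forall n, (0 < n)%N ->
    'C(n, j)%:R <= B * n%:R ^+ j.
  move=> j; have [p [_ Hp]] := @binomial_inv_poly R j; have [B B0 HB] := horner_bounded p.
  exists B; split => // n n0; rewrite Hp// mulrC ler_wpM2r ?exprn_ge0//.
  exact: le_trans (ler_norm _) (HB _ (@normV_nat_le1 R n n0)).
pose Kt := Bg * K3 ^+ m + \sum_(j < m) BC j * KQ j.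
have Kt0 : 0 <= Kt.
  rewrite addr_ge0 ?mulr_ge0 ?exprn_ge0// sumr_ge0// => j _.
  by rewrite mulr_ge0//; [have [] := HBC j|have [] := HQ j].
pose F n t := complex.Re (g t * phi t ^+ n).
pose Ej n j t := \sum_(i < (size (Q j)).+1) 'C(n, j)%:R * (Q j)`_i *
   (t ^+ i * expR (- (n%:R * (s2 / 2) * t ^+ 2))).
pose E n t := \sum_(j < m) Ej n j t.
have EE n t : E n t = expR (- (n%:R * (s2 / 2) * t ^+ 2)) * \sum_(j < m) 'C(n, j)%:R * (Q j).[t].
  rewrite mulr_sumr; apply: eq_bigr => j _; rewrite (@horner_coef_wide _ (size (Q j)).+1)//.
  by rewrite mulr_sumr mulr_sumr; apply: eq_bigr => i _; ring.
have FE n t : (0 < n)%N -> `|t| <= de -> `|F n t - E n t| <=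
    Kt * n%:R ^+ m * (`|t| ^+ (6 * k) * expR (- (n%:R * (s2 / 4) * t ^+ 2))).
  move=> n0 tde; have t1 : `|t| <= 1 := le_trans tde de1.
  pose e1 := expR (- (n%:R * (s2 / 2) * t ^+ 2)).
  pose e2 := expR (n%:R * (s2 / 4) * t ^+ 2).
  have phiE : phi t ^+ n = (1 + w t) ^+ n * e1%:C.
    have ee : expR (s2 / 2 * t ^+ 2) ^+ n * e1 = 1.
      by rewrite -expRM_natl /e1 -expRD (_ : _ + _ = 0) ?expR0//; ring.
    rewrite /w addrC subrK exprMn -[RHS]mulrA.
    have -> : (expR (s2 / 2 * t ^+ 2))%:C ^+ n * e1%:C =
        (expR (s2 / 2 * t ^+ 2) ^+ n * e1)%:C by rewrite rmorphM rmorphXn.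
    by rewrite ee mulr1.
  have e2w : (1 + nc (w t)) ^+ n <= e2.
    apply: (@le_trans _ _ (expR (nc (w t)) ^+ n)).
      by apply: lerXn2r; rewrite ?nnegrE ?addr_ge0 ?expR_ge0 ?normc_ge0// expR_ge1Dx.
    rewrite -expRM_natl ler_expR -mulrA ler_wpM2l//.
    apply: (le_trans (Hw t t1)).
    rewrite -(real_normK (num_real t)) exprS mulrA ler_wpM2r ?sqr_ge0//.
    by apply: le_trans deK; rewrite ler_wpM2l.
  have e21 : 1 <= e2 by rewrite -expR0 ler_expR (mulr_ge0 _ (sqr_ge0 _))// (mulr_ge0 _ (ltW c20)).
  (* Two errors are separated: the truncation of the binomial formula, and the replacement of each g
     w ^ j by its Taylor polynomial. Both are O(n ^ m |t| ^ (6 k)) times [e2]. *)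
  have FEE : F n t - E n t = e1 * (complex.Re (g t * ((1 + w t) ^+ n -
       \sum_(j < m) 'C(n, j)%:R * w t ^+ j)) +
       \sum_(j < m) 'C(n, j)%:R * (complex.Re (g t * w t ^+ j) - (Q j).[t])).
    have -> : \sum_(j < m) 'C(n, j)%:R * (complex.Re (g t * w t ^+ j) - (Q j).[t]) =
       complex.Re (g t * \sum_(j < m) 'C(n, j)%:R * w t ^+ j) -
       \sum_(j < m) 'C(n, j)%:R * (Q j).[t].
      under eq_bigr do rewrite mulrBr.
      rewrite sumrB; congr (_ - _).
      rewrite mulr_sumr (@Re_sum _ m (fun j => g t * ('C(n, j)%:R * w t ^+ j))).
      apply: eq_bigr => j _; rewrite mulrCA.
      have -> : ('C(n, j)%:R : R[i]) = ('C(n, j)%:R : R)%:C by rewrite rmorph_nat.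
      by case: (g t * _) => a b /=; rewrite mul0r subr0.
    rewrite EE /F phiE mulrA ReM /= mulr0 subr0 mulrBr ReD.
    have -> : complex.Re (- (g t * \sum_(j < m) 'C(n, j)%:R * w t ^+ j)) =
       - complex.Re (g t * \sum_(j < m) 'C(n, j)%:R * w t ^+ j) by case: (g t * _).
    by rewrite -/e1; ring.
  have nm j : (j < m)%N -> n%:R ^+ j <= n%:R ^+ m :> R.
    by move=> jm; rewrite ler_weXn2l ?ler1n// ltnW.
  have b1 : `|complex.Re (g t * ((1 + w t) ^+ n - \sum_(j < m) 'C(n, j)%:R * w t ^+ j))| <=
      Bg * K3 ^+ m * n%:R ^+ m * `|t| ^+ (6 * k) * e2.
    apply: (le_trans (normc_re _)); rewrite ComplexField.Normc.normcM.
    have -> : Bg * K3 ^+ m * n%:R ^+ m * `|t| ^+ (6 * k) * e2 =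
      Bg * ((n%:R * (K3 * `|t| ^+ 3)) ^+ m * e2).
      rewrite [(n%:R * _) ^+ _]exprMn [(K3 * _) ^+ _]exprMn -exprM (_ : (3 * m = 6 * k)%N); last by rewrite /m; clear; lia.
      by ring.
    apply: ler_pM; rewrite ?normc_ge0 ?HBg//.
    apply: (le_trans (binomial_remainder _ _ _)).
    apply: ler_pM; rewrite ?exprn_ge0 ?mulr_ge0 ?addr_ge0 ?normc_ge0//.
    apply: lerXn2r; rewrite ?nnegrE ?mulr_ge0 ?exprn_ge0 ?normc_ge0//.
    by rewrite ler_wpM2l// Hw.
  have b2 : `|\sum_(j < m) 'C(n, j)%:R * (complex.Re (g t * w t ^+ j) - (Q j).[t])| <=
      (\sum_(j < m) BC j * KQ j) * n%:R ^+ m * `|t| ^+ (6 * k) * e2.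
    apply: (@le_trans _ _ ((\sum_(j < m) BC j * KQ j) * n%:R ^+ m * `|t| ^+ (6 * k))); last first.
      rewrite ler_peMr// ?mulr_ge0 ?exprn_ge0// sumr_ge0// => j _.
      by rewrite mulr_ge0//; [have [] := HBC j|have [] := HQ j].
    apply: (le_trans (ler_norm_sum _ _ _)); rewrite !mulr_suml; apply: ler_sum => j _.
    rewrite normrM ger0_norm//; have [B0 HB] := HBC j; have [L0 HL] := HQ j.
    apply: (@le_trans _ _ ((BC j * n%:R ^+ j) * (KQ j * `|t| ^+ (6 * k)))).
      by apply: ler_pM => //; [exact: HB|exact: HL].
    have -> : BC j * KQ j * n%:R ^+ m * `|t| ^+ (6 * k) =
      (BC j * n%:R ^+ m) * (KQ j * `|t| ^+ (6 * k)) by ring.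
    by rewrite ler_wpM2r ?mulr_ge0 ?exprn_ge0// ler_wpM2l// nm.
  rewrite FEE normrM ger0_norm ?expR_ge0//.
  have -> : expR (- (n%:R * (s2 / 4) * t ^+ 2)) = e1 * e2.
    by rewrite /e1 /e2 -expRD; congr expR; field.
  have -> : Kt * n%:R ^+ m * (`|t| ^+ (6 * k) * (e1 * e2)) =
     e1 * (Bg * K3 ^+ m * n%:R ^+ m * `|t| ^+ (6 * k) * e2 +
      (\sum_(j < m) BC j * KQ j) * n%:R ^+ m * `|t| ^+ (6 * k) * e2).
    by rewrite /Kt; ring.
  rewrite ler_wpM2l ?expR_ge0//; apply: (le_trans (ler_normD _ _)); exact: lerD.
have mI : measurable (`[- de, de]%classic : set (measurableTypeR R)) by exact: measurable_itv.
have iI n j : (0 < n)%N -> mu.-integrable `[- de, de]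
    (EFin \o (fun t : R => t ^+ j * expR (- (n%:R * (s2 / 2) * t ^+ 2)))).
  move=> n0; apply: (@integrable_le _ _ R mu _ _ (fun t : R => `|t| ^+ j * expR (- (n%:R * (s2 / 2) * t ^+ 2)))) => //.
  - apply: measurable_funTS; apply: measurable_funM; first exact: measurable_funX.
    apply: measurableT_comp => //; apply: measurableT_comp => //.
    by apply: measurable_funM => //; exact: measurable_funX.
  - by move=> t _; rewrite normrM normrX [X in _ * X]ger0_norm ?expR_ge0.
  - apply: integrableS (integrable_gauss_scaled j n0 c0) => //.
have iEi n j i : (0 < n)%N -> mu.-integrable `[- de, de] (EFin \o
   (fun t : R => 'C(n, j)%:R * (Q j)`_i * (t ^+ i * expR (- (n%:R * (s2 / 2) * t ^+ 2))))).
  by move=> n0; have := integrableZl mI ('C(n, j)%:R * (Q j)`_i) (iI n i n0); apply: eq_integrable.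
have iEj n j : (0 < n)%N -> mu.-integrable `[- de, de] (EFin \o Ej n j).
  move=> n0; apply: (@integrable_sumf _ _ _ mu _ _ (fun i t => 'C(n, j)%:R * (Q j)`_i *
   (t ^+ i * expR (- (n%:R * (s2 / 2) * t ^+ 2))))) => // i _; exact: iEi.
have iE n : (0 < n)%N -> mu.-integrable `[- de, de] (EFin \o E n).
  by move=> n0; apply: integrable_sumf => // j _; exact: iEj.
have mF n : measurable_fun setT (F n).
  by have [? ?] := measurable_reimX n mp1 mp2; exact: measurable_reM.
have iR n : (0 < n)%N -> mu.-integrable `[- de, de] (EFin \o (fun t : R =>
    Kt * n%:R ^+ m * (`|t| ^+ (6 * k) * expR (- (n%:R * (s2 / 4) * t ^+ 2))))).
  move=> n0; have h := integrableS measurableT mI (@subsetT _ _) (integrable_gauss_scaled (6 * k) n0 c20).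
  by have := integrableZl mI (Kt * n%:R ^+ m) h; apply: eq_integrable.
have FEi n : (0 < n)%N -> forall t, `[- de, de]%classic t -> `|F n t - E n t| <=
    Kt * n%:R ^+ m * (`|t| ^+ (6 * k) * expR (- (n%:R * (s2 / 4) * t ^+ 2))).
  by move=> n0 t; rewrite /= in_itv/= -ler_norml => tde; exact: FE.
have mFE n : (0 < n)%N -> measurable_fun `[- de, de] (fun t => F n t - E n t).
  move=> n0; apply: measurable_funB; first exact: measurable_funTS (mF n).
  by apply/measurable_EFinP; exact: (measurable_int mu) (iE n n0).
have iF n : (0 < n)%N -> mu.-integrable `[- de, de] (EFin \o F n).
  move=> n0; have h := integrable_le mI (mFE n n0) (FEi n n0) (iR n n0).
  have := integrableD mI h (iE n n0); apply: eq_integrable => // t _.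
  by rewrite /= -EFinD subrK.
pose M := gauss_moment (6 * k) (s2 / 4).
have approx n : (0 < n)%N -> `|Num.sqrt n%:R * (\int[mu]_(t in `[- de, de]) F n t) -
     Num.sqrt n%:R * (\int[mu]_(t in `[- de, de]) E n t)| <= Kt * M / n%:R ^+ k.
  move=> n0; have s0' : 0 < Num.sqrt n%:R :> R := @sqrtn_gt0 R n n0.
  have n0R : 0 < n%:R :> R by rewrite ltr0n.
  rewrite -mulrBr normrM gtr0_norm// -RintegralB//; [|exact: iF|exact: iE].
  have h := le_norm_Rintegral mI (mFE n n0) (FEi n n0) (iR n n0).
  apply: (le_trans (ler_wpM2l (ltW s0') h)).
  apply: (@le_trans _ _ (Num.sqrt n%:R * (Kt * n%:R ^+ m *
     \int[mu]_t (`|t| ^+ (6 * k) * expR (- (n%:R * (s2 / 4) * t ^+ 2)))))).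
    rewrite ler_wpM2l ?(ltW s0')// RintegralZl//; last first.
      exact: integrableS measurableT mI (@subsetT _ _) (integrable_gauss_scaled (6 * k) n0 c20).
    rewrite ler_wpM2l ?mulr_ge0 ?exprn_ge0// fine_le//.
    - apply: integrable_fin_num => //.
      exact: integrableS measurableT mI (@subsetT _ _) (integrable_gauss_scaled (6 * k) n0 c20).
    - exact: integrable_fin_num (integrable_gauss_scaled (6 * k) n0 c20).
    - apply: ge0_subset_integral => //.
      exact: (measurable_int mu) (integrable_gauss_scaled (6 * k) n0 c20).
  rewrite gauss_moment_scaled// -/M.
  have -> : Num.sqrt n%:R ^+ (6 * k).+1 = Num.sqrt n%:R * (n%:R ^+ m * n%:R ^+ k) :> R.
    rewrite exprS (_ : (6 * k = 2 * (m + k))%N); last by rewrite /m; clear; lia.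
    by rewrite exprM sqr_sqrtr// exprD.
  rewrite le_eqVlt; apply/orP; left; apply/eqP; field.
  by rewrite !expf_neq0 ?gt_eqF.
apply: inv_expansion_approx approx.
(* Among all pairs (j, i) only (0, 0) contributes to the leading coefficient. *)
have -> : complex.Re (g 0) * gauss_moment 0 (s2 / 2) =
  \sum_(j < m) \sum_(i < (size (Q j)).+1)
    (if (val j == 0%N) && (val i == 0%N) then (Q j)`_i * gauss_moment 0 (s2 / 2) else 0).
  have m1 : m = m.-1.+1 by rewrite /m; move: k1; clear; lia.
  rewrite m1 big_ord_recl [X in _ + X]big1 ?addr0; last by move=> j _; rewrite big1.
  by rewrite big_ord_recl /= [X in _ + X]big1 ?addr0// Q00.
apply: (@inv_expansion_approx _ _ (fun n => \sum_(j < m) \sum_(i < (size (Q j)).+1)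
   'C(n, j)%:R * (Q j)`_i * (Num.sqrt n%:R * \int[mu]_(t in `[- de, de])
     (t ^+ i * expR (- (n%:R * (s2 / 2) * t ^+ 2))))) _ _ 0).
  apply: (@inv_expansion_sum _ _ _ (fun j n => \sum_(i < (size (Q j)).+1)
   'C(n, j)%:R * (Q j)`_i * (Num.sqrt n%:R * \int[mu]_(t in `[- de, de])
     (t ^+ i * expR (- (n%:R * (s2 / 2) * t ^+ 2)))))
    (fun j => \sum_(i < (size (Q j)).+1)
    (if (j == 0%N) && (val i == 0%N) then (Q j)`_i * gauss_moment 0 (s2 / 2) else 0))) => j jm.
  apply: (@inv_expansion_sum _ _ _ (fun i n =>
   'C(n, j)%:R * (Q j)`_i * (Num.sqrt n%:R * \int[mu]_(t in `[- de, de])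
     (t ^+ i * expR (- (n%:R * (s2 / 2) * t ^+ 2)))))
    (fun i => if (j == 0%N) && (i == 0%N) then (Q j)`_i * gauss_moment 0 (s2 / 2) else 0)) => i _.
  by apply: binomial_gauss_expansion => // ij; exact: Qsmall.
move=> n n0; rewrite [X in `|X|](_ : _ = 0) ?normr0 ?mul0r//.
apply/eqP; rewrite subr_eq0; apply/eqP.
rewrite (Rintegral_sum mI (fun j _ => iEj n j n0)) mulr_sumr; apply: eq_bigr => j _.
rewrite /Ej (@Rintegral_sum _ _ _ mu _ _ (fun i t => 'C(n, j)%:R * (Q j)`_i *
   (t ^+ i * expR (- (n%:R * (s2 / 2) * t ^+ 2)))) mI (fun i _ => iEi n j i n0)).
rewrite mulr_sumr; apply: eq_bigr => i _.
by rewrite RintegralZl//; [ring|exact: iI].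
Qed.

End laplace_method.

(** * The Laplace transform of the positive part *)

Section cis.
Context {R : realType}.
Local Notation nc := ComplexField.Normc.normc.
Local Open Scope complex_scope.

Definition cis (x : R) : R[i] := cos x +i* sin x.

Lemma cisD x y : cis (x + y) = cis x * cis y.
Proof. by rewrite /cis cosD sinD; simpc; rewrite [sin x * _ + _]addrC. Qed.

Lemma cis0 : cis 0 = 1.
Proof. by rewrite /cis cos0 sin0. Qed.

Lemma normc_cis x : nc (cis x) = 1.
Proof. by rewrite /= cos2Dsin2 sqrtr1. Qed.

End cis.

(** * The integral of exp (z u) / z ^ 2 over a vertical line *)

Section laplace_kernel.
Context {R : realType}.
Local Notation mu := (@lebesgue_measure R).
Local Notation nc := ComplexField.Normc.normc.
Local Open Scope complex_scope.

Lemma sqrD_gt0 (h t : R) : 0 < h -> 0 < h ^+ 2 + t ^+ 2.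
Proof. by move=> h0; rewrite ltr_pwDl ?sqr_ge0// exprn_gt0. Qed.

Lemma inv_sqr_complexE (h t : R) : 0 < h -> ((h +i* t)^-1) ^+ 2 =
  ((h ^+ 2 - t ^+ 2) * ((h ^+ 2 + t ^+ 2)^-1) ^+ 2) +i*
  (- (2 * h * t * ((h ^+ 2 + t ^+ 2)^-1) ^+ 2)).
Proof.
move=> h0; have n0 : h ^+ 2 + t ^+ 2 != 0 by rewrite gt_eqF// sqrD_gt0.
have -> : (h +i* t)^-1 = (h / (h ^+ 2 + t ^+ 2)) -i* (t / (h ^+ 2 + t ^+ 2)) by [].
rewrite expr2; simpc.
by apply/eqP; rewrite eq_complex /=; apply/andP; split; apply/eqP; field.
Qed.

Lemma normc_inv_sqr (h t : R) : 0 < h -> nc (((h +i* t)^-1) ^+ 2) = (h ^+ 2 + t ^+ 2)^-1.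
Proof.
move=> h0; rewrite normcX ComplexField.Normc.normcV exprVn normc_sqr //=.
Qed.

(** The real part of exp (z u) / z ^ 2 at z = h + i t. The imaginary part, defined next, is its
    harmonic conjugate and serves to turn derivatives in h into derivatives in t. *)
Definition lap_kernel (h u t : R) : R :=
  expR (h * u) * complex.Re (cis (t * u) * ((h +i* t)^-1) ^+ 2).

Definition lap_kernel_im (h u t : R) : R :=
  expR (h * u) * complex.Im (cis (t * u) * ((h +i* t)^-1) ^+ 2).

Lemma lap_kernelE h u t : 0 < h -> lap_kernel h u t = expR (h * u) *
  (cos (t * u) * ((h ^+ 2 - t ^+ 2) * ((h ^+ 2 + t ^+ 2)^-1) ^+ 2) +
   sin (t * u) * (2 * h * t * ((h ^+ 2 + t ^+ 2)^-1) ^+ 2)).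
Proof.
by move=> h0; rewrite /lap_kernel inv_sqr_complexE// ReM /= mulrN opprK.
Qed.

Lemma lap_kernel_imE h u t : 0 < h -> lap_kernel_im h u t = expR (h * u) *
  (sin (t * u) * ((h ^+ 2 - t ^+ 2) * ((h ^+ 2 + t ^+ 2)^-1) ^+ 2) -
   cos (t * u) * (2 * h * t * ((h ^+ 2 + t ^+ 2)^-1) ^+ 2)).
Proof.
by move=> h0; rewrite /lap_kernel_im inv_sqr_complexE// ImM /=; congr (_ * _); ring.
Qed.

Lemma lap_kernel_bound h u t : 0 < h ->
  `|lap_kernel h u t| <= expR (h * u) * (h ^+ 2 + t ^+ 2)^-1.
Proof.
move=> h0; rewrite normrM ger0_norm ?expR_ge0// ler_wpM2l ?expR_ge0//.
apply: (le_trans (normc_re _)).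
by rewrite ComplexField.Normc.normcM normc_cis mul1r normc_inv_sqr.
Qed.

Lemma lap_kernel_im_bound h u t : 0 < h ->
  `|lap_kernel_im h u t| <= expR (h * u) * (h ^+ 2 + t ^+ 2)^-1.
Proof.
move=> h0; rewrite normrM ger0_norm ?expR_ge0// ler_wpM2l ?expR_ge0//.
apply: (le_trans (normc_im _)).
by rewrite ComplexField.Normc.normcM normc_cis mul1r normc_inv_sqr.
Qed.

Lemma inv_sqrD_le (h t : R) : 0 < h ->
  (h ^+ 2 + t ^+ 2)^-1 <= (1 + (h ^+ 2)^-1) * (1 + t ^+ 2)^-1.
Proof.
move=> h0; have h20 : 0 < h ^+ 2 by rewrite exprn_gt0.
have t20 := sqr_ge0 t; have d0 := sqrD_gt0 t h0.
rewrite ler_pdivlMr ?ltr_pwDl// mulrC ler_pdivrMr// mulrDl mul1r mulrDr mulVf ?gt_eqF//.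
have : 0 <= (h ^+ 2)^-1 * t ^+ 2 by rewrite mulr_ge0// invr_ge0 ltW.
lra.
Qed.

Lemma measurable_inv_sqrD (h : R) : 0 < h ->
  measurable_fun (setT : set R) (fun t : R => (h ^+ 2 + t ^+ 2)^-1).
Proof.
move=> h0; apply: continuous_measurable_fun => t.
apply: cvgV; first by rewrite gt_eqF// sqrD_gt0.
by apply: cvgD; [exact: cvg_cst|exact: exprn_continuous].
Qed.

Lemma integrable_inv_sqrD (h : R) : 0 < h ->
  mu.-integrable setT (EFin \o (fun t : R => (h ^+ 2 + t ^+ 2)^-1)).
Proof.
move=> h0; apply: (@integrable_le _ _ R mu setT _
   (fun t : R => (1 + (h ^+ 2)^-1) * (1 + t ^+ 2)^-1)) => //.
- exact: measurable_inv_sqrD.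
- move=> t _; rewrite ger0_norm ?invr_ge0 ?(ltW (sqrD_gt0 _ _))//; exact: inv_sqrD_le.
- have := integrableZl measurableT (1 + (h ^+ 2)^-1) (@integrable_oneDsqrV R).
  by apply: eq_integrable.
Qed.

Lemma is_derive_inv_sqrD_r (h t : R) : 0 < h ->
  is_derive t (1 : R) (fun t => (h ^+ 2 + t ^+ 2)^-1) (- (2 * t) * ((h ^+ 2 + t ^+ 2)^-1) ^+ 2).
Proof.
move=> h0; have n0 : h ^+ 2 + t ^+ 2 != 0 by rewrite gt_eqF// sqrD_gt0.
have H : is_derive t (1 : R) (fun t => h ^+ 2 + t ^+ 2) (2 * t).
  by apply: trigger_derive; rewrite /GRing.scale /=; ring.
have := @is_deriveV R (fun t => h ^+ 2 + t ^+ 2) t (2 * t) 1 n0 H.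
move/trigger_derive; apply; rewrite /GRing.scale /=; field.
by rewrite n0.
Qed.

Lemma is_derive_inv_sqrD_l (h t : R) : 0 < h ->
  is_derive h (1 : R) (fun h => (h ^+ 2 + t ^+ 2)^-1) (- (2 * h) * ((h ^+ 2 + t ^+ 2)^-1) ^+ 2).
Proof.
move=> h0; have n0 : h ^+ 2 + t ^+ 2 != 0 by rewrite gt_eqF// sqrD_gt0.
have H : is_derive h (1 : R) (fun h => h ^+ 2 + t ^+ 2) (2 * h).
  by apply: trigger_derive; rewrite /GRing.scale /=; ring.
have := @is_deriveV R (fun h => h ^+ 2 + t ^+ 2) h (2 * h) 1 n0 H.
move/trigger_derive; apply; rewrite /GRing.scale /=; field.
by rewrite n0.
Qed.

(* The real part of the derivative of [z |-> exp (z * u) / z ^ 2] at [h + i t]. *)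
Definition lap_kernel' (h u t : R) : R :=
  let q := (h ^+ 2 + t ^+ 2)^-1 in expR (h * u) *
  (u * (cos (t * u) * ((h ^+ 2 - t ^+ 2) * q ^+ 2) +
   sin (t * u) * (2 * h * t * q ^+ 2)) +
   cos (t * u) * (h * (6 * t ^+ 2 - 2 * h ^+ 2) * q ^+ 3) -
   sin (t * u) * (t * (6 * h ^+ 2 - 2 * t ^+ 2) * q ^+ 3)).

Lemma is_derive_lap_kernel_im (h u t : R) : 0 < h ->
  is_derive t (1 : R) (lap_kernel_im h u) (lap_kernel' h u t).
Proof.
move=> h0; have n0 : h ^+ 2 + t ^+ 2 != 0 by rewrite gt_eqF// sqrD_gt0.
have Hq := is_derive_inv_sqrD_r t h0.
rewrite (_ : lap_kernel_im h u = fun t => expR (h * u) *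
  (sin (t * u) * ((h ^+ 2 - t ^+ 2) * ((h ^+ 2 + t ^+ 2)^-1) ^+ 2) -
   cos (t * u) * (2 * h * t * ((h ^+ 2 + t ^+ 2)^-1) ^+ 2))); last first.
  by apply/funext => x; exact: lap_kernel_imE.
apply: trigger_derive; rewrite /lap_kernel' /GRing.scale /=; field.
exact: n0.
Qed.

Lemma is_derive_lap_kernel (h u t : R) : 0 < h ->
  is_derive h (1 : R) (fun h => lap_kernel h u t) (lap_kernel' h u t).
Proof.
move=> h0; have n0 : h ^+ 2 + t ^+ 2 != 0 by rewrite gt_eqF// sqrD_gt0.
have Hq := is_derive_inv_sqrD_l t h0.
pose f (h : R) := expR (h * u) *
  (cos (t * u) * ((h ^+ 2 - t ^+ 2) * ((h ^+ 2 + t ^+ 2)^-1) ^+ 2) +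
   sin (t * u) * (2 * h * t * ((h ^+ 2 + t ^+ 2)^-1) ^+ 2)).
have H : is_derive h (1 : R) f (lap_kernel' h u t).
  apply: trigger_derive; rewrite /lap_kernel' /GRing.scale /=; field.
  exact: n0.
apply: near_eq_is_derive H.
near=> x; rewrite /f lap_kernelE//.
by near: x; exact: lt_nbhsr.
Unshelve. all: by end_near. Qed.

(** The complex derivative is u exp (z u) / z ^ 2 - 2 exp (z u) / z ^ 3, and 1 / |z| <= 1 / h; the
    constants 2 and 12 come from bounding the coordinates one by one. The bound is integrable in t
    and locally uniform in h > 0, as differentiation under the integral demands. *)
Lemma lap_kernel'_bound (h u t : R) : 0 < h ->
  `|lap_kernel' h u t| <= expR (h * u) * (2 * `|u| + 12 / h) * (h ^+ 2 + t ^+ 2)^-1.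
Proof.
move=> h0; have d0 := sqrD_gt0 t h0.
rewrite /lap_kernel' normrM ger0_norm ?expR_ge0// -[leRHS]mulrA ler_wpM2l ?expR_ge0//.
set d := h ^+ 2 + t ^+ 2 in d0 *.
have q0 : 0 < d^-1 by rewrite invr_gt0.
have cos1 : `|cos (t * u)| <= 1 by rewrite ler_norml cos_geN1 cos_le1.
have sin1 : `|sin (t * u)| <= 1 by rewrite ler_norml sin_geN1 sin_le1.
have t20 := sqr_ge0 t; have h20 := sqr_ge0 h.
have b1 : `|(h ^+ 2 - t ^+ 2) * d^-1 ^+ 2| <= d^-1.
  rewrite normrM [X in _ * X]ger0_norm ?exprn_ge0 ?(ltW q0)// expr2 mulrA ler_piMl ?(ltW q0)//.
  by rewrite ler_pdivrMr// mul1r ler_norml /d; apply/andP; split; lra.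
have b2 : `|2 * h * t * d^-1 ^+ 2| <= d^-1.
  rewrite normrM [X in _ * X]ger0_norm ?exprn_ge0 ?(ltW q0)// expr2 mulrA ler_piMl ?(ltW q0)//.
  rewrite ler_pdivrMr// mul1r ler_norml /d.
  by have := sqr_ge0 (h - t); have := sqr_ge0 (h + t); rewrite sqrrB sqrrD => *; apply/andP; split; lra.
have b3 : `|h * (6 * t ^+ 2 - 2 * h ^+ 2) * d^-1 ^+ 3| <= 6 / h * d^-1.
  rewrite (_ : h * _ * _ = ((6 * t ^+ 2 - 2 * h ^+ 2) * d^-1) * (h * d^-1) * d^-1); last by ring.
  rewrite normrM [X in _ * X]ger0_norm ?(ltW q0)// ler_wpM2r ?(ltW q0)// normrM.
  apply: ler_pM => //.
    by rewrite normrM (gtr0_norm q0) ler_pdivrMr// ler_norml /d; apply/andP; split; lra.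
  rewrite (ger0_norm (mulr_ge0 (ltW h0) (ltW q0))) ler_pdivrMr// ler_pdivlMl// /d.
  by rewrite -expr2; lra.
have b4 : `|t * (6 * h ^+ 2 - 2 * t ^+ 2) * d^-1 ^+ 3| <= 6 / h * d^-1.
  rewrite (_ : t * _ * _ = ((6 * h ^+ 2 - 2 * t ^+ 2) * d^-1) * (t * d^-1) * d^-1); last by ring.
  rewrite normrM [X in _ * X]ger0_norm ?(ltW q0)// ler_wpM2r ?(ltW q0)// normrM.
  apply: ler_pM => //.
    by rewrite normrM (gtr0_norm q0) ler_pdivrMr// ler_norml /d; apply/andP; split; lra.
  rewrite normrM (gtr0_norm q0) ler_pdivrMr// ler_pdivlMl// /d -(real_normK (num_real t)).
  by have := sqr_ge0 (h - `|t|); have := sqr_ge0 (h + `|t|); rewrite sqrrB sqrrD => *; lra.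
have mul1 (x y z : R) : `|x| <= 1 -> `|y| <= z -> `|x * y| <= z.
  by move=> x1 yz; rewrite normrM -[leRHS]mul1r ler_pM.
have c1 := mul1 _ _ _ cos1 b1; have c2 := mul1 _ _ _ sin1 b2.
have c3 := mul1 _ _ _ cos1 b3; have c4 := mul1 _ _ _ sin1 b4.
have -> : (2 * `|u| + 12 / h) * d^-1 =
  `|u| * (d^-1 + d^-1) + 6 / h * d^-1 + 6 / h * d^-1 by ring.
apply: (le_trans (ler_normB _ _)); apply: lerD => //.
apply: (le_trans (ler_normD _ _)); apply: lerD => //.
rewrite normrM ler_wpM2l//; apply: (le_trans (ler_normD _ _)); exact: lerD.
Qed.

Lemma continuous_lap_kernel' (h u : R) : 0 < h -> continuous (lap_kernel' h u).
Proof.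
move=> h0 t; have Hq := is_derive_inv_sqrD_r t h0.
apply: differentiable_continuous; apply/derivable1_diffP.
by rewrite /lap_kernel' /=; apply: ex_derive.
Qed.

Lemma measurable_lap_kernel (h u : R) : 0 < h ->
  measurable_fun (setT : set R) (lap_kernel h u).
Proof.
move=> h0; apply: continuous_measurable_fun => t; have Hq := is_derive_inv_sqrD_r t h0.
rewrite (_ : lap_kernel h u = fun t => expR (h * u) *
  (cos (t * u) * ((h ^+ 2 - t ^+ 2) * ((h ^+ 2 + t ^+ 2)^-1) ^+ 2) +
   sin (t * u) * (2 * h * t * ((h ^+ 2 + t ^+ 2)^-1) ^+ 2))); last first.
  by apply/funext => x; exact: lap_kernelE.
apply: differentiable_continuous; apply/derivable1_diffP.
by apply: ex_derive.
Qed.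

Lemma integrable_lap_kernel (h u : R) : 0 < h ->
  mu.-integrable setT (EFin \o lap_kernel h u).
Proof.
move=> h0; apply: (@integrable_le _ _ R mu setT _
   (fun t : R => expR (h * u) * (h ^+ 2 + t ^+ 2)^-1)) => //.
- exact: measurable_lap_kernel.
- by move=> t _; exact: lap_kernel_bound.
- have := integrableZl measurableT (expR (h * u)) (integrable_inv_sqrD h0).
  by apply: eq_integrable.
Qed.

Lemma cvg0_of_le_natV (f : nat -> R) (K : R) :
  (forall n, (0 < n)%N -> `|f n| <= K / n%:R) -> f n @[n --> \oo] --> (0 : R).
Proof.
move=> H; apply/cvgr0Pnorm_le => e e0; near=> n.
have n0 : (0 < n)%N by near: n; exact: nbhs_infty_gt.
apply: (le_trans (H n n0)); rewrite ler_pdivrMr ?ltr0n// -ler_pdivrMl// mulrC.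
by near: n; exact: nbhs_infty_ger.
Unshelve. all: by end_near. Qed.

Lemma lap_kernel'_integral (h u : R) : 0 < h -> \int[mu]_t lap_kernel' h u t = 0.
Proof.
move=> h0.
have dec (s : R) n : (0 < n)%N -> s ^+ 2 = n%:R ^+ 2 ->
    `|lap_kernel_im h u s| <= expR (h * u) / n%:R.
  move=> n0 sn; apply: (le_trans (lap_kernel_im_bound u s h0)).
  rewrite ler_wpM2l ?expR_ge0// sn lef_pV2 ?posrE ?ltr_pwDl ?exprn_gt0 ?sqr_ge0 ?ltr0n//.
  have : n%:R <= n%:R ^+ 2 :> R by rewrite expr2 ler_peMr// ler1n.
  have := sqr_ge0 h; lra.
apply: (@Rintegral_derive0 R (lap_kernel_im h u) (lap_kernel' h u)).
- by move=> t; exact: is_derive_lap_kernel_im.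
- exact: continuous_lap_kernel'.
- apply: (@integrable_le _ _ R mu setT _
   (fun t : R => expR (h * u) * (2 * `|u| + 12 / h) * (h ^+ 2 + t ^+ 2)^-1)) => //.
  + by apply: continuous_measurable_fun; exact: continuous_lap_kernel'.
  + by move=> t _; exact: lap_kernel'_bound.
  + have := integrableZl measurableT (expR (h * u) * (2 * `|u| + 12 / h)) (integrable_inv_sqrD h0).
    by apply: eq_integrable.
- by apply: (@cvg0_of_le_natV _ (expR (h * u))) => n n0; apply: dec.
- by apply: (@cvg0_of_le_natV _ (expR (h * u))) => n n0; apply: dec => //; rewrite sqrrN.
Qed.

Definition lap_integral (h u : R) : R := \int[mu]_t lap_kernel h u t.

(* By the Cauchy-Riemann equations, the h-derivative of the kernel is the t-derivative
   of [lap_kernel_im], which vanishes at infinity. *)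
Lemma is_derive_lap_integral (h u : R) : 0 < h ->
  is_derive h (1 : R) (fun h => lap_integral h u) 0.
Proof.
(* The interval ]h / 2, h + 1[ is bounded and stays away from the pole z = 0, so that one dominating
   function serves for all of it. *)
move=> h0; pose a := h / 2; pose b := h + 1.
have a0 : 0 < a by rewrite divr_gt0.
pose G (t : R) := expR (b * `|u|) * (2 * `|u| + 12 / a) * (a ^+ 2 + t ^+ 2)^-1.
have G0 t : 0 <= G t.
  by rewrite !mulr_ge0 ?expR_ge0 ?addr_ge0 ?mulr_ge0 ?invr_ge0 ?(ltW a0)// ltW// sqrD_gt0.
have iG : mu.-integrable setT (EFin \o G).
  have := integrableZl measurableT (expR (b * `|u|) * (2 * `|u| + 12 / a)) (integrable_inv_sqrD a0).
  by apply: eq_integrable.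
have I0 x : `]a, b[%classic x -> 0 < x.
  by rewrite /= in_itv/= => /andP[ax _]; exact: lt_trans ax.
have Ih : `]a, b[%classic h.
  by rewrite /= in_itv/= /a /b; apply/andP; split; lra.
have ik x : `]a, b[%classic x -> mu.-integrable setT (EFin \o (lap_kernel x u)).
  by move=> /I0; exact: integrable_lap_kernel.
have dk x t : `]a, b[%classic x -> setT t -> derivable (fun x => lap_kernel x u t) x 1.
  by move=> /I0 x0 _; have := is_derive_lap_kernel u t x0 => -[].
have dkE x t : 0 < x -> partial1of2 (fun x t => lap_kernel x u t) x t = lap_kernel' x u t.
  move=> x0; rewrite partial1of2E; have := is_derive_lap_kernel u t x0 => H.
  by rewrite derive_val.
have kG x t : `]a, b[%classic x -> setT t ->
    `|partial1of2 (fun x t => lap_kernel x u t) x t| <= G t.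
  move=> Ix _; have x0 := I0 _ Ix; rewrite dkE//.
  move: Ix; rewrite /= in_itv/= => /andP[ax xb].
  apply: (le_trans (lap_kernel'_bound u t x0)).
  apply: ler_pM; rewrite ?mulr_ge0 ?expR_ge0 ?addr_ge0 ?mulr_ge0 ?invr_ge0 ?(ltW x0)//.
  - exact: ltW (sqrD_gt0 _ _).
  - apply: ler_pM; rewrite ?expR_ge0 ?addr_ge0 ?mulr_ge0 ?invr_ge0 ?(ltW x0)//.
      rewrite ler_expR; apply: (@le_trans _ _ (x * `|u|)).
        by rewrite ler_wpM2l ?(ltW x0)// ler_norm.
      by rewrite ler_wpM2r// ltW.
    by rewrite lerD2l ler_wpM2l// lef_pV2 ?posrE// ltW.
  - rewrite lef_pV2 ?posrE ?sqrD_gt0// lerD2r lerXn2r ?nnegrE ?(ltW a0) ?(ltW x0)//.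
    exact: ltW.
apply: DeriveDef.
  exact: (derivable_under_integral measurableT Ih ik dk G0 iG kG).
rewrite -derive1E (differentiation_under_integral measurableT Ih ik dk G0 iG kG).
rewrite (@eq_Rintegral _ _ _ mu setT (lap_kernel' h u)); first exact: lap_kernel'_integral.
by move=> t _; exact: dkE.
Qed.

(** The derivative is known to vanish for h > 0 only; composition with exp moves this to the whole
    line, where a function with zero derivative is constant. *)
Lemma lap_integral_indep (h1 h2 u : R) : 0 < h1 -> 0 < h2 ->
  lap_integral h1 u = lap_integral h2 u.
Proof.
move=> h10 h20.
have key (s s' : R) : lap_integral (expR s) u = lap_integral (expR s') u.
  apply: (@is_derive_0_is_cst R ((fun h => lap_integral h u) \o expR)) => x.
  have := @is_derive1_comp R (fun h => lap_integral h u) expR x _ _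
    (is_derive_lap_integral u (expR_gt0 x)) (is_derive_expR x).
  by rewrite mul0r.
by have := key (ln h1) (ln h2); rewrite !lnK ?posrE.
Qed.

(** The product z u is unchanged, the factor 1 / z ^ 2 contributes l ^ 2, and the change of variable
    t -> l t contributes 1 / l. *)
Lemma lap_integral_scale (h u l : R) : 0 < h -> 0 < l ->
  lap_integral (h / l) (l * u) = l * lap_integral h u.
Proof.
move=> h0 l0; have l0' : l != 0 by rewrite gt_eqF.
have kE t : lap_kernel (h / l) (l * u) t = l ^+ 2 * lap_kernel h u (l * t).
  rewrite !lap_kernelE ?divr_gt0//.
  have -> : h / l * (l * u) = h * u by field.
  have -> : t * (l * u) = l * t * u by ring.
  have -> : ((h / l) ^+ 2 + t ^+ 2)^-1 = l ^+ 2 * (h ^+ 2 + (l * t) ^+ 2)^-1.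
    by field; rewrite l0' !gt_eqF ?sqrD_gt0 ?divr_gt0.
  field; rewrite l0'/= gt_eqF// sqrD_gt0//.
rewrite /lap_integral (@eq_Rintegral _ _ _ mu setT (fun t => l ^+ 2 * lap_kernel h u (l * t))); last first.
  by move=> t _; exact: kE.
rewrite RintegralZl//; last exact: (integrable_scale l0' (integrable_lap_kernel u h0)).
rewrite (Rintegral_scale l0' (integrable_lap_kernel u h0)) gtr0_norm// mulrA.
by congr (_ * _); field.
Qed.

(* The constant is [2 * pi], but its value is not needed. *)
Lemma lap_integral_posp : exists C : R, forall h u : R, 0 < h ->
  lap_integral h u = C * Num.max u 0.
Proof.
exists (lap_integral 1 1) => h u h0.
have [u0|u0] := leP u 0; last first.
  have := @lap_integral_scale 1 1 u ltr01 u0; rewrite mulr1 => E.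
  by rewrite (@lap_integral_indep h (1 / u)) ?divr_gt0// E mulrC.
rewrite mulr0; apply/normr0_eq0/eqP; rewrite eq_le normr_ge0 andbT.
pose K : R := \int[mu]_t (1 ^+ 2 + t ^+ 2)^-1.
(* For u <= 0, independence of h and scaling identify n times the integral at u with the integral at
   n u on the line h = 1. There exp (n u) <= 1 keeps it below K for every n, which forces it to be
   0. *)
apply: (@le0_of_le_natV _ _ K) => n n0.
have n0R : 0 < n%:R :> R by rewrite ltr0n.
have := @lap_integral_scale n%:R u n%:R n0R n0R; rewrite divff ?gt_eqF// => E.
rewrite (@lap_integral_indep h n%:R)// ler_pdivlMr// mulrC -[X in X * _]gtr0_norm// -normrM -E.
apply: le_norm_Rintegral => //.
- exact: measurable_lap_kernel.
- move=> t _; apply: (le_trans (lap_kernel_bound _ _ ltr01)).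
  apply: ler_piMl; first by rewrite invr_ge0 ltW// sqrD_gt0.
  by rewrite -[leRHS]expR0 ler_expR mul1r mulr_ge0_le0.
- exact: integrable_inv_sqrD.
Qed.

End laplace_kernel.

(** * Characteristic functions of weighted laws *)

Section weighted_characteristic_function.
Context d (Y : measurableType d) (R : realType) (nu : probability Y R).
Context (w X : Y -> R).
Context (mw : measurable_fun setT w) (mX : measurable_fun setT X).
Context (w_ge0 : forall y, 0 <= w y).
Context (w_int : forall k, nu.-integrable setT (EFin \o (fun y => w y * `|X y| ^+ k))).
Local Notation nc := ComplexField.Normc.normc.
Local Open Scope complex_scope.

Definition wcos (t : R) : R := \int[nu]_y (w y * cos (t * X y)).
Definition wsin (t : R) : R := \int[nu]_y (w y * sin (t * X y)).
Definition wchar (t : R) : R[i] := wcos t +i* wsin t.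
Definition wmoment (k : nat) : R := \int[nu]_y (w y * X y ^+ k).
Definition wabs_moment (k : nat) : R := \int[nu]_y (w y * `|X y| ^+ k).

Lemma w_integrable : nu.-integrable setT (EFin \o w).
Proof. by have := w_int 0; apply: eq_integrable => // y _ /=; rewrite expr0 mulr1. Qed.

Lemma w_integrable_le (f : R -> R) (K : R) k : measurable_fun setT f ->
  (forall x, `|f x| <= K * `|x| ^+ k) ->
  nu.-integrable setT (EFin \o (fun y => w y * f (X y))).
Proof.
move=> mf Hf; apply: (@integrable_le _ _ R nu setT _ (fun y => K * (w y * `|X y| ^+ k))) => //.
- by apply: measurable_funM => //; exact: measurableT_comp.
- by move=> y _; rewrite normrM ger0_norm// mulrCA ler_wpM2l.
- by have := integrableZl measurableT K (w_int k); apply: eq_integrable.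
Qed.

Lemma w_Rintegral_le (f : R -> R) (K : R) k : measurable_fun setT f ->
  (forall x, `|f x| <= K * `|x| ^+ k) ->
  `|\int[nu]_y (w y * f (X y))| <= K * wabs_moment k.
Proof.
move=> mf Hf; rewrite /wabs_moment -RintegralZl//; apply: le_norm_Rintegral => //.
- by apply: measurable_funM => //; exact: measurableT_comp.
- by move=> y _; rewrite normrM ger0_norm// mulrCA ler_wpM2l.
- by have := integrableZl measurableT K (w_int k); apply: eq_integrable.
Qed.

Lemma measurable_cosM (t : R) : measurable_fun (setT : set R) (fun x => cos (t * x)).
Proof.
by apply: measurableT_comp; [apply: continuous_measurable_fun; exact: continuous_cos|exact: measurable_funM].
Qed.

Lemma measurable_sinM (t : R) : measurable_fun (setT : set R) (fun x => sin (t * x)).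
Proof.
by apply: measurableT_comp; [apply: continuous_measurable_fun; exact: continuous_sin|exact: measurable_funM].
Qed.

Lemma integrable_wcos t : nu.-integrable setT (EFin \o (fun y => w y * cos (t * X y))).
Proof.
apply: (@w_integrable_le (fun x => cos (t * x)) 1 0); first exact: measurable_cosM.
by move=> x; rewrite expr0 mulr1 ler_norml cos_geN1 cos_le1.
Qed.

Lemma integrable_wsin t : nu.-integrable setT (EFin \o (fun y => w y * sin (t * X y))).
Proof.
apply: (@w_integrable_le (fun x => sin (t * x)) 1 0); first exact: measurable_sinM.
by move=> x; rewrite expr0 mulr1 ler_norml sin_geN1 sin_le1.
Qed.

Lemma integrable_wmoment k : nu.-integrable setT (EFin \o (fun y => w y * X y ^+ k)).
Proof.
apply: (@w_integrable_le (fun x => x ^+ k) 1 k); first exact: measurable_funX.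
by move=> x; rewrite mul1r normrX.
Qed.

Lemma w_horner (p : {poly R}) (t : R) :
  nu.-integrable setT (EFin \o (fun y => w y * p.[t * X y])) /\
  \int[nu]_y (w y * p.[t * X y]) = (\poly_(i < size p) (p`_i * wmoment i)).[t].
Proof.
have E y : w y * p.[t * X y] = \sum_(i < size p) p`_i * t ^+ i * (w y * X y ^+ i).
  rewrite horner_coef mulr_sumr; apply: eq_bigr => i _.
  by rewrite exprMn; ring.
have I i : nu.-integrable setT (EFin \o (fun y => p`_i * t ^+ i * (w y * X y ^+ i))).
  by have := integrableZl measurableT (p`_i * t ^+ i) (integrable_wmoment i); apply: eq_integrable.
split.
  have := @integrable_sumf _ _ _ nu setT (size p) (fun i y => p`_i * t ^+ i * (w y * X y ^+ i))
    measurableT (fun i _ => I i).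
  by apply: eq_integrable => // y _ /=; rewrite E.
rewrite (@eq_Rintegral _ _ _ nu setT (fun y => \sum_(i < size p) p`_i * t ^+ i * (w y * X y ^+ i))); last first.
  by move=> y _; exact: E.
rewrite (@Rintegral_sum _ _ _ nu setT (size p) (fun i y => p`_i * t ^+ i * (w y * X y ^+ i))
    measurableT (fun i _ => I i)).
rewrite horner_poly; apply: eq_bigr => i _.
by rewrite RintegralZl//; [rewrite /wmoment; ring|exact: integrable_wmoment].
Qed.

(** Replacing [f] by its Taylor polynomial under the integral gives a polynomial in t with the
    moments in its coefficients, and the remainder costs the absolute moment of order N.
    Differentiation in t is avoided. *)
Lemma w_taylor0 (f : R -> R) : measurable_fun setT f -> (forall x, `|f x| <= 1) ->
  (forall N, exists p : {poly R}, forall x, `|f x - p.[x]| <= `|x| ^+ N) ->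
  taylor0 (fun t => \int[nu]_y (w y * f (t * X y))).
Proof.
move=> mf f1 H N; have [p Hp] := H N.
exists (\poly_(i < size p) (p`_i * wmoment i)), (wabs_moment N).
  by apply: Rintegral_ge0 => y _; rewrite mulr_ge0 ?exprn_ge0.
move=> t t1; have [I E] := w_horner p t; rewrite -E.
have If : nu.-integrable setT (EFin \o (fun y => w y * f (t * X y))).
  apply: (@w_integrable_le (fun x => f (t * x)) 1 0).
    by apply: measurableT_comp => //; exact: measurable_funM.
  by move=> x; rewrite expr0 mulr1.
rewrite -RintegralB// (@eq_Rintegral _ _ _ nu setT
  (fun y => w y * (fun x => f (t * x) - p.[t * x]) (X y))); last by move=> y _; rewrite mulrBr.
rewrite mulrC; apply: (@w_Rintegral_le (fun x => f (t * x) - p.[t * x]) _ N).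
  apply: measurable_funB; apply: measurableT_comp => //; try exact: measurable_funM.
  by apply: continuous_measurable_fun; exact: continuous_horner.
by move=> x; rewrite -exprMn -normrM.
Qed.

Lemma ctaylor0_wchar : ctaylor0 wchar.
Proof.
split.
- apply: (@w_taylor0 cos) => [|x|N].
  + by apply: continuous_measurable_fun; exact: continuous_cos.
  + by rewrite ler_norml cos_geN1 cos_le1.
  + by have [p [q [H _]]] := @cos_sin_taylor R N; exists p.
- apply: (@w_taylor0 sin) => [|x|N].
  + by apply: continuous_measurable_fun; exact: continuous_sin.
  + by rewrite ler_norml sin_geN1 sin_le1.
  + by have [p [q [_ H]]] := @cos_sin_taylor R N; exists q.
Qed.

(** The bounds for cos x - 1 + x ^ 2 / 2 and sin x - x are integrated. The linear term disappears
    because the law is centred; the real and the imaginary part cost one third absolute moment each,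
    whence the factor 2. *)
Lemma wchar_third_order : wmoment 0 = 1 -> wmoment 1 = 0 -> forall t,
  nc (wchar t - (1 - wmoment 2 / 2 * t ^+ 2)%:C) <= 2 * wabs_moment 3 * `|t| ^+ 3.
Proof.
move=> m0 m1 t.
apply: (le_trans (normc_le _)) => /=; rewrite subr0.
have -> : 2 * wabs_moment 3 * `|t| ^+ 3 =
  `|t| ^+ 3 * wabs_moment 3 + `|t| ^+ 3 * wabs_moment 3 by ring.
have Ew := w_integrable.
have m0' : \int[nu]_y w y = 1.
  by rewrite -m0; apply: eq_Rintegral => y _; rewrite expr0 mulr1.
apply: lerD.
- have I2 : nu.-integrable setT (EFin \o (fun y => w y - t ^+ 2 / 2 * (w y * X y ^+ 2))).
    have := integrable_lin 1 (- (t ^+ 2 / 2)) measurableT Ew (integrable_wmoment 2).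
    by apply: eq_integrable => // y _ /=; rewrite mul1r mulNr.
  have -> : wcos t - (1 - wmoment 2 / 2 * t ^+ 2) =
    \int[nu]_y (w y * (fun x => cos (t * x) - 1 + 2^-1 * (t * x) ^+ 2) (X y)).
    rewrite (@eq_Rintegral _ _ _ nu setT (fun y => w y * cos (t * X y) -
      (w y - t ^+ 2 / 2 * (w y * X y ^+ 2)))); last by move=> y _ /=; rewrite exprMn; ring.
    rewrite RintegralB//; last exact: integrable_wcos.
    congr (_ - _).
    rewrite (@eq_Rintegral _ _ _ nu setT (fun y => 1 * w y + (- (t ^+ 2 / 2)) * (w y * X y ^+ 2))); last first.
      by move=> y _; rewrite mul1r mulNr.
    rewrite Rintegral_lin//; last exact: integrable_wmoment.
    by rewrite m0' mul1r -/(wmoment 2); ring.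
  apply: (@w_Rintegral_le (fun x => cos (t * x) - 1 + 2^-1 * (t * x) ^+ 2) _ 3); last first.
    by move=> x; rewrite -exprMn -normrM; exact: cos_bound3.
  apply: measurable_funD; first by apply: measurable_funB => //; exact: measurable_cosM.
  by apply: measurable_funM => //; apply: measurable_funX; exact: measurable_funM.
- have -> : wsin t = \int[nu]_y (w y * (fun x => sin (t * x) - t * x) (X y)).
    rewrite (@eq_Rintegral _ _ _ nu setT (fun y => w y * sin (t * X y) -
      t * (w y * X y ^+ 1))); last by move=> y _ /=; rewrite expr1; ring.
    rewrite RintegralB//; last 2 first.
    - exact: integrable_wsin.
    - by have := integrableZl measurableT t (integrable_wmoment 1); apply: eq_integrable.
    rewrite RintegralZl//; last exact: integrable_wmoment.
    by rewrite -/(wmoment 1) m1 mulr0 subr0.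
  apply: (@w_Rintegral_le (fun x => sin (t * x) - t * x) _ 3); last first.
    by move=> x; rewrite -exprMn -normrM; exact: sin_bound3.
  by apply: measurable_funB; [exact: measurable_sinM|exact: measurable_funM].
Qed.

Lemma cos_lipschitz (x y : R) : `|cos x - cos y| <= `|x - y|.
Proof.
have := @derive_bound R (fun z => cos (y + z) - cos y) (fun z => - sin (y + z)) 1 0 (x - y).
have -> : y + (x - y) = x by ring.
rewrite mul1r expr1; apply.
- by move=> z; apply: trigger_derive; rewrite /GRing.scale /=; ring.
- by rewrite addr0 subrr.
- by move=> z _; rewrite mul1r expr0 normrN ler_norml sin_geN1 sin_le1.
Qed.

Lemma sin_lipschitz (x y : R) : `|sin x - sin y| <= `|x - y|.
Proof.
have := @derive_bound R (fun z => sin (y + z) - sin y) (fun z => cos (y + z)) 1 0 (x - y).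
have -> : y + (x - y) = x by ring.
rewrite mul1r expr1; apply.
- by move=> z; apply: trigger_derive; rewrite /GRing.scale /=; ring.
- by rewrite addr0 subrr.
- by move=> z _; rewrite mul1r expr0 ler_norml cos_geN1 cos_le1.
Qed.

Lemma lipschitz_continuous (f : R -> R) (K : R) :
  (forall x y, `|f x - f y| <= K * `|x - y|) -> continuous f.
Proof.
move=> H x; apply/cvgrPdist_le => e e0.
have K1 : 0 < `|K| + 1 by rewrite ltr_wpDl.
near=> y; apply: (le_trans (H x y)).
apply: (@le_trans _ _ ((`|K| + 1) * `|x - y|)).
  by rewrite ler_wpM2r// (le_trans (ler_norm K))// lerDl.
rewrite -ler_pdivlMl//; near: y; apply: cvgr_dist_le; first exact: cvg_id.
by rewrite mulr_gt0// invr_gt0.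
Unshelve. all: by end_near. Qed.

Lemma measurable_wcos : measurable_fun setT wcos.
Proof.
apply: continuous_measurable_fun; apply: (@lipschitz_continuous _ (wabs_moment 1)) => s t.
rewrite /wcos -RintegralB//; [|exact: integrable_wcos..].
rewrite (@eq_Rintegral _ _ _ nu setT (fun y => w y * (fun x => cos (s * x) - cos (t * x)) (X y))); last first.
  by move=> y _; rewrite mulrBr.
rewrite mulrC; apply: (@w_Rintegral_le (fun x => cos (s * x) - cos (t * x)) _ 1).
  by apply: measurable_funB; exact: measurable_cosM.
by move=> x; rewrite expr1 -normrM mulrBl cos_lipschitz.
Qed.

Lemma measurable_wsin : measurable_fun setT wsin.
Proof.
apply: continuous_measurable_fun; apply: (@lipschitz_continuous _ (wabs_moment 1)) => s t.
rewrite /wsin -RintegralB//; [|exact: integrable_wsin..].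
rewrite (@eq_Rintegral _ _ _ nu setT (fun y => w y * (fun x => sin (s * x) - sin (t * x)) (X y))); last first.
  by move=> y _; rewrite mulrBr.
rewrite mulrC; apply: (@w_Rintegral_le (fun x => sin (s * x) - sin (t * x)) _ 1).
  by apply: measurable_funB; exact: measurable_sinM.
by move=> x; rewrite expr1 -normrM mulrBl sin_lipschitz.
Qed.

(* With A = wcos t and B = wsin t, |wchar t|^2 = A^2 + B^2 is the average over y
   of A cos (t X y) + B sin (t X y), each of which has the bounded form. *)
Lemma wchar_sqr_bound (t q : R) : wmoment 0 = 1 ->
  (forall th, \int[nu]_y (w y * cos (t * X y - th)) <= q) -> nc (wchar t) ^+ 2 <= q.
Proof.
move=> m0 H; rewrite normc_sqr /=.
have m0' : \int[nu]_y w y = 1.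
  by rewrite -m0; apply: eq_Rintegral => y _; rewrite expr0 mulr1.
have key th : wcos t * cos th + wsin t * sin th <= q.
  apply: le_trans (H th); rewrite le_eqVlt; apply/orP; left; apply/eqP.
  rewrite mulrC [wsin t * _]mulrC /wcos /wsin -Rintegral_lin//; [|exact: integrable_wcos|exact: integrable_wsin].
  by apply: eq_Rintegral => y _; rewrite cosB; ring.
have -> : wcos t ^+ 2 + wsin t ^+ 2 =
    \int[nu]_y (wcos t * (w y * cos (t * X y)) + wsin t * (w y * sin (t * X y))).
  by rewrite Rintegral_lin//; [exact: integrable_wcos|exact: integrable_wsin].
rewrite -[q]mulr1 -m0' -RintegralZl//; last exact: w_integrable.
apply: le_Rintegral => //.
- apply: integrable_lin => //; [exact: integrable_wcos|exact: integrable_wsin].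
- by have := integrableZl measurableT q w_integrable; apply: eq_integrable.
- move=> y _; rewrite [leRHS]mulrC.
  have -> : wcos t * (w y * cos (t * X y)) + wsin t * (w y * sin (t * X y)) =
    w y * (wcos t * cos (t * X y) + wsin t * sin (t * X y)) by ring.
  exact: ler_wpM2l.
Qed.

Lemma integrable_wcosB t th :
  nu.-integrable setT (EFin \o (fun y => w y * cos (t * X y - th))).
Proof.
have := integrable_lin (cos th) (sin th) measurableT (integrable_wcos t) (integrable_wsin t).
by apply: eq_integrable => // y _ /=; rewrite cosB; congr EFin; ring.
Qed.

Lemma normc_wchar_le1 t : wmoment 0 = 1 -> nc (wchar t) <= 1.
Proof.
move=> m0; rewrite -(ler_pXn2r (n := 2)) ?nnegrE ?normc_ge0// expr1n.
apply: wchar_sqr_bound => // th.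
rewrite -[leRHS]m0; apply: le_Rintegral => //.
- exact: integrable_wcosB.
- exact: integrable_wmoment.
- by move=> y _; rewrite expr0 ler_wpM2l// cos_le1.
Qed.

(** Compared with the density, of total mass 1, the integrand loses at least [wm * eta] at each
    point of D; elsewhere cos <= 1 suffices. *)
Lemma wcos_gap (t th wm eta : R) (D : set Y) : measurable D -> wmoment 0 = 1 ->
  (forall y, D y -> wm <= w y) -> 0 <= wm -> 0 <= eta ->
  (forall y, D y -> cos (t * X y - th) <= 1 - eta) ->
  \int[nu]_y (w y * cos (t * X y - th)) <= 1 - wm * eta * fine (nu D).
Proof.
move=> mD m0 Hw wm0 eta0 Hc.
have ID : nu.-integrable setT (EFin \o (fun y => wm * eta * \1_D y)).
  by have := integrableZl measurableT (wm * eta) (integrable_indic nu mD); apply: eq_integrable.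
have -> : wm * eta * fine (nu D) = \int[nu]_y (wm * eta * \1_D y).
  rewrite RintegralZl//; last exact: integrable_indic.
  by rewrite /Rintegral integral_indic// setIT.
rewrite -[X in X - _]m0 -RintegralB//; last exact: integrable_wmoment.
apply: le_Rintegral => //.
- exact: integrable_wcosB.
- have := integrable_lin 1 (-1) measurableT (integrable_wmoment 0) ID.
  by apply: eq_integrable => // y _ /=; rewrite mul1r mulN1r.
- move=> y _; rewrite expr0 mulr1 indicE.
  have [yD|yD] := boolP (y \in D); last first.
    by rewrite mulr0 subr0 ler_piMr// cos_le1.
  rewrite mulr1; move: yD => /set_mem yD; have h1 := Hw y yD; have h2 := Hc y yD.
  have h3 : w y * cos (t * X y - th) <= w y * (1 - eta) by rewrite ler_wpM2l.
  have h4 : wm * eta <= w y * eta by rewrite ler_wpM2r.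
  lra.
Qed.

End weighted_characteristic_function.

(** * Cramer's condition *)

Section cramer_condition.
Context {R : realType}.

(** Truncation to [-L, L] is monotone and 1-Lipschitz: applied to the end points of successive
    intervals, it keeps their order and does not lengthen them, and intervals outside [-L, L] become
    degenerate. *)
Definition clamp (L x : R) : R := Num.max (- L) (Num.min L x).

Lemma clamp_ge L x : - L <= clamp L x.
Proof. by rewrite le_max lexx. Qed.

Lemma clamp_le L x : 0 <= L -> clamp L x <= L.
Proof. by move=> L0; rewrite ge_max ge_min lexx/= andbT; lra. Qed.

Lemma clamp_mono L x y : x <= y -> clamp L x <= clamp L y.
Proof.
move=> xy; rewrite /clamp ge_max !le_max lexx /=.
by rewrite le_min !ge_min lexx xy !orbT.
Qed.

Lemma clamp_lip L x y : 0 <= L -> x <= y -> clamp L y - clamp L x <= y - x.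
Proof.
rewrite /clamp => L0 xy.
have [h1|h1] := leP L y; have [h2|h2] := leP L x.
- by rewrite subrr subr_ge0.
- by have [h3|h3] := leP (- L) L; have [h4|h4] := leP (- L) x; lra.
- by have [h3|h3] := leP (- L) y; have [h4|h4] := leP (- L) L; lra.
- by have [h3|h3] := leP (- L) y; have [h4|h4] := leP (- L) x; lra.
Qed.

Lemma cos_gt_near_period (r x : R) : 0 < r -> r <= pi -> cos r < cos x ->
  exists k : int, `|x - 2 * pi * k%:~R| < r.
Proof.
move=> r0 rpi cx; have pi0 : 0 < pi :> R := pi_gt0 R.
(* Rounding: 2 pi k is a multiple of 2 pi nearest to x. *)
pose k := Num.floor (x / (2 * pi) + 2^-1); exists k.
have h1 : k%:~R <= x / (2 * pi) + 2^-1 by exact: Num.Theory.floor_le.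
have h2 : x / (2 * pi) + 2^-1 < k%:~R + 1.
  by have := Num.Theory.floorD1_gt (x / (2 * pi) + 2^-1); rewrite intrD.
clearbody k.
have yb : `|x - 2 * pi * k%:~R| <= pi.
  have p20 : 0 < 2 * pi :> R by rewrite mulr_gt0.
  have e : x = x / (2 * pi) * (2 * pi) by rewrite divfK// gt_eqF.
  move: h1 h2; rewrite [in `|x - _|]e.
  set u := x / (2 * pi); clear e; clearbody u; clear -u pi0.
  move: (k%:~R : R) (pi : R) pi0 => z p p0 h1 h2.
  by rewrite ler_norml; apply/andP; split; nra.
have cy : cos (x - 2 * pi * k%:~R) = cos x.
  have cosn (n : nat) (z : R) : cos (z + 2 * pi * n%:R) = cos z.
    by rewrite [2 * pi]mulr_natl mulr_natr (periodicn (@cosD2pi R)).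
  case: (k) => n.
  - by rewrite -pmulrn -[in RHS](subrK (2 * pi * n%:R) x) cosn.
  - by rewrite NegzE mulrNz mulrN opprK -pmulrn cosn.
rewrite -cy -(cos_norm (x - _)) ltr_cos in cx => //.
- by rewrite in_itv/= yb normr_ge0.
- by rewrite in_itv/= rpi ltW.
Qed.

(** Half the period is abstracted to some p >= 1; with r <= 1 this makes the open intervals of
    radius r about the multiples of 2 p disjoint. *)
Lemma cos_period : exists2 p : R, 1 <= p & forall r, 0 < r <= 1 ->
  cos r < 1 /\ forall x, cos r < cos x -> exists k : int, `|x - 2 * p * k%:~R| < r.
Proof.
have pi1 : 1 <= pi :> R by apply: le_trans (@pi_ge2 R); rewrite ler1n.
exists pi => // r /andP[r0 r1]; split; last first.
  by move=> x; apply: cos_gt_near_period => //; exact: le_trans pi1.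
rewrite -cos0 ltr_cos// in_itv/= ?lexx ?pi_ge0//=.
by rewrite (ltW r0) (le_trans r1).
Qed.

Lemma disjoint_increments (U : R -> R) (a b : nat -> R) (c : R) :
  {homo U : x y / x <= y} -> (forall i, c <= a i) -> (forall i, b i <= a i.+1) ->
  forall n, \sum_(i < n) (U (b i) - U (a i)) <= U (a n) - U c.
Proof.
move=> Um ca ba; elim=> [|n IH]; first by rewrite big_ord0 subr_ge0 Um.
rewrite big_ord_recr /=; have := Um _ _ (ba n); lra.
Qed.

Lemma cumulative_quantiles (U : cumulativeBounded (0 : R) (1 : R)) :
  exists2 L, 0 < L & 3 / 4 <= U L - U (- L).
Proof.
have [M [_ HM]] : \forall x \near +oo, 7 / 8 < U x.
  by apply: cvgr_gt (cumulativey U) _ _; lra.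
have [N [_ HN]] : \forall x \near -oo, U x < 1 / 8.
  by apply: cvgr_lt (cumulativeNy U) _ _; lra.
exists (`|M| + `|N| + 1); first by rewrite ltr_wpDl// addr_ge0.
have h1 := HM (`|M| + `|N| + 1); have h2 := HN (- (`|M| + `|N| + 1)).
have a1 := ler_norm M; have a2 := ler_norm (- N); rewrite normrN in a2.
have b1 := normr_ge0 M; have b2 := normr_ge0 N.
have {}h1 : 7 / 8 < U (`|M| + `|N| + 1) by apply: h1; lra.
have {}h2 : U (- (`|M| + `|N| + 1)) < 1 / 8 by apply: h2; lra.
lra.
Qed.

(* The points where cos (t y - th) is close to 1 are covered by short intervals,
   of total length in [-L, L] small uniformly in t >= de and th. *)
Lemma cramer_set (nu : probability R R) (V : R -> R) (beta : R)
    (U1 U2 : cumulativeBounded (0 : R) (1 : R)) (de : R) :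
  (forall a b : R, a <= b -> nu (`]a, b]%classic : set R) = (V b - V a)%:E) ->
  0 < beta <= 1 -> (forall x, V x = beta * U1 x + (1 - beta) * U2 x) ->
  absolutely_continuous U1 -> 0 < de ->
  exists L eta : R, 0 < eta /\ forall t th, de <= t -> exists D : set R,
    [/\ measurable D, (forall y, D y -> `|y| <= L),
        (forall y, D y -> cos (t * y - th) <= 1 - eta) & beta / 2 <= fine (nu D)].
Proof.
move=> HV /andP[be0 be1] VE ac de0; have [p pi1 Hp] := cos_period.
have pi0 : 0 < p := lt_le_trans ltr01 pi1.
have [L L0 HL] := cumulative_quantiles U1.
(* [U1] is to gain at most 1 / 4 on the removed intervals; as it gains at least 3 / 4 on [-L, L],
   one half remains, whence the bound beta / 2. *)
have [rho rho0 Hrho] := ac (1 / 4) ltac:(by rewrite divr_gt0).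
(* At most t L + 3 intervals, of length at most 2 r / t, are removed. Their total length is at most
   2 r (L + 3 / t), and t >= de makes this smaller than [rho] for all t at once. *)
pose r := Num.min 1 (rho / (4 * (L + 3 / de))).
have L3 : 0 < L + 3 / de by rewrite addr_gt0// divr_gt0.
have r0 : 0 < r by rewrite lt_min ltr01 divr_gt0// mulr_gt0.
have r1 : r <= 1 by rewrite ge_min lexx.
have rr : 2 * r * (L + 3 / de) < rho.
  have : r <= rho / (4 * (L + 3 / de)) by rewrite ge_min lexx orbT.
  rewrite ler_pdivlMr ?mulr_gt0// => h; nra.
clearbody r.
have [cr1 near_period] := Hp r ltac:(by rewrite r0 r1).
have eta0 : 0 < 1 - cos r by rewrite subr_gt0.
exists L, (1 - cos r); split => // t th tde.
have t0 : 0 < t := lt_le_trans de0 tde.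
(* The integers k such that 2 p k is within r of t y - th for some y in ]-L, L] are all of the form
   kmin + i with i < N. *)
pose kmin := Num.floor ((- (t * L) - th - r) / (2 * p)).
pose N := (Num.truncn ((2 * (t * L) + 2 * r) / (2 * p))).+2.
have kmin1 : kmin%:~R <= (- (t * L) - th - r) / (2 * p) by exact: Num.Theory.floor_le.
have kmin2 : (- (t * L) - th - r) / (2 * p) < kmin%:~R + 1.
  by have := Num.Theory.floorD1_gt ((- (t * L) - th - r) / (2 * p)); rewrite intrD.
have tL0 : 0 < t * L by rewrite mulr_gt0.
have N1 : (2 * (t * L) + 2 * r) / (2 * p) + 1 < N%:R.
  have -> : N%:R = (Num.truncn ((2 * (t * L) + 2 * r) / (2 * p))).+1%:R + 1 :> R by rewrite natr1.
  by rewrite ltrD2r truncnS_gt.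
have N2 : N%:R <= (2 * (t * L) + 2 * r) / (2 * p) + 2.
  rewrite /N -addn2 natrD lerD2r truncn_le//.
  by apply: divr_ge0; [rewrite addr_ge0 ?mulr_ge0 ?(ltW t0) ?(ltW L0) ?(ltW r0)|rewrite mulr_ge0 ?(ltW pi0)].
clearbody kmin N.
pose lo (i : nat) := (th + 2 * p * (kmin%:~R + i%:R) - r) / t.
pose hi (i : nat) := (th + 2 * p * (kmin%:~R + i%:R) + r) / t.
pose a i := clamp L (lo i); pose b i := clamp L (hi i).
have lohi i : lo i <= hi i by rewrite ler_pM2r ?invr_gt0//; lra.
have ab i : a i <= b i by exact: clamp_mono.
have ba i : b i <= a i.+1.
  apply: clamp_mono; rewrite ler_pM2r ?invr_gt0// -natr1; lra.
have aa i j : (i < j)%N -> b i <= a j.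
  elim: j => [//|j IH]; rewrite ltnS leq_eqVlt => /orP[/eqP <- //|ij].
  exact: le_trans (le_trans (IH ij) (ab j)) (ba j).
have len : \sum_(i < N) (b i - a i) < rho.
  apply: (@le_lt_trans _ _ (\sum_(i < N) (2 * r / t))).
    apply: ler_sum => i _; apply: (le_trans (clamp_lip (ltW L0) (lohi i))).
    by rewrite /hi /lo -mulrBl ler_pM2r ?invr_gt0//; lra.
  rewrite sumr_const card_ord; apply: le_lt_trans rr; rewrite -[leLHS]mulr_natr.
  have N3 : N%:R <= t * L + 3 :> R.
    apply: (le_trans N2).
    have : (2 * (t * L) + 2 * r) / (2 * p) <= t * L + 1.
      rewrite ler_pdivrMr ?mulr_gt0//; nra.
    lra.
  have -> : 2 * r / t * N%:R = 2 * r * (N%:R / t) by ring.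
  rewrite ler_wpM2l ?mulr_ge0 ?(ltW r0)// ler_pdivrMr//.
  apply: (le_trans N3); rewrite mulrDl mulrC lerD2l mulrAC -mulrA ler_peMr//.
  by rewrite ler_pdivlMr// mul1r.
have incr : \sum_(i < N) (U1 (b i) - U1 (a i)) <= 1 / 4.
  apply: ltW; apply: le_lt_trans (Hrho N (fun i => a i) (fun i => b i) _ _ len).
  - by apply: ler_sum => i _; exact: ler_norm.
  - by move=> i.
  - apply/trivIsetP => i j _ _ ij; rewrite -subset0 => x [] /=.
    rewrite !in_itv/= => /andP[x1 x2] /andP[x3 x4].
    by case: (ltngtP i j) => [/aa h|/aa h|/val_inj e]; [lra|lra|rewrite e eqxx in ij].
have mono (U : cumulativeBounded (0 : R) (1 : R)) : {homo U : x y / x <= y}.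
  exact: cumulative_is_nondecreasing.
(* For [U2] monotonicity is enough: its increments over disjoint intervals in [-L, L] add up to at
   most its total increment there, so that its contribution to the remaining mass is nonnegative. *)
have incr2 : \sum_(i < N) (U2 (b i) - U2 (a i)) <= U2 L - U2 (- L).
  apply: (le_trans (@disjoint_increments U2 a b (- L) (mono _) (fun i => clamp_ge L _) ba N)).
  by rewrite lerD2r mono// clamp_le// ltW.
pose I (i : nat) : set R := `]a i, b i]%classic.
pose U := \big[setU/set0]_(i < N) I i.
have mU : measurable U by apply: bigsetU_measurable => i _; exact: measurable_itv.
pose X : set R := `]- L, L]%classic.
have mX : measurable X by exact: measurable_itv.
exists (X `\` U); split.
- exact: measurableD.
- by move=> y [/=]; rewrite /X /= in_itv/= => /andP[y1 y2] _; rewrite ler_norml y2 ltW.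
- move=> y [/=]; rewrite /X /= in_itv/= => /andP[y1 y2] nU; rewrite subKr leNgt.
  apply/negP => cy; apply: nU.
  have [k] := near_period _ cy.
  rewrite ltr_norml => /andP[k1 k2].
  have ty1 : - (t * L) < t * y by rewrite -mulrN ltr_pM2l.
  have ty2 : t * y <= t * L by rewrite ler_pM2l.
  have kk1 : kmin%:~R < k%:~R + (0 : R).
    apply: (le_lt_trans kmin1); rewrite ltr_pdivrMr ?mulr_gt0//; lra.
  have kk2 : k%:~R < kmin%:~R + N%:R :> R.
    have e : (2 * (t * L) + 2 * r) / (2 * p) = (t * L - th + r) / (2 * p) - (- (t * L) - th - r) / (2 * p).
      by field; rewrite gt_eqF.
    have : k%:~R < (t * L - th + r) / (2 * p) :> R.
      rewrite ltr_pdivlMr ?mulr_gt0//; lra.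
    move: N1; rewrite e; lra.
  rewrite addr0 ltr_int in kk1.
  have [i ki] : exists i : nat, k = kmin + i%:Z.
    by exists `|k - kmin|%N; rewrite gez0_abs ?subr_ge0 ?(ltW kk1)// [RHS]addrC subrK.
  have iN : (i < N)%N by move: kk2; rewrite ki intrD ltrD2l ltr_nat.
  rewrite /U -bigcup_mkord; exists i => //=; rewrite /I /= in_itv/=.
  have ly : lo i < y.
    by rewrite ltr_pdivrMr// mulrC; move: k1 k2; rewrite ki intrD -[i%:Z%:~R]/(i%:R : R); lra.
  have hy : y < hi i.
    by rewrite ltr_pdivlMr// mulrC; move: k1 k2; rewrite ki intrD -[i%:Z%:~R]/(i%:R : R); lra.
  apply/andP; split.
    by rewrite /a /clamp gt_max y1 gt_min ly orbT.
  by rewrite /b /clamp le_max le_min y2 (ltW hy) orbT.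
- have fin A : measurable A -> nu A = (fine (nu A))%:E.
    by move=> mA; rewrite fineK// fin_num_measure.
  have : (nu X <= nu (X `\` U) + \sum_(i < N) nu (I i))%E.
    apply: (@le_trans _ _ (nu ((X `\` U) `|` U))).
      apply: le_measure; rewrite ?inE//; first by apply: measurableU => //; exact: measurableD.
      by move=> x xX; case: (pselect (U x)) => Ux; [right|left].
    apply: (le_trans (measureU2 _ _ _)) => //; first exact: measurableD.
    by rewrite leeD2l// Boole_inequality// => i _; exact: measurable_itv.
  rewrite /X HV; last by lra.
  rewrite (eq_bigr (fun i : 'I_N => (V (b i) - V (a i))%:E)); last first.
    by move=> i _; rewrite /I HV.
  rewrite -/X sumEFin fin; last exact: measurableD.
  rewrite -EFinD lee_fin => H.
  have E : \sum_(i < N) (V (b i) - V (a i)) = beta * \sum_(i < N) (U1 (b i) - U1 (a i)) +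
     (1 - beta) * \sum_(i < N) (U2 (b i) - U2 (a i)).
    rewrite !mulr_sumr -big_split /=; apply: eq_bigr => i _; rewrite !VE; ring.
  (* The remaining mass is at least beta (3 / 4 - 1 / 4) from [U1], plus a nonnegative multiple of 1
     - beta from [U2]. *)
  rewrite E !VE in H; nra.
Qed.

End cramer_condition.

(** * Sums of independent random variables *)

Section independent_sums.
Context d (T : measurableType d) (R : realType) (P : probability T R).
Context (Z : nat -> {RV P >-> R}) (Z_indep : mutually_independent Z).

(** Built as a bundled random variable, so that measurability is carried along and [distribution]
    applies to it. *)
Fixpoint partial_sum (n : nat) : {RV P >-> R} :=
  if n is k.+1 then (partial_sum k \+ Z k : {RV P >-> R}) else (cst 0 : {RV P >-> R}).

Lemma partial_sumE n t : partial_sum n t = \sum_(i < n) Z i t.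
Proof.
elim: n => [|n IH] /=; first by rewrite big_ord0.
by rewrite big_ord_recr /= -IH.
Qed.

Lemma measurable_partial_sum_pair n :
  measurable_fun setT (fun t => (partial_sum n t, Z n t)).
Proof. exact: measurable_fun_pair. Qed.

Lemma measurable_cylinder (J : {fset nat}) (B : nat -> set R) :
  (forall i, i \in J -> measurable (B i)) ->
  measurable (\bigcap_(i in [set` J]) (Z i @^-1` B i)).
Proof.
move=> mB; apply: fin_bigcap_measurable; first exact: finite_fset.
by move=> i iJ; apply: measurable_funPTI => //; exact: mB.
Qed.

(** The finite set [J] of later indices lets the induction move Z_n from the family into the sum.
    With E the event on the remaining variables, the measure X -> P (X and E) / P E, transported by
    (S_n, Z_n), takes product values on rectangles, hence is the product of the two laws. It can
    then be evaluated on the set of pairs whose sum lies in A. *)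
Lemma partial_sum_indep n (J : {fset nat}) (B : nat -> set R) (A : set R) :
  (forall j, j \in J -> (n <= j)%N) -> (forall j, j \in J -> measurable (B j)) ->
  measurable A ->
  P (partial_sum n @^-1` A `&` \bigcap_(i in [set` J]) (Z i @^-1` B i)) =
  (P (partial_sum n @^-1` A) * P (\bigcap_(i in [set` J]) (Z i @^-1` B i)))%E.
Proof.
elim: n J B A => [|n IH] J B A Jn mB mA.
  have [A0|A0] := pselect (A 0).
    rewrite (_ : _ @^-1` A = setT) ?setTI ?probability_setT ?mul1e//.
    by apply/seteqP; split.
  rewrite (_ : _ @^-1` A = set0) ?set0I ?measure0 ?mul0e//.
  by apply/seteqP; split.
pose E := \bigcap_(i in [set` J]) (Z i @^-1` B i).
have mE : measurable E := measurable_cylinder mB.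
have nJ : n \notin J by apply/negP => /Jn; rewrite ltnn.
pose pr t := (partial_sum n t, Z n t).
have mpr : measurable_fun setT pr := measurable_partial_sum_pair n.
have rect A1 A2 : measurable A1 -> measurable A2 ->
    P (pr @^-1` (A1 `*` A2) `&` E) = (P (partial_sum n @^-1` A1) * P (Z n @^-1` A2) * P E)%E.
  move=> mA1 mA2.
  pose B' i := if i == n then A2 else B i.
  have mB' j : j \in (n |` J)%fset -> measurable (B' j).
    rewrite in_fset1U /B'; case: eqP => //= _; exact: mB.
  have BE i : i \in J -> B' i = B i.
    by move=> iJ; rewrite /B'; case: eqP => // e; rewrite e (negPf nJ) in iJ.
  have J'n j : j \in (n |` J)%fset -> (n <= j)%N.
    by rewrite in_fset1U => /orP[/eqP -> //|/Jn]; exact: ltnW.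
  have E' : \bigcap_(i in [set` (n |` J)%fset]) (Z i @^-1` B' i) = Z n @^-1` A2 `&` E.
    apply/seteqP; split => t /=.
      move=> H; split.
        by have := H n; rewrite /B' eqxx; apply; rewrite /= fset1U1.
      by move=> i iJ; rewrite -BE//; apply: H; rewrite /= in_fset1U (iJ : i \in J) orbT.
    move=> [h1 h2] i /=; rewrite in_fset1U /B'; case: eqP => [->//|_ /= iJ].
    exact: h2.
  have := IH (n |` J)%fset B' A1 J'n mB' mA1.
  rewrite E' (_ : _ `&` (_ `&` E) = pr @^-1` (A1 `*` A2) `&` E); last first.
    by apply/seteqP; split => t /=; rewrite /pr /=; tauto.
  move=> ->; rewrite -muleA; congr (_ * _)%E.
  rewrite -E' Z_indep// big_fsetU1//= /B' eqxx /E Z_indep//; congr (_ * _)%E.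
  by apply: eq_big_seq => i iJ; rewrite -[in RHS](BE _ iJ).
have prE : partial_sum n.+1 @^-1` A = pr @^-1` [set x | A (x.1 + x.2)] by [].
have mA' : measurable [set x : R * R | A (x.1 + x.2)].
  have := @measurable_funD _ _ R setT (@fst R R) (@snd R R) (@measurable_fst _ _ _ _) (@measurable_snd _ _ _ _).
  by move=> /(_ measurableT A mA); rewrite setTI.
have full X : measurable X -> P (pr @^-1` X) = (distribution P (partial_sum n) \x distribution P (Z n))%E X.
  move=> mX; apply/esym.
  apply: (@product_measure_unique _ _ _ _ _ (distribution P (partial_sum n)) (distribution P (Z n))
    (pushforward P pr)) => //= A1 A2 mA1 mA2.
  have := IH [fset n]%fset (fun=> A2) A1.
  rewrite set_fset1 bigcap_set1 => IH1.
  rewrite /pushforward -IH1//; first by move=> j; rewrite inE => /eqP ->.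
(* If P E = 0 both sides vanish; otherwise one may divide by P E to get a probability. *)
have [PE0|PE0] := eqVneq (P E) 0.
  rewrite PE0 mule0; apply/eqP; rewrite eq_le measure_ge0 andbT -PE0.
  have mI : measurable (partial_sum n.+1 @^-1` A `&` E).
    by apply: measurableI => //; exact: measurable_funPTI.
  by apply: (le_measure P); rewrite ?inE//; move=> t [].
have PEf : P E \is a fin_num by exact: fin_num_measure.
pose c := (fine (P E))^-1.
have c0 : 0 <= c by rewrite invr_ge0 fine_ge0.
have cPE : (c%:E * P E = 1)%E.
  rewrite -(fineK PEf) -EFinM /c mulVf// fine_eq0//.
have resE X : measurable X -> (distribution P (partial_sum n) \x distribution P (Z n))%E X =
    mscale (NngNum c0) (pushforward (mrestr P mE) pr) X.
  move=> mX.
  apply: (@product_measure_unique _ _ _ _ _ (distribution P (partial_sum n)) (distribution P (Z n))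
    (mscale (NngNum c0) (pushforward (mrestr P mE) pr))) => //= A1 A2 mA1 mA2.
  have -> : mscale (NngNum c0) (pushforward (mrestr P mE) pr) (A1 `*` A2) =
    (c%:E * P (pr @^-1` (A1 `*` A2) `&` E))%E by [].
  rewrite rect// muleC -muleA [(P E * _)%E]muleC cPE mule1//.
rewrite prE full// (resE mpr _ mA') /mscale /pushforward /mrestr /=.
rewrite muleAC cPE mul1e//.
Qed.

Lemma joint_law n (X : set (R * R)) : measurable X ->
  P ((fun t => (partial_sum n t, Z n t)) @^-1` X) =
  (distribution P (partial_sum n) \x distribution P (Z n))%E X.
Proof.
have mpr := measurable_partial_sum_pair n.
move=> mX; apply/esym.
apply: (@product_measure_unique _ _ _ _ _ (distribution P (partial_sum n)) (distribution P (Z n))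
  (pushforward P (fun t => (partial_sum n t, Z n t)))) => //= A1 A2 mA1 mA2.
have := @partial_sum_indep n [fset n]%fset (fun=> A2) A1.
rewrite set_fset1 bigcap_set1 => IH1.
by rewrite /pushforward -IH1// => j; rewrite inE => /eqP ->.
Qed.

(** The joint law of S_n and Z_n is a product measure, on which Fubini's theorem separates the two
    factors. *)
Lemma expectation_mul_indep n (F G : R -> R) :
  measurable_fun setT F -> measurable_fun setT G ->
  P.-integrable setT (EFin \o (fun t => F (partial_sum n t))) ->
  P.-integrable setT (EFin \o (fun t => G (Z n t))) ->
  P.-integrable setT (EFin \o (fun t => F (partial_sum n t) * G (Z n t))) /\
  \int[P]_t (F (partial_sum n t) * G (Z n t)) =
  \int[P]_t F (partial_sum n t) * \int[P]_t G (Z n t).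
Proof.
move=> mF mG iF iG.
pose mu := distribution P (partial_sum n); pose nu := distribution P (Z n).
have mpr := measurable_partial_sum_pair n.
pose H (x : R * R) : \bar R := (F x.1 * G x.2)%:E.
have mH : measurable_fun setT H.
  apply/measurable_EFinP; apply: measurable_funM.
    by apply: measurableT_comp => //; exact: measurable_fst.
  by apply: measurableT_comp => //; exact: measurable_snd.
have iF' : mu.-integrable setT (EFin \o F).
  by apply: integrable_pushforward => //; exact/measurable_EFinP.
have iG' : nu.-integrable setT (EFin \o G).
  by apply: integrable_pushforward => //; exact/measurable_EFinP.
have iH : (mu \x nu)%E.-integrable setT H.
  apply/integrable12ltyP => //.
  rewrite (eq_integral (fun x => `|(F x)%:E| * \int[nu]_y `|(G y)%:E|))%E; last first.
    move=> x _; rewrite -ge0_integralZl//.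
      by apply: eq_integral => y _; rewrite /H /= normrM EFinM.
    by apply: measurableT_comp => //; exact/measurable_EFinP.
  have Goo : (\int[nu]_y `|(G y)%:E| < +oo)%E by move/integrableP: iG' => [].
  have Gf : (\int[nu]_y `|(G y)%:E|)%E \is a fin_num by rewrite ge0_fin_numE// integral_ge0.
  rewrite -(fineK Gf) ge0_integralZr//; last 2 first.
  - by apply: measurableT_comp => //; exact/measurable_EFinP.
  - by rewrite lee_fin fine_ge0// integral_ge0.
  by rewrite lte_mul_pinfty ?integral_ge0//; [rewrite ge0_fin_numE ?integral_ge0//; move/integrableP: iF' => []|rewrite ltry].
have iHP : P.-integrable setT (H \o (fun t => (partial_sum n t, Z n t))).
  move/integrableP: iH => [_ iH]; apply/integrableP; split.
    exact: measurableT_comp.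
  apply: le_lt_trans iH.
  rewrite (eq_measure_integral (pushforward P (fun t => (partial_sum n t, Z n t)))); last first.
    by move=> A mA _; exact/esym/joint_law.
  rewrite ge0_integral_pushforward//=.
  by have := measurableT_comp (@abse_measurable R setT) mH.
split => //.
have -> : \int[P]_t (F (partial_sum n t) * G (Z n t)) =
   fine (\int[P]_t ((H \o (fun t => (partial_sum n t, Z n t))) t))%E by [].
rewrite -(integral_pushforward mpr mH iHP measurableT).
rewrite (eq_measure_integral (mu \x nu)%E); last first.
  by move=> A mA _; exact: joint_law.
rewrite -integral12_prod_meas1//.
rewrite (eq_integral (fun x => (\int[nu]_y G y)%:E * (F x)%:E)%E); last first.
  move=> x _; rewrite /fubini_F /H /= muleC.
  under eq_integral do rewrite EFinM.
  by rewrite integralZl// /Rintegral fineK// integrable_fin_num.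
rewrite integralZl// fineM//; last exact: integrable_fin_num.
rewrite mulrC; congr (fine _ * _).
  by rewrite /mu integral_distribution//; exact/measurable_EFinP.
by rewrite /Rintegral /nu integral_distribution//; exact/measurable_EFinP.
Qed.

Section exponential_moments.
Context (nu : probability R R).
Context (Z_law : forall n (A : set R), measurable A -> P (Z n @^-1` A) = nu A).

Lemma integrable_law n (f : R -> R) : measurable_fun setT f ->
  nu.-integrable setT (EFin \o f) ->
  P.-integrable setT (EFin \o (fun t => f (Z n t))) /\
  \int[P]_t f (Z n t) = \int[nu]_y f y.
Proof.
move=> mf fi; have mfE : measurable_fun setT (EFin \o f) by exact/measurable_EFinP.
have mZ : measurable_fun setT (Z n) by [].
have dE (A : set R) : measurable A -> A `<=` setT -> nu A = distribution P (Z n) A.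
  by move=> mA _; rewrite -(Z_law n mA).
have mfZ : P.-integrable setT (EFin \o (fun t => f (Z n t))).
  move/integrableP: fi => [_ fi]; apply/integrableP; split.
    by apply/measurable_EFinP; exact: (measurableT_comp mf mZ).
  apply: le_lt_trans fi; rewrite (eq_measure_integral (distribution P (Z n)))//.
  by rewrite ge0_integral_distribution//; exact: measurableT_comp.
split => //; rewrite /Rintegral; congr fine.
by rewrite (eq_measure_integral (distribution P (Z n)))// integral_distribution.
Qed.

Context (h m : R) (exp_int : nu.-integrable setT (EFin \o (fun y => expR (h * y)))).
Local Notation nc := ComplexField.Normc.normc.
Local Open Scope complex_scope.

Definition exp_cos (t y : R) : R := expR (h * y) * cos (t * y).
Definition exp_sin (t y : R) : R := expR (h * y) * sin (t * y).

Lemma measurable_exp_cos t : measurable_fun (setT : set R) (exp_cos t).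
Proof.
apply: measurable_funM; last exact: measurable_cosM.
by apply: measurableT_comp => //; exact: measurable_funM.
Qed.

Lemma measurable_exp_sin t : measurable_fun (setT : set R) (exp_sin t).
Proof.
apply: measurable_funM; last exact: measurable_sinM.
by apply: measurableT_comp => //; exact: measurable_funM.
Qed.

Definition exp_char (t : R) : R[i] :=
  (\int[nu]_y exp_cos t (y - m)) +i* (\int[nu]_y exp_sin t (y - m)).

Lemma integrable_exp_trig (g : R -> R) : measurable_fun setT g -> (forall x, `|g x| <= 1) ->
  nu.-integrable setT (EFin \o (fun y => expR (h * (y - m)) * g (y - m))).
Proof.
move=> mg g1; have mB : measurable_fun (setT : set R) (fun y => y - m) by exact: measurable_funB.
apply: (@integrable_le _ _ R nu setT _ (fun y => expR (- (h * m)) * expR (h * y) + 0 * 0)) => //.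
- apply: measurable_funM; last exact: measurableT_comp.
  by apply: measurableT_comp => //; exact: measurable_funM.
- move=> y _; rewrite normrM ger0_norm ?expR_ge0// mulr0 addr0 -expRD.
  rewrite (_ : - _ + _ = h * (y - m)); last by ring.
  by rewrite ler_piMr ?expR_ge0.
- apply: integrable_lin => //; exact: integrable0.
Qed.

(** The multiplicativity of E exp (z S) over independent summands in real form: the addition
    formulas for cos and sin are the two coordinates of a complex product, so that both integrals,
    with their integrability, go through the induction together. *)
Lemma partial_sum_exp_char n t :
  [/\ P.-integrable setT (EFin \o (fun x => exp_cos t (partial_sum n x - n%:R * m))),
      P.-integrable setT (EFin \o (fun x => exp_sin t (partial_sum n x - n%:R * m))),
      \int[P]_x exp_cos t (partial_sum n x - n%:R * m) = complex.Re (exp_char t ^+ n) &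
      \int[P]_x exp_sin t (partial_sum n x - n%:R * m) = complex.Im (exp_char t ^+ n)].
Proof.
elim: n => [|n [iC iS eC eS]].
  have e0 : P.-integrable setT (EFin \o (fun _ : T => 1 : R)).
    exact: finite_measure_integrable_cst.
  have e1 : P.-integrable setT (EFin \o (fun _ : T => 0 : R)) by exact: integrable0.
  have E1 x : exp_cos t (partial_sum 0 x - 0%:R * m) = 1.
    by rewrite /exp_cos /= mul0r subr0 !mulr0 expR0 cos0 mulr1.
  have E2 x : exp_sin t (partial_sum 0 x - 0%:R * m) = 0.
    by rewrite /exp_sin /= mul0r subr0 !mulr0 expR0 sin0 mulr0.
  split.
  - by apply: eq_integrable e0 => // x _ /=; rewrite E1.
  - by apply: eq_integrable e1 => // x _ /=; rewrite E2.
  - rewrite (@eq_Rintegral _ _ _ P setT (cst 1))//.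
    by rewrite /= Rintegral_cst//= ?probability_setT /= ?mulr1// fin_num_measure.
  - rewrite (@eq_Rintegral _ _ _ P setT (cst 0))//.
    by rewrite Rintegral_cst// mul0r.
have mB (a : R) : measurable_fun (setT : set R) (fun y => y - a) by exact: measurable_funB.
pose F1 s := exp_cos t (s - n%:R * m); pose F2 s := exp_sin t (s - n%:R * m).
pose G1 s := exp_cos t (s - m); pose G2 s := exp_sin t (s - m).
have mF1 : measurable_fun setT F1 := measurableT_comp (measurable_exp_cos t) (mB _).
have mF2 : measurable_fun setT F2 := measurableT_comp (measurable_exp_sin t) (mB _).
have mG1 : measurable_fun setT G1 := measurableT_comp (measurable_exp_cos t) (mB _).
have mG2 : measurable_fun setT G2 := measurableT_comp (measurable_exp_sin t) (mB _).
have iG1 : nu.-integrable setT (EFin \o G1).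
  apply: (@integrable_exp_trig (fun x => cos (t * x))); first exact: measurable_cosM.
  by move=> x; rewrite ler_norml cos_geN1 cos_le1.
have iG2 : nu.-integrable setT (EFin \o G2).
  apply: (@integrable_exp_trig (fun x => sin (t * x))); first exact: measurable_sinM.
  by move=> x; rewrite ler_norml sin_geN1 sin_le1.
have [jG1 eG1] := integrable_law n mG1 iG1.
have [jG2 eG2] := integrable_law n mG2 iG2.
have [i11 e11] := expectation_mul_indep mF1 mG1 iC jG1.
have [i12 e12] := expectation_mul_indep mF1 mG2 iC jG2.
have [i21 e21] := expectation_mul_indep mF2 mG1 iS jG1.
have [i22 e22] := expectation_mul_indep mF2 mG2 iS jG2.
have ZE x : partial_sum n.+1 x - n.+1%:R * m = (partial_sum n x - n%:R * m) + (Z n x - m).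
  by rewrite /= -natr1; ring.
have EC x : exp_cos t (partial_sum n.+1 x - n.+1%:R * m) =
    1 * (F1 (partial_sum n x) * G1 (Z n x)) + (-1) * (F2 (partial_sum n x) * G2 (Z n x)).
  by rewrite ZE /exp_cos /F1 /F2 /G1 /G2 /exp_cos /exp_sin !mulrDr expRD cosD; ring.
have ES x : exp_sin t (partial_sum n.+1 x - n.+1%:R * m) =
    1 * (F1 (partial_sum n x) * G2 (Z n x)) + 1 * (F2 (partial_sum n x) * G1 (Z n x)).
  by rewrite ZE /exp_sin /F1 /F2 /G1 /G2 /exp_cos /exp_sin !mulrDr expRD sinD; ring.
split.
- by apply: eq_integrable (integrable_lin 1 (-1) measurableT i11 i22) => // x _ /=; rewrite -EC.
- by apply: eq_integrable (integrable_lin 1 1 measurableT i12 i21) => // x _ /=; rewrite -ES.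
- rewrite (@eq_Rintegral _ _ _ P setT _ _ (fun x _ => EC x)) Rintegral_lin//.
  rewrite e11 e22 eC eS eG1 eG2 exprSr ReM /=; ring.
- rewrite (@eq_Rintegral _ _ _ P setT _ _ (fun x _ => ES x)) Rintegral_lin//.
  rewrite e12 e21 eC eS eG1 eG2 exprSr ImM /=; ring.
Qed.

End exponential_moments.

End independent_sums.

(** * Laplace representation of the expected positive part *)

Section laplace_representation.
Context d (T : measurableType d) (R : realType) (P : probability T R).
Context (S : T -> R) (mS : measurable_fun setT S) (h : R) (h0 : 0 < h).
Context (exp_int : P.-integrable setT (EFin \o (fun x => expR (h * S x)))).
Local Notation mu := (@lebesgue_measure R).
Local Open Scope complex_scope.

(** E exp (z S) at z = h + i t, in coordinates and not normalised by its value at t = 0. *)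
Definition tilt_char (t : R) : R[i] :=
  (\int[P]_x (expR (h * S x) * cos (t * S x))) +i*
  (\int[P]_x (expR (h * S x) * sin (t * S x))).

(** The weight exp (- z a) / z ^ 2 at z = h + i t. *)
Definition lap_weight (a t : R) : R[i] :=
  (expR (- (h * a)))%:C * cis (- (t * a)) * ((h +i* t)^-1) ^+ 2.

Lemma lap_kernel_shift (s a t : R) : lap_kernel h (s - a) t =
  complex.Re (lap_weight a t) * (expR (h * s) * cos (t * s)) +
  - complex.Im (lap_weight a t) * (expR (h * s) * sin (t * s)).
Proof.
rewrite /lap_kernel /lap_weight.
rewrite (_ : h * (s - a) = h * s + - (h * a)); last by ring.
rewrite (_ : t * (s - a) = t * s + - (t * a)); last by ring.
rewrite expRD cisD.
rewrite !ReM !ImM /=; ring.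
Qed.

Lemma measurable_tilt_trig (g : R -> R) t : measurable_fun (setT : set R) g ->
  measurable_fun setT (fun x => expR (h * S x) * g (t * S x)).
Proof.
move=> mg; have mM (l : R) : measurable_fun setT (fun x => l * S x).
  exact: measurable_funM.
by apply: measurable_funM; apply: (measurableT_comp _ (mM _)).
Qed.

Lemma integrable_tilt_trig (g : R -> R) t : measurable_fun (setT : set R) g ->
  (forall x, `|g x| <= 1) ->
  P.-integrable setT (EFin \o (fun x => expR (h * S x) * g (t * S x))).
Proof.
move=> mg g1; apply: (@integrable_le _ _ R P setT _ (fun x => expR (h * S x))) => //.
- exact: measurable_tilt_trig.
- by move=> x _; rewrite normrM ger0_norm ?expR_ge0// ler_piMr ?expR_ge0.
Qed.

Lemma integrable_tilt_cos t :
  P.-integrable setT (EFin \o (fun x => expR (h * S x) * cos (t * S x))).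
Proof.
apply: integrable_tilt_trig => [|x]; last by rewrite ler_norml cos_geN1 cos_le1.
by apply: continuous_measurable_fun; exact: continuous_cos.
Qed.

Lemma integrable_tilt_sin t :
  P.-integrable setT (EFin \o (fun x => expR (h * S x) * sin (t * S x))).
Proof.
apply: integrable_tilt_trig => [|x]; last by rewrite ler_norml sin_geN1 sin_le1.
by apply: continuous_measurable_fun; exact: continuous_sin.
Qed.

Lemma Rintegral_lap_kernel a t :
  P.-integrable setT (EFin \o (fun x => lap_kernel h (S x - a) t)) /\
  \int[P]_x lap_kernel h (S x - a) t = complex.Re (tilt_char t * lap_weight a t).
Proof.
have E := integrable_lin (complex.Re (lap_weight a t)) (- complex.Im (lap_weight a t))
  measurableT (integrable_tilt_cos t) (integrable_tilt_sin t).
split; first by apply: eq_integrable E => // x _ /=; rewrite lap_kernel_shift.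
rewrite (@eq_Rintegral _ _ _ P setT _ _ (fun x _ => lap_kernel_shift (S x) a t)).
rewrite Rintegral_lin//; [|exact: integrable_tilt_cos|exact: integrable_tilt_sin].
rewrite ReM /=; ring.
Qed.

Lemma measurable_lap_kernel_pair (a : R) :
  measurable_fun setT (fun z : T * measurableTypeR R => lap_kernel h (S z.1 - a) z.2).
Proof.
have m1 : measurable_fun setT (fun z : T * measurableTypeR R => S z.1 - a).
  apply: measurable_funB => //.
  by apply: measurableT_comp => //; exact: measurable_fst.
have m2 : measurable_fun setT (fun z : T * measurableTypeR R => z.2 : R).
  exact: measurable_snd.
have m3 := measurable_inv_sqrD h0.
have m4 := measurableT_comp m3 m2.
have mc : measurable_fun (setT : set R) (@cos R).
  by apply: continuous_measurable_fun; exact: continuous_cos.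
have ms : measurable_fun (setT : set R) (@sin R).
  by apply: continuous_measurable_fun; exact: continuous_sin.
have m5 := measurable_funM m2 m1.
under eq_fun do rewrite lap_kernelE//.
apply: measurable_funM.
  by apply: measurableT_comp => //; exact: measurable_funM.
have mq : measurable_fun setT (fun z : T * measurableTypeR R => ((h ^+ 2 + z.2 ^+ 2)^-1 ^+ 2 : R)).
  exact: measurable_funX.
apply: measurable_funD; apply: measurable_funM.
- exact: (measurableT_comp mc m5).
- apply: measurable_funM => //; apply: measurable_funB => //; exact: measurable_funX.
- exact: (measurableT_comp ms m5).
- by apply: measurable_funM => //; apply: measurable_funM.
Qed.

(** The kernel is at most exp (h (S - a)) / (h ^ 2 + t ^ 2), the product of an integrable function
    on the probability space and an integrable function of t. The second factor would not be
    integrable with 1 / z in place of 1 / z ^ 2. *)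
Lemma integrable_lap_kernel_pair (a : R) :
  (P \x mu)%E.-integrable setT
    (EFin \o (fun z : T * measurableTypeR R => lap_kernel h (S z.1 - a) z.2)).
Proof.
have mK := measurable_lap_kernel_pair a.
apply/integrable12ltyP; first exact/measurable_EFinP.
pose J := \int[mu]_t (h ^+ 2 + t ^+ 2)^-1.
have iJ := integrable_inv_sqrD h0.
have JE : (\int[mu]_t ((h ^+ 2 + t ^+ 2)^-1)%:E = J%:E)%E.
  by rewrite /J /Rintegral fineK// integrable_fin_num.
have J0 : 0 <= J by apply: Rintegral_ge0 => t _; rewrite invr_ge0 ltW// sqrD_gt0.
apply: (@le_lt_trans _ _ (\int[P]_x (J * (expR (- (h * a)) * expR (h * S x)))%:E)%E).
  apply: ge0_le_integral => //.
  - by move=> x _; exact: integral_ge0.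
  - have mK' : measurable_fun setT (fun z : T * measurableTypeR R => `|lap_kernel h (S z.1 - a) z.2|%:E).
      by apply/measurable_EFinP; exact: measurableT_comp.
    exact: (@measurable_fun_fubini_tonelli_F _ _ _ _ _ mu _ mK').
  - apply/measurable_EFinP; apply: measurable_funM => //; apply: measurable_funM => //.
    by apply: measurableT_comp => //; exact: measurable_funM.
  - move=> x _; rewrite mulrC EFinM -JE -ge0_integralZl//; last 2 first.
    + by apply: measurable_int iJ.
    + by move=> t _; rewrite lee_fin invr_ge0 ltW// sqrD_gt0.
    apply: ge0_le_integral => //.
    + have mk := measurable_int _ (integrable_lap_kernel (S x - a) h0).
      exact: (measurableT_comp (@abse_measurable R setT) mk).
    + by apply: measurable_funeM; apply: measurable_int iJ.
    + move=> t _; rewrite /= lee_fin -expRD (_ : - _ + _ = h * (S x - a)); last by ring.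
      exact: lap_kernel_bound.
under eq_integral do rewrite mulrA EFinM.
rewrite ge0_integralZl//; last 2 first.
- by apply: measurable_int exp_int.
- by rewrite lee_fin mulr_ge0 ?expR_ge0.
- by rewrite lte_mul_pinfty ?lee_fin ?mulr_ge0 ?expR_ge0//; apply: integrable_lty.
Qed.

Lemma integrable_posp (a : R) :
  P.-integrable setT (EFin \o (fun x => Num.max (S x - a) 0)).
Proof.
apply: (@integrable_le _ _ R P setT _ (fun x => expR (- (h * a)) / h * expR (h * S x) + 0 * 0)) => //.
- by apply: measurable_maxr => //; exact: measurable_funB.
- move=> x _; rewrite ger0_norm ?le_max ?lexx ?orbT// mulr0 addr0.
  rewrite mulrAC -expRD (_ : - _ + _ = h * (S x - a)); last by ring.
  rewrite ge_max ler_pdivlMr// mulrC divr_ge0 ?expR_ge0 ?(ltW h0)// andbT.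
  by apply: le_trans (expR_ge1Dx _); lra.
- by apply: integrable_lin => //; exact: integrable0.
Qed.

Lemma laplace_representation (C a : R) :
  (forall u, lap_integral h u = C * Num.max u 0) ->
  mu.-integrable setT (EFin \o (fun t => complex.Re (tilt_char t * lap_weight a t))) /\
  C * \int[P]_x Num.max (S x - a) 0 = \int[mu]_t complex.Re (tilt_char t * lap_weight a t).
Proof.
move=> HC; have iK := integrable_lap_kernel_pair a.
have E2 (t : R) : (\int[P]_x (lap_kernel h (S x - a) t)%:E)%E =
    (complex.Re (tilt_char t * lap_weight a t))%:E.
  have [i1 <-] := Rintegral_lap_kernel a t.
  by rewrite /Rintegral fineK// integrable_fin_num.
split.
  pose M := \int[P]_x expR (h * S x).
  apply: (@integrable_le _ _ R mu setT _ (fun t => (expR (- (h * a)) * M) * (h ^+ 2 + t ^+ 2)^-1 + 0 * 0)) => //.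
  - apply/measurable_EFinP; apply: eq_measurable_fun (measurable_fubini_G iK) => t _.
    exact: E2.
  - move=> t _; have [i1 <-] := Rintegral_lap_kernel a t.
    rewrite mulr0 addr0 mulrAC -RintegralZl//; apply: le_norm_Rintegral => //.
    + by apply/measurable_EFinP; apply: measurable_int i1.
    + move=> x _; apply: (le_trans (lap_kernel_bound _ _ h0)).
      rewrite mulrAC -expRD (_ : - _ + _ = h * (S x - a)) //; ring.
    + have := integrable_lin (expR (- (h * a)) / (h ^+ 2 + t ^+ 2)) 0 measurableT exp_int
        (integrable0 P setT (R := R)).
      by apply: eq_integrable => // x _ /=; rewrite mul0r addr0.
  - apply: integrable_lin => //; [exact: integrable_inv_sqrD|exact: integrable0].
have F := Fubini iK.
rewrite -RintegralZl//; last exact: integrable_posp.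
rewrite /Rintegral; congr fine; transitivity (\int[P]_x \int[mu]_t (lap_kernel h (S x - a) t)%:E)%E.
  apply: eq_integral => x _; rewrite -HC /lap_integral /Rintegral fineK//.
  by apply: integrable_fin_num => //; exact: integrable_lap_kernel.
by rewrite F; apply: eq_integral => t _; exact: E2.
Qed.

End laplace_representation.

(** * Smoothed Laplace inversion *)

Section smoothed_inversion.
Context {R : realType}.
Local Notation mu := (@lebesgue_measure R).
Local Notation nc := ComplexField.Normc.normc.
Local Open Scope complex_scope.

Lemma expR_bound1 (x : R) : `|expR x - 1| <= expR `|x| * `|x|.
Proof.
have := @derive_bound R (fun y => expR y - 1) expR (expR `|x|) 0 x; rewrite expr1; apply.
- by move=> y; apply: trigger_derive; rewrite subr0.
- by rewrite expR0 subrr.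
- move=> y yx; rewrite expr0 mulr1 ger0_norm ?expR_ge0// ler_expR.
  exact: le_trans (ler_norm _) yx.
Qed.

Lemma expR_bound2 (x : R) : `|expR x - 1 - x| <= expR `|x| * `|x| ^+ 2.
Proof.
have := @derive_bound R (fun y => expR y - 1 - y) (fun y => expR y - 1) (expR `|x|) 1 x; apply.
- by move=> y; apply: trigger_derive; rewrite subr0.
- by rewrite expR0 subrr subr0.
- move=> y yx; rewrite expr1; apply: (le_trans (expR_bound1 y)).
  by rewrite ler_wpM2r// ler_expR.
Qed.

Definition inv_weight (h t : R) : R[i] := (h +i* t)^-1.

Lemma inv_weightE h t : inv_weight h t =
  (h * (h ^+ 2 + t ^+ 2)^-1) +i* (- (t * (h ^+ 2 + t ^+ 2)^-1)).
Proof. by []. Qed.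

(** The identity 1 / (h ^ 2 + t ^ 2) = (1 - t ^ 2 / (h ^ 2 + t ^ 2)) / h ^ 2 is exact; iterating it
    gives expansions on all of [-1, 1], even for h < 1, where the geometric series does not converge
    there. *)
Lemma taylor0_inv_sqrD (h : R) : 0 < h -> taylor0 (fun t => (h ^+ 2 + t ^+ 2)^-1).
Proof.
move=> h0 N; have h20 : 0 < h ^+ 2 by rewrite exprn_gt0.
elim: N => [|N [p [K K0 HK]]].
  exists 0, (h ^+ 2)^-1 => [|t _]; first by rewrite invr_ge0 ltW.
  rewrite horner0 subr0 expr0 mulr1 ger0_norm ?invr_ge0 ?(ltW (sqrD_gt0 _ _))//.
  by rewrite lef_pV2 ?posrE ?sqrD_gt0// lerDl sqr_ge0.
exists ((h ^+ 2)^-1 *: (1 - 'X^2 * p)), ((h ^+ 2)^-1 * K) => [|t t1].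
  by rewrite mulr_ge0// invr_ge0 ltW.
have d0 := sqrD_gt0 t h0.
rewrite hornerZ hornerD hornerN hornerM hornerXn hornerC.
rewrite (_ : _ - _ = - ((h ^+ 2)^-1 * t ^+ 2 * ((h ^+ 2 + t ^+ 2)^-1 - p.[t]))); last first.
  by field; rewrite !gt_eqF.
have hi : 0 <= (h ^+ 2)^-1 by rewrite invr_ge0 ltW.
rewrite normrN normrM (normrM _ (t ^+ 2)) (ger0_norm hi) -!mulrA ler_wpM2l// normrX.
have := ler_wpM2l (exprn_ge0 2 (normr_ge0 t)) (HK t t1); move=> /le_trans; apply.
rewrite [X in _ <= K * X]exprS [leRHS]mulrCA ler_wpM2r ?mulr_ge0 ?exprn_ge0//.
by rewrite expr2 ler_piMr.
Qed.

Lemma ctaylor0_inv_weight (h : R) : 0 < h -> ctaylor0 (inv_weight h).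
Proof.
move=> h0; have H := taylor0_inv_sqrD h0; split.
  exact: (taylor0M (taylor0_cst h) H).
exact: (taylor0N (taylor0M (@taylor0_id R) H)).
Qed.

Lemma measurable_inv_weight (h : R) : 0 < h ->
  measurable_fun (setT : set R) (fun t => complex.Re (inv_weight h t)) /\
  measurable_fun (setT : set R) (fun t => complex.Im (inv_weight h t)).
Proof.
move=> h0; have H := measurable_inv_sqrD h0; split.
  exact: (measurable_funM (measurable_cst h) H).
apply: measurableT_comp => //; exact: measurable_funM.
Qed.

(* [lap_quotient h e t] tends to [inv_weight h t] = 1 / z as e tends to 0, where z = h + i t:
   it is (1 - exp (- z e)) / (e z ^ 2). *)
Definition lap_quotient (h e t : R) : R[i] :=
  (lap_weight h 0 t - lap_weight h e t) * (e^-1)%:C.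

Lemma measurable_lap_weight (h e : R) : 0 < h ->
  measurable_fun (setT : set R) (fun t => complex.Re (lap_weight h e t)) /\
  measurable_fun (setT : set R) (fun t => complex.Im (lap_weight h e t)).
Proof.
move=> h0; have H := measurable_inv_sqrD h0.
have cE t : cos (- (t * e)) = cos (e * t) by rewrite cosN mulrC.
have sE t : sin (- (t * e)) = - sin (e * t) by rewrite sinN mulrC.
have mc := measurable_cosM e; have ms := measurable_sinM e.
have mt2 : measurable_fun (setT : set R) (fun t : R => t ^+ 2) by exact: measurable_funX.
have mq : measurable_fun (setT : set R) (fun t : R => (h ^+ 2 + t ^+ 2)^-1 ^+ 2).
  exact: measurable_funX.
have mr : measurable_fun (setT : set R) (fun t : R =>
    (h ^+ 2 - t ^+ 2) * (h ^+ 2 + t ^+ 2)^-1 ^+ 2).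
  by apply: measurable_funM => //; exact: measurable_funB.
have mi : measurable_fun (setT : set R) (fun t : R =>
    - (2 * h * t * (h ^+ 2 + t ^+ 2)^-1 ^+ 2)).
  by apply: measurableT_comp => //; apply: measurable_funM => //; exact: measurable_funM.
split.
  rewrite (_ : (fun t => _) = fun t => expR (- (h * e)) * (cos (e * t) * ((h ^+ 2 - t ^+ 2) * (h ^+ 2 + t ^+ 2)^-1 ^+ 2)
     + sin (e * t) * (- (2 * h * t * (h ^+ 2 + t ^+ 2)^-1 ^+ 2)))).
    apply: measurable_funM => //; apply: measurable_funD; exact: measurable_funM.
  apply/funext => t; rewrite /lap_weight inv_sqr_complexE// /cis cE sE !ReM ImM /=; ring.
rewrite (_ : (fun t => _) = fun t => expR (- (h * e)) * (cos (e * t) * (- (2 * h * t * (h ^+ 2 + t ^+ 2)^-1 ^+ 2))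
   - sin (e * t) * ((h ^+ 2 - t ^+ 2) * (h ^+ 2 + t ^+ 2)^-1 ^+ 2))).
  apply: measurable_funM => //; apply: measurable_funB; exact: measurable_funM.
apply/funext => t; rewrite /lap_weight inv_sqr_complexE// /cis cE sE !ImM !ReM /=; ring.
Qed.

Lemma measurable_lap_quotient (h e : R) : 0 < h ->
  measurable_fun (setT : set R) (fun t => complex.Re (lap_quotient h e t)) /\
  measurable_fun (setT : set R) (fun t => complex.Im (lap_quotient h e t)).
Proof.
move=> h0; have [r0 i0] := measurable_lap_weight 0 h0; have [re ie] := measurable_lap_weight e h0.
split.
  rewrite (_ : (fun t => _) = fun t =>
    (complex.Re (lap_weight h 0 t) - complex.Re (lap_weight h e t)) * e^-1).
    by apply: measurable_funM => //; exact: measurable_funB.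
  by apply/funext => t; rewrite /lap_quotient; do 2 case: lap_weight => ? ?; rewrite ReM /=; ring.
rewrite (_ : (fun t => _) = fun t =>
  (complex.Im (lap_weight h 0 t) - complex.Im (lap_weight h e t)) * e^-1).
  by apply: measurable_funM => //; exact: measurable_funB.
by apply/funext => t; rewrite /lap_quotient; do 2 case: lap_weight => ? ?; rewrite ImM /=; ring.
Qed.

Lemma expR_norm_le (h e : R) : 0 < h -> `|e| <= 1 -> expR (- (h * e)) <= expR h.
Proof.
move=> h0; rewrite ler_norml => /andP[e1 e2]; rewrite ler_expR; nra.
Qed.

(** The estimate for t away from 0: the two weights are bounded separately, so the division by e is
    paid in full. *)
Lemma lap_quotient_bound (h e t : R) : 0 < h -> `|e| <= 1 ->
  nc (lap_quotient h e t) <= (1 + expR h) / `|e| * (h ^+ 2 + t ^+ 2)^-1.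
Proof.
move=> h0 e1; rewrite /lap_quotient /lap_weight -mulrBl.
have := @normc_inv_sqr R h t h0; move: ((h +i* t : R[i])^-1 ^+ 2) => q qE.
rewrite !ComplexField.Normc.normcM qE normc_real normfV mulrAC ler_wpM2r ?invr_ge0 ?(ltW (sqrD_gt0 _ _))//.
rewrite ler_wpM2r ?invr_ge0//.
apply: (le_trans (le_normcD _ _)).
rewrite normcN !ComplexField.Normc.normcM !normc_real !normc_cis !mulr1.
rewrite mulr0 oppr0 expR0 normr1 lerD2l ger0_norm ?expR_ge0//.
exact: expR_norm_le.
Qed.

(** The estimate near 0: the difference is (1 - exp (- z e) - z e) / (e z ^ 2), whose numerator is
    of second order in e. *)
Lemma lap_quotient_approx (h : R) : 0 < h -> exists2 K : R, 0 <= K &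
  forall e t, e != 0 -> `|e| <= 1 -> `|t| <= 1 ->
  nc (lap_quotient h e t - inv_weight h t) <= K * `|e|.
Proof.
move=> h0; have h20 : 0 < h ^+ 2 by rewrite exprn_gt0.
have H0 := expR_gt0 h.
exists (expR h * (h ^+ 2 + h + 2) / h ^+ 2).
  by rewrite divr_ge0 ?(ltW h20)// mulr_ge0 ?(ltW H0)//; nra.
move=> e t en0 e1 t1; have d0 := sqrD_gt0 t h0.
pose w : R[i] := 1 - (expR (- (h * e)))%:C * cis (- (t * e)) - e%:C * (h +i* t).
have z0 : (h +i* t : R[i]) != 0.
  by rewrite eq_complex /= (gt_eqF h0).
have e0' : e%:C != 0 :> R[i] by rewrite eq_complex /= (negPf en0).
have eV : (e^-1)%:C = (e%:C)^-1 :> R[i] by rewrite rmorphV ?unitfE.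
have -> : lap_quotient h e t - inv_weight h t = w * (e^-1)%:C * ((h +i* t)^-1) ^+ 2.
  rewrite /lap_quotient /lap_weight /inv_weight /w !mulr0 oppr0 expR0 cis0 eV.
  by field; rewrite z0 e0'.
have := @normc_inv_sqr R h t h0; move: ((h +i* t : R[i])^-1 ^+ 2) => q qE.
rewrite !ComplexField.Normc.normcM qE normc_real normfV.
have ne0 : 0 < `|e| by rewrite normr_gt0.
have bw : nc w <= expR h * (h ^+ 2 + h + 2) * `|e| ^+ 2.
  apply: (le_trans (normc_le _)).
  have -> : complex.Re w = - (expR (- (h * e)) - 1 - (- (h * e))) - expR (- (h * e)) * (cos (t * e) - 1).
    by rewrite /w !ReD /= /cis cosN sinN; ring.
  have -> : complex.Im w = expR (- (h * e)) * (sin (t * e) - t * e) + t * e * (expR (- (h * e)) - 1).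
    by rewrite /w !ImD /= /cis cosN sinN; ring.
  have b1 := expR_bound1 (- (h * e)); have b2 := expR_bound2 (- (h * e)).
  have b3 := cos_bound2 (t * e); have b4 := sin_bound3 (t * e).
  have he : expR (- (h * e)) <= expR h := expR_norm_le h0 e1.
  have he' : expR `|- (h * e)| <= expR h.
    by rewrite ler_expR normrN normrM gtr0_norm// ler_piMr// ltW.
  have a1 : `|- (h * e)| = h * `|e| by rewrite normrN normrM gtr0_norm.
  have a2 : `|t * e| <= `|e| by rewrite normrM ler_piMl.
  have E0 := expR_ge0 (- (h * e)).
  have p1 : `|expR (- (h * e)) - 1 - - (h * e)| <= expR h * (h ^+ 2 * `|e| ^+ 2).
    apply: (le_trans b2); by rewrite -exprMn -a1 ler_wpM2r// exprn_ge0.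
  have p2 : `|expR (- (h * e)) * (cos (t * e) - 1)| <= expR h * `|e| ^+ 2.
    rewrite normrM (ger0_norm E0); apply: ler_pM => //; apply: (le_trans b3).
    by rewrite ler_pXn2r ?nnegrE.
  have p3 : `|expR (- (h * e)) * (sin (t * e) - t * e)| <= expR h * `|e| ^+ 2.
    rewrite normrM (ger0_norm E0); apply: ler_pM => //; apply: (le_trans b4).
    apply: (@le_trans _ _ (`|e| ^+ 3)); first by rewrite ler_pXn2r ?nnegrE.
    by rewrite exprS ler_piMl ?exprn_ge0.
  have p4 : `|t * e * (expR (- (h * e)) - 1)| <= expR h * (h * `|e| ^+ 2).
    rewrite normrM; apply: (@le_trans _ _ (`|e| * (expR h * (h * `|e|)))).
      apply: ler_pM => //; apply: (le_trans b1); rewrite -a1 ler_wpM2r//.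
    by rewrite expr2; lra.
  apply: (@le_trans _ _ ((expR h * (h ^+ 2 * `|e| ^+ 2) + expR h * `|e| ^+ 2) +
     (expR h * `|e| ^+ 2 + expR h * (h * `|e| ^+ 2)))); last by lra.
  apply: lerD; apply: (le_trans (ler_normD _ _)); apply: lerD => //; by rewrite normrN.
rewrite -mulrA [leRHS]mulrAC.
apply: (@le_trans _ _ (expR h * (h ^+ 2 + h + 2) * `|e| ^+ 2 * (`|e|^-1 * (h ^+ 2 + t ^+ 2)^-1))).
  by rewrite ler_wpM2r// mulr_ge0// invr_ge0 ?(ltW d0).
rewrite [X in X * (_ * _)](_ : _ = expR h * (h ^+ 2 + h + 2) * `|e| * `|e|); last by rewrite expr2 mulrA.
rewrite mulrA mulfK ?gt_eqF// ler_wpM2l//.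
  by rewrite mulr_ge0// mulr_ge0 ?(ltW H0)//; nra.
by rewrite lef_pV2 ?posrE// lerDl sqr_ge0.
Qed.

End smoothed_inversion.

(** * Expansion of the smoothed inversion integral *)

Section smoothed_expansion.
Context {R : realType}.
Local Notation mu := (@lebesgue_measure R).
Local Notation nc := ComplexField.Normc.normc.
Local Open Scope complex_scope.
Context (phi : R -> R[i]) (h : R) (h0 : 0 < h).
Context (mre : measurable_fun setT (fun t => complex.Re (phi t))).
Context (mim : measurable_fun setT (fun t => complex.Im (phi t))).
Context (phi_le1 : forall t, nc (phi t) <= 1).

Definition smoothed_inversion (n : nat) (e : R) : R :=
  \int[mu]_t complex.Re (phi t ^+ n * lap_quotient h e t).

(** On [-de, de] the quotient is replaced by 1 / z at a cost O(|e|), as |phi| <= 1. Outside, the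
    integrand is at most rho ^ n times the bound O(1 / |e|) of the quotient, which is integrable in
    t. *)
Lemma smoothed_inversion_approx (de rho : R) : 0 < de <= 1 -> 0 < rho ->
  (forall t, de <= `|t| -> nc (phi t) <= rho) ->
  exists2 L : R, 0 <= L & forall n e, e != 0 -> `|e| <= 1 ->
  `|smoothed_inversion n e - \int[mu]_(t in `[- de, de]) complex.Re (inv_weight h t * phi t ^+ n)|
  <= L * (`|e| + rho ^+ n / `|e|).
Proof.
move=> /andP[de0 de1] rho0 Hrho.
have [K1 K10 HK1] := lap_quotient_approx h0.
pose J := \int[mu]_t (h ^+ 2 + t ^+ 2)^-1.
have iJ := integrable_inv_sqrD h0.
have J0 : 0 <= J by apply: Rintegral_ge0 => t _; rewrite invr_ge0 ltW// sqrD_gt0.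
have H0 := expR_gt0 h.
exists (2 * K1 + (1 + expR h) * J) => [|n e en0 e1].
  by apply: addr_ge0; apply: mulr_ge0 => //; lra.
have ne0 : 0 < `|e| by rewrite normr_gt0.
have [mqr mqi] := measurable_lap_quotient e h0.
have [mgr mgi] := measurable_inv_weight h0.
have [mpr mpi] := measurable_reimX n mre mim.
have mf := measurable_reM mpr mpi mqr mqi.
have mg := measurable_reM mgr mgi mpr mpi.
pose I : set R := `[- de, de]%classic.
have mI : measurable I by exact: measurable_itv.
pose f t := complex.Re (phi t ^+ n * lap_quotient h e t).
pose g t := complex.Re (inv_weight h t * phi t ^+ n).
have phin t : nc (phi t ^+ n) <= 1 by rewrite normcX exprn_ile1 ?normc_ge0.
have bq t := lap_quotient_bound t h0 e1.
have i2 c : mu.-integrable setT (EFin \o (fun t => c * (h ^+ 2 + t ^+ 2)^-1)).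
  by have := integrableZl measurableT c iJ; apply: eq_integrable.
have fi : mu.-integrable setT (EFin \o f).
  apply: (@integrable_le _ _ R mu setT f (fun t => (1 + expR h) / `|e| * (h ^+ 2 + t ^+ 2)^-1)) => //.
  move=> t _; apply: (le_trans (normc_re _)); rewrite ComplexField.Normc.normcM.
  apply: le_trans (bq t); rewrite ler_piMl ?normc_ge0//.
have Ib t : I t -> `|t| <= de by rewrite /I /= in_itv /= ler_norml.
have iI : mu.-integrable setT (EFin \o (\1_I : R -> R)).
  have i1 := @integrable_oneDsqrV R.
  apply: (@integrable_le _ _ R mu setT _ (fun t => 2 * (1 + t ^+ 2)^-1)) => //.
  - move=> t _; have p0 : 0 < 1 + t ^+ 2 by rewrite ltr_pwDl ?sqr_ge0.
    rewrite indicE; have [/set_mem /Ib It|_] := boolP (t \in I); last first.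
      by rewrite normr0 mulr_ge0// invr_ge0 ltW.
    rewrite normr1 ler_pdivlMr// mul1r -[t ^+ 2]real_normK ?num_real//.
    have : `|t| ^+ 2 <= 1 by rewrite expr_le1//; exact: le_trans de1.
    lra.
  - by have := integrableZl measurableT 2 i1; apply: eq_integrable.
have gi : mu.-integrable setT (EFin \o (g \_ I)).
  apply: (@integrable_le _ _ R mu setT _ (fun t => h ^-1 * \1_I t + 0 * \1_I t)) => //.
  - by apply/measurable_restrict => //; apply: measurable_funTS.
  - move=> t _; rewrite mul0r addr0 patchE indicE; case: ifPn => tI; last first.
      by rewrite normr0 mulr0.
    rewrite mulr1; apply: (le_trans (normc_re _)); rewrite ComplexField.Normc.normcM.
    apply: (@le_trans _ _ (nc (inv_weight h t))); first by rewrite ler_piMr ?normc_ge0.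
    rewrite -(ler_pXn2r (n := 2)) ?nnegrE ?normc_ge0 ?invr_ge0 ?(ltW h0)//.
    rewrite -normcX normc_inv_sqr// exprVn lef_pV2 ?posrE ?exprn_gt0 ?sqrD_gt0//.
    by rewrite lerDl sqr_ge0.
  - exact: integrable_lin.
have -> : \int[mu]_(t in `[- de, de]) g t = \int[mu]_t (g \_ I) t.
  by rewrite Rintegral_mkcond.
rewrite /smoothed_inversion -RintegralB//.
have Imu : \int[mu]_t \1_I t = 2 * de.
  have muI : mu I = (2 * de)%:E.
    rewrite /I lebesgue_measure_itv /= lte_fin ifT /= -?EFinD; first by congr EFin; ring.
    lra.
  transitivity (fine (mu I)); last by rewrite muI.
  by rewrite /Rintegral integral_indic// setIT.
have -> : (2 * K1 + (1 + expR h) * J) * (`|e| + rho ^+ n / `|e|) =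
   (K1 * `|e| * 2 + 2 * K1 * (rho ^+ n / `|e|) + (1 + expR h) * J * `|e|) +
   rho ^+ n * ((1 + expR h) / `|e|) * J by field; rewrite gt_eqF.
have r0 : 0 <= rho ^+ n by rewrite exprn_ge0// ltW.
apply: (@le_trans _ _ (K1 * `|e| * (2 * de) + rho ^+ n * ((1 + expR h) / `|e|) * J)); last first.
  rewrite lerD2r; have p1 : 0 <= K1 * `|e| by exact: mulr_ge0.
  have p2 : 0 <= 2 * K1 * (rho ^+ n / `|e|) by rewrite mulr_ge0 ?divr_ge0//; lra.
  have p3 : 0 <= (1 + expR h) * J * `|e| by rewrite mulr_ge0 ?mulr_ge0//; lra.
  have : K1 * `|e| * (2 * de) <= K1 * `|e| * 2 by rewrite ler_wpM2l//; lra.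
  lra.
rewrite -Imu -Rintegral_lin//; last first.
apply: le_norm_Rintegral => //.
- apply: measurable_funB => //; by apply/measurable_EFinP; apply: measurable_int gi.
- move=> t _; rewrite patchE indicE; case: ifPn => tI.
    have tI' : I t by rewrite inE in tI.
    have t1 : `|t| <= 1 by rewrite (le_trans (Ib t tI')).
    have -> : f t - g t = complex.Re (phi t ^+ n * (lap_quotient h e t - inv_weight h t)).
      rewrite /f /g; move: (phi t ^+ n) (lap_quotient h e t) (inv_weight h t) => [? ?] [? ?] [? ?].
      by rewrite !ReM /=; ring.
    rewrite mulr1 -[leLHS]addr0; apply: lerD; last first.
      by rewrite !mulr_ge0 ?invr_ge0 ?(ltW (sqrD_gt0 _ _))//; lra.
    apply: (le_trans (normc_re _)); rewrite ComplexField.Normc.normcM.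
    by apply: le_trans (HK1 e t en0 e1 t1); rewrite ler_piMl ?normc_ge0.
  rewrite mulr0 add0r subr0 -mulrA; apply: (le_trans (normc_re _)).
  rewrite ComplexField.Normc.normcM; apply: ler_pM; rewrite ?normc_ge0//.
  rewrite normcX lerXn2r ?nnegrE ?normc_ge0 ?(ltW rho0)//; apply: Hrho.
  rewrite leNgt; apply/negP => td; move/negP: tI; apply; rewrite inE /I /= in_itv /=.
  by rewrite -ler_norml ltW.
- exact: integrable_lin.
Qed.

(** The hypothesis relating [A] to the inversion integrals says that A n lies between those with
    steps e and -e. It is expressed through balls rather than inequalities, so that it does not
    depend on which of the two is larger. *)
Lemma smoothed_expansion (s2 K : R) (A : nat -> R) : 0 < s2 -> 0 <= K ->
  ctaylor0 phi ->
  (forall t, `|t| <= 1 -> nc (phi t - (1 - s2 / 2 * t ^+ 2)%:C) <= K * `|t| ^+ 3) ->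
  (forall de, 0 < de <= 1 -> exists2 rho, 0 < rho < 1 &
     forall t, de <= `|t| -> nc (phi t) <= rho) ->
  (forall n e, (0 < n)%N -> 0 < e <= 1 -> forall v w : R,
     `|smoothed_inversion n e - v| <= w -> `|smoothed_inversion n (- e) - v| <= w ->
     `|A n - v| <= w) ->
  forall k, inv_expansion k (fun n => Num.sqrt n%:R * A n) (h^-1 * gauss_moment 0 (s2 / 2)).
Proof.
move=> s20 K0 tphi H3 Hcr HA k.
have [mgr mgi] := measurable_inv_weight h0.
have [de [de01 Hde]] := laplace_expansion s20 mre mim mgr mgi tphi (ctaylor0_inv_weight h0) K0 H3.
have [rho /andP[rho0 rho1] Hrho] := Hcr de de01.
have [L L0 HL] := smoothed_inversion_approx de01 rho0 Hrho.
have g0 : complex.Re (inv_weight h 0) = h^-1.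
  by rewrite inv_weightE /= expr0n /= addr0; field; rewrite gt_eqF.
have lr : 0 < - ln rho by rewrite oppr_gt0 ln_lt0// rho0.
(* The exponent 2 k + 2 is 1 + (k + 1) + k: one factor n bounds sqrt n, n ^ (k + 1) is 1 / e, and n
   ^ k is the required rate. *)
have [B B0 HB] := @pow_expR_bounded R (2 * k + 2) _ lr.
have := Hde k; rewrite g0 => He.
apply: (@inv_expansion_approx R k _ _ _ (L * (1 + B)) He) => n n0 {He}.
have nR : 0 < n%:R :> R by rewrite ltr0n.
have n1 : 1 <= n%:R :> R by rewrite ler1n.
(* The exponent k + 1 instead of k pays for the factor sqrt n <= n. *)
pose e : R := (n%:R ^+ k.+1)^-1.
have e0 : 0 < e by rewrite invr_gt0 exprn_gt0.
have e1 : e <= 1 by rewrite invf_le1 ?exprn_gt0// exprn_ege1.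
rewrite -mulrBr normrM ger0_norm ?sqrtr_ge0//.
have sn : Num.sqrt n%:R <= n%:R :> R.
  rewrite -(ler_pXn2r (n := 2)) ?nnegrE ?sqrtr_ge0 ?(ltW nR)// sqr_sqrtr ?(ltW nR)//.
  by rewrite expr2 ler_peMl// (ltW nR).
have bnd : `|A n - \int[mu]_(t in `[- de, de]) complex.Re (inv_weight h t * phi t ^+ n)| <=
    L * (e + rho ^+ n / e).
  apply: (HA n e n0); rewrite ?e0//.
  - have := HL n e; rewrite (gtr0_norm e0); apply => //; exact: lt0r_neq0.
  - have := HL n (- e); rewrite normrN (gtr0_norm e0) oppr_eq0; apply => //; exact: lt0r_neq0.
apply: (@le_trans _ _ (n%:R * (L * (e + rho ^+ n / e)))).
  by apply: ler_pM => //; exact: sqrtr_ge0.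
rewrite mulrCA -[leRHS]mulrA ler_wpM2l// mulrDl mulrDr; apply: lerD.
  by rewrite /e exprS invfM mulrA mulfV ?mul1r ?gt_eqF.
rewrite ler_pdivlMr ?exprn_gt0//; have := HB n%:R (ltW nR).
rewrite (_ : expR _ = rho ^+ n); last first.
  by rewrite mulNr opprK mulrC expRM_natl lnK.
apply: le_trans; rewrite /e invrK.
rewrite (_ : (2 * k + 2)%N = (1 + (k.+1 + k))%N); last by clear; lia.
by rewrite 2!exprD expr1 le_eqVlt; apply/orP; left; apply/eqP; ring.
Qed.

End smoothed_expansion.

(** * Exponential tilting *)

Section tilted_law.
Context {R : realType} (nu : probability R R) (h m b : R) (b0 : 0 < b).
Local Notation nc := ComplexField.Normc.normc.
Local Open Scope complex_scope.

(* The distance of [t * y] to any translate of [2 * pi * int] is bounded away from 0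
   with [nu]-probability at least [b], uniformly in large [t]. *)
Definition cramer_condition := forall de : R, 0 < de ->
  exists L eta : R, 0 < eta /\ forall t th, de <= t -> exists D : set R,
    [/\ measurable D, (forall y, D y -> `|y| <= L),
        (forall y, D y -> cos (t * y - th) <= 1 - eta) & b <= fine (nu D)].

Context (cramer : cramer_condition).

Definition tilt (y : R) : R := expR (h * (y - m)).

Lemma measurable_tilt : measurable_fun (setT : set R) tilt.
Proof.
apply: measurableT_comp => //; apply: measurable_funM => //.
exact: measurable_funB.
Qed.

Lemma tilt_ge0 y : 0 <= tilt y. Proof. exact: expR_ge0. Qed.

Lemma tilt_lower (L : R) : exists2 wm : R, 0 < wm & forall y, `|y| <= L -> wm <= tilt y.
Proof.
exists (expR (- (`|h| * (L + `|m|)))) => [|y yL]; first exact: expR_gt0.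
rewrite ler_expR; apply: lerNnormlW; rewrite normrM ler_wpM2l//.
by apply: (le_trans (ler_normB _ _)); rewrite lerD2r.
Qed.

Lemma Rintegral_ge_on (f : R -> R) (c : R) (D : set R) : measurable D ->
  nu.-integrable setT (EFin \o f) -> (forall y, 0 <= f y) -> (forall y, D y -> c <= f y) ->
  c * fine (nu D) <= \int[nu]_y f y.
Proof.
move=> mD fi f0 fc; have iD := integrable_indic nu mD.
have -> : c * fine (nu D) = \int[nu]_y (c * \1_D y).
  by rewrite RintegralZl// /Rintegral integral_indic// setIT.
apply: le_Rintegral => //.
  by have := integrableZl measurableT c iD; apply: eq_integrable.
by move=> y _; rewrite indicE; have [/set_mem /fc|_] := boolP (y \in D); rewrite ?mulr1 ?mulr0.
Qed.

Context (tilt_int : forall k, nu.-integrable setT (EFin \o (fun y => tilt y * `|y - m| ^+ k))).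

Lemma measurable_centered : measurable_fun (setT : set R) (fun y => y - m).
Proof. exact: measurable_funB. Qed.

Lemma tilt_integrable : nu.-integrable setT (EFin \o tilt).
Proof. by have := tilt_int 0; apply: eq_integrable => // y _ /=; rewrite expr0 mulr1. Qed.

(** This is exp (- h m) times the moment generating function at h, that is exp (- alpha) when m is
    the value of [mbar] at h; its n-th power is the exponential factor of the tail. *)
Definition tilt_mass : R := \int[nu]_y tilt y.
Definition tilt_var : R := (\int[nu]_y (tilt y * (y - m) ^+ 2)) / tilt_mass.

Lemma tilt_mass_gt0 : 0 < tilt_mass.
Proof.
have [L [eta [eta0 H]]] := cramer ltr01.
have [D [mD DL _ bD]] := H 1 0 (lexx 1).
have [wm wm0 Hwm] := tilt_lower L.
have := Rintegral_ge_on mD tilt_integrable tilt_ge0 (fun y Dy => Hwm y (DL y Dy)).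
apply: lt_le_trans; rewrite mulr_gt0//; exact: lt_le_trans bD.
Qed.

Lemma tilt_var_gt0 : 0 < tilt_var.
Proof.
apply: divr_gt0; last exact: tilt_mass_gt0.
have [L [eta [eta0 H]]] := cramer ltr01.
(* With t = 1 and phase m, cos (y - m) <= 1 - eta on D forces (y - m) ^ 2 >= eta there. *)
have [D [mD DL Dc bD]] := H 1 m (lexx 1).
have [wm wm0 Hwm] := tilt_lower L.
have i2 : nu.-integrable setT (EFin \o (fun y => tilt y * (y - m) ^+ 2)).
  by have := tilt_int 2; apply: eq_integrable => // y _ /=; rewrite real_normK ?num_real.
have := @Rintegral_ge_on (fun y => tilt y * (y - m) ^+ 2) (wm * eta) D mD i2.
have p0 : 0 < wm * eta by rewrite mulr_gt0.
move=> G; apply: (lt_le_trans _ (G _ _)).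
- by rewrite mulr_gt0//; exact: lt_le_trans bD.
- by move=> y; rewrite mulr_ge0 ?tilt_ge0 ?sqr_ge0.
- move=> y Dy; apply: ler_pM; rewrite ?(ltW wm0) ?(ltW eta0)//; first exact/Hwm/DL.
  have := Dc _ Dy; rewrite mul1r => c1.
  have := cos_bound2 (y - m); rewrite real_normK ?num_real// ler_norml => /andP[]; lra.
Qed.

Let w y := tilt y / tilt_mass.
Let X y := y - m.

Lemma measurable_tilt_density : measurable_fun (setT : set R) w.
Proof. by apply: measurable_funM => //; exact: measurable_tilt. Qed.

Lemma tilt_density_ge0 y : 0 <= w y.
Proof. by rewrite divr_ge0 ?tilt_ge0 ?(ltW tilt_mass_gt0). Qed.

Lemma tilt_density_int k : nu.-integrable setT (EFin \o (fun y => w y * `|X y| ^+ k)).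
Proof.
have := integrableZl measurableT tilt_mass^-1 (tilt_int k); apply: eq_integrable => // y _ /=.
by rewrite -EFinM; congr EFin; rewrite /w /X; ring.
Qed.

Lemma tilt_integrable_pow k : nu.-integrable setT (EFin \o (fun y => tilt y * (y - m) ^+ k)).
Proof.
have mk : measurable_fun (setT : set R) (fun y => (y - m) ^+ k).
  by apply: measurable_funX; exact: measurable_centered.
apply: (@integrable_le _ _ R nu setT _ (fun y => tilt y * `|y - m| ^+ k)) => //.
- by apply: measurable_funM => //; exact: measurable_tilt.
- by move=> y _; rewrite normrM normrX (ger0_norm (tilt_ge0 y)).
Qed.

Lemma tilt_density_moment k :
  wmoment nu w X k = (\int[nu]_y (tilt y * (y - m) ^+ k)) / tilt_mass.
Proof.
rewrite mulrC -RintegralZl//; last exact: tilt_integrable_pow.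
by apply: eq_Rintegral => y _; rewrite /w /X; ring.
Qed.

Lemma tilt_moment0 : wmoment nu w X 0 = 1.
Proof.
rewrite tilt_density_moment (_ : \int[nu]_y _ = tilt_mass) ?divff ?gt_eqF ?tilt_mass_gt0//.
by apply: eq_Rintegral => y _; rewrite expr0 mulr1.
Qed.

Lemma exp_char_tilt t : exp_char nu h m t = tilt_mass%:C * wchar nu w X t.
Proof.
have M0 : tilt_mass != 0 by rewrite gt_eqF ?tilt_mass_gt0.
rewrite /exp_char /wchar; apply/eqP; rewrite eq_complex ReM ImM /= !mul0r subr0 addr0.
apply/andP; split; apply/eqP.
  rewrite /wcos -RintegralZl//; last exact: (integrable_wcos measurable_tilt_density measurable_centered tilt_density_ge0 tilt_density_int).
  by apply: eq_Rintegral => y _; rewrite /exp_cos /w /X mulrA; congr (_ * _); rewrite mulrCA divff ?mulr1.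
rewrite /wsin -RintegralZl//; last exact: (integrable_wsin measurable_tilt_density measurable_centered tilt_density_ge0 tilt_density_int).
by apply: eq_Rintegral => y _; rewrite /exp_sin /w /X mulrA; congr (_ * _); rewrite mulrCA divff ?mulr1.
Qed.

(** On the bounded set of Cramer's condition the tilted density is at least c > 0, so the integral
    of cos (t X - th) is at most q = 1 - c eta b for every phase th; [wchar_sqr_bound] turns this
    into a bound for the modulus. *)
Lemma tilt_char_gap (de : R) : 0 < de -> exists2 rho : R, 0 < rho < 1 &
  forall t, de <= `|t| -> nc (wchar nu w X t) <= rho.
Proof.
move=> de0; have [L [eta [eta0 H]]] := cramer de0.
have [wm wm0 Hwm] := tilt_lower L.
have M0 := tilt_mass_gt0.
pose c := wm / tilt_mass.
have c0 : 0 < c by rewrite divr_gt0.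
have ce0 : 0 < c * eta by rewrite mulr_gt0.
pose q := 1 - c * eta * b.
have q1 : q < 1 by rewrite /q gtrBl mulr_gt0.
have gap t th : de <= t -> \int[nu]_y (w y * cos (t * X y - th)) <= q.
  move=> det; have [D [mD DL Dc bD]] := H t (th + t * m) det.
  have G := @wcos_gap _ _ R nu w X measurable_tilt_density measurable_centered tilt_density_ge0
    tilt_density_int t th c eta D mD tilt_moment0.
  apply: (le_trans (G _ (ltW c0) (ltW eta0) _)).
  - by move=> y Dy; rewrite /c /w ler_wpM2r ?invr_ge0 ?(ltW M0)//; exact/Hwm/DL.
  - by move=> y Dy; have := Dc y Dy; rewrite /X (_ : t * y - _ = t * (y - m) - th)//; ring.
  - by rewrite /q lerD2l lerN2 ler_wpM2l// ltW.
have key t : de <= `|t| -> nc (wchar nu w X t) ^+ 2 <= q.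
  move=> det; apply: (wchar_sqr_bound measurable_tilt_density measurable_centered
    tilt_density_ge0 tilt_density_int tilt_moment0) => th.
  have [t0|t0] := leP 0 t; first by apply: gap; rewrite ger0_norm in det.
  rewrite (@eq_Rintegral _ _ _ nu setT (fun y => w y * cos (- t * X y - - th))).
    by apply: gap; rewrite ltr0_norm in det.
  by move=> y _; congr (_ * _); rewrite -[LHS]cosN; congr cos; rewrite /X; ring.
have q0 : 0 <= q by apply: le_trans (key de _); rewrite ?sqr_ge0// ler_norm.
(* q bounds the square of the modulus, and (1 + q) / 2 is a bound for sqrt q that stays strictly
   between 0 and 1. *)
exists ((1 + q) / 2) => [|t det]; first by apply/andP; split; lra.
rewrite -(ler_pXn2r (n := 2)) ?nnegrE ?normc_ge0//; last by lra.
by apply: (le_trans (key t det)); have := sqr_ge0 ((1 - q) / 2); rewrite !expr2; lra.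
Qed.

End tilted_law.

(** * Tail probabilities between differences of positive parts *)

Section tail_sandwich.
Context d (T : measurableType d) (R : realType) (P : probability T R).
Context (S : T -> R) (mS : measurable_fun setT S).
Context (iS : forall a, P.-integrable setT (EFin \o (fun x => Num.max (S x - a) 0))).

(** Pointwise, max (s, 0) - max (s - e, 0) is at most e times the indicator of s > 0, which is at
    most max (s + e, 0) - max (s, 0). *)
Lemma tail_sandwich (e : R) : 0 < e ->
  \int[P]_x Num.max (S x - 0) 0 - \int[P]_x Num.max (S x - e) 0 <=
    e * fine (P [set x | 0 < S x]) /\
  e * fine (P [set x | 0 < S x]) <=
    \int[P]_x Num.max (S x - - e) 0 - \int[P]_x Num.max (S x - 0) 0.
Proof.
move=> e0; pose A := [set x | 0 < S x].
have mA : measurable A.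
  rewrite (_ : A = S @^-1` `]0, +oo[%classic); first by rewrite -[X in measurable X]setTI; exact: mS.
  by apply/seteqP; split => x /=; rewrite /A /= in_itv /= andbT.
have iA := integrable_indic P mA.
have iAe : P.-integrable setT (EFin \o (fun x => e * \1_A x)).
  by have := integrableZl measurableT e iA; apply: eq_integrable.
have -> : e * fine (P A) = \int[P]_x (e * \1_A x).
  by rewrite RintegralZl// /Rintegral integral_indic// setIT.
have indA x : \1_A x = (0%R < S x)%R%:R :> R.
  by rewrite indicE; congr (nat_of_bool _)%:R; apply/idP/idP => [/set_mem|Ax]//; exact/mem_set.
have iB a b := integrableB measurableT (iS a) (iS b).
have mx s : Num.max s 0 = if 0 < s then s else 0 :> R by case: ltP.
rewrite -!RintegralB//; split; apply: le_Rintegral => //; try exact: iB;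
  move=> x _; rewrite indA subr0 !mx ?opprK; case: (ltP 0 (S x)) => s0;
  case: ltP => s1 /=; lra.
Qed.

End tail_sandwich.

(** * Expansion of the tail of a sum under exponential tilting *)

Section large_deviation_expansion.
Context d (T : measurableType d) (R : realType) (P : probability T R).
Context (Z : nat -> {RV P >-> R}) (Z_indep : mutually_independent Z).
Context (nu : probability R R).
Context (Z_law : forall n (A : set R), measurable A -> P (Z n @^-1` A) = nu A).
Context (h m b : R) (h0 : 0 < h) (b0 : 0 < b) (cramer : cramer_condition nu b).
Context (exp_int : nu.-integrable setT (EFin \o (fun y => expR (h * y)))).
Context (tilt_int : forall k, nu.-integrable setT (EFin \o (fun y => tilt h m y * `|y - m| ^+ k))).
Context (tilt_mean : \int[nu]_y (tilt h m y * (y - m)) = 0).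
Local Notation mu := (@lebesgue_measure R).
Local Notation nc := ComplexField.Normc.normc.
Local Open Scope complex_scope.
Local Notation M := (tilt_mass nu h m).
Local Notation centered_sum n := (fun x => partial_sum Z n x - n%:R * m).
Local Notation density := (fun y => tilt h m y / tilt_mass nu h m).
Local Notation center := (fun y : R => y - m).
Local Notation phi := (wchar nu density center).

Lemma measurable_centered_sum n : measurable_fun setT (centered_sum n).
Proof. exact: measurable_funB. Qed.

Lemma integrable_exp_centered_sum n :
  P.-integrable setT (EFin \o (fun x => expR (h * centered_sum n x))).
Proof.
have [i _ _ _] := partial_sum_exp_char Z_indep Z_law m exp_int n 0.
by apply: eq_integrable i => // x _ /=; rewrite /exp_cos mul0r cos0 mulr1.
Qed.

Lemma tilt_char_centered_sum n t :
  tilt_char P (centered_sum n) h t = (M ^+ n)%:C * phi t ^+ n.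
Proof.
have [_ _ e1 e2] := partial_sum_exp_char Z_indep Z_law m exp_int n t.
rewrite rmorphXn -exprMn -(exp_char_tilt b0 cramer tilt_int).
by apply/eqP; rewrite eq_complex -e1 -e2 /= !eqxx.
Qed.

(** The transform of the centred sum is (M phi) ^ n with phi normalised at t = 0, whence the factor
    M ^ n. *)
Lemma smoothed_inversion_tail (C : R) n e : e != 0 ->
  (forall u, lap_integral h u = C * Num.max u 0) ->
  C * ((\int[P]_x Num.max (centered_sum n x - 0) 0 -
        \int[P]_x Num.max (centered_sum n x - e) 0) / e) =
  M ^+ n * smoothed_inversion phi h n e.
Proof.
move=> en0 HC.
have rep := laplace_representation (measurable_centered_sum n) h0 (integrable_exp_centered_sum n).
have [i0 E0] := rep C 0 HC; have [ie Ee] := rep C e HC.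
rewrite mulrA mulrBr E0 Ee -RintegralB// mulrC -RintegralZl//; last exact: (integrableB measurableT i0 ie).
have M0 : M ^+ n != 0 by rewrite expf_neq0// gt_eqF// (tilt_mass_gt0 b0 cramer tilt_int).
have RE t : e^-1 * (complex.Re (tilt_char P (centered_sum n) h t * lap_weight h 0 t) -
    complex.Re (tilt_char P (centered_sum n) h t * lap_weight h e t)) =
    M ^+ n * complex.Re (phi t ^+ n * lap_quotient h e t).
  rewrite tilt_char_centered_sum /lap_quotient; clear.
  move: (phi t ^+ n) (lap_weight h 0 t) (lap_weight h e t) => [? ?] [? ?] [? ?].
  by rewrite !ReM /=; ring.
rewrite /smoothed_inversion -RintegralZl//; first by apply: eq_Rintegral => t _; exact: RE.
have := integrableZl measurableT (e^-1 / M ^+ n) (integrableB measurableT i0 ie).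
apply: eq_integrable => // t _ /=; rewrite -EFinB -EFinM; congr EFin.
by rewrite mulrAC RE mulrAC divff// mul1r.
Qed.

Lemma large_deviation_expansion : exists c : nat -> R, 0 < c 0%N /\
  forall k, exists K : R, forall n, (0 < n)%N ->
  `|Num.sqrt n%:R * (fine (P [set x | 0 < centered_sum n x]) / M ^+ n) -
    \sum_(i < k) c i / n%:R ^+ i| <= K / n%:R ^+ k.
Proof.
have [C HC] := @lap_integral_posp R.
have M0 := tilt_mass_gt0 b0 cramer tilt_int.
have mw := measurable_tilt_density nu h m.
have mX := measurable_centered m.
have w0 := tilt_density_ge0 b0 cramer tilt_int.
have wi := tilt_density_int tilt_int.
have w1 := tilt_moment0 b0 cramer tilt_int.
have wm1 : wmoment nu density center 1 = 0.
  rewrite (tilt_density_moment tilt_int).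
  under eq_Rintegral do rewrite expr1.
  by rewrite tilt_mean mul0r.
have wm2 : wmoment nu density center 2 = tilt_var nu h m by rewrite (tilt_density_moment tilt_int).
pose Q n := fine (P [set x | 0 < centered_sum n x]).
(* The tail is expanded together with the constant C of the inversion formula, whose sign is not
   known at this point. *)
pose A n := C * (Q n / M ^+ n).
have Hexp := @smoothed_expansion R phi h h0 (measurable_wcos mw mX w0 wi) (measurable_wsin mw mX w0 wi)
  (fun t => normc_wchar_le1 mw mX w0 wi t w1) (tilt_var nu h m) (2 * wabs_moment nu density center 3) A
  (tilt_var_gt0 b0 cramer tilt_int).
have {}Hexp : forall k, inv_expansion k (fun n => Num.sqrt n%:R * A n)
    (h^-1 * gauss_moment 0 (tilt_var nu h m / 2)).
  apply: Hexp.
  - rewrite mulr_ge0//; apply: Rintegral_ge0 => y _; rewrite mulr_ge0 ?w0 ?exprn_ge0//.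
  - exact: ctaylor0_wchar.
  - by move=> t _; rewrite -wm2; exact: wchar_third_order.
  - move=> de /andP[de0 _]; exact: (tilt_char_gap b0 cramer tilt_int de0).
  move=> n e n0 /andP[e0 e1] v w.
  have [s1 s2] := tail_sandwich (measurable_centered_sum n)
    (integrable_posp (measurable_centered_sum n) h0 (integrable_exp_centered_sum n)) e0.
  have en : - e != 0 by rewrite oppr_eq0 gt_eqF.
  have F1 := smoothed_inversion_tail n (lt0r_neq0 e0) (HC h ^~ h0).
  have F2 := smoothed_inversion_tail n en (HC h ^~ h0).
  have Mn0 : 0 < M ^+ n by rewrite exprn_gt0.
  have AE : M ^+ n * A n = C * Q n by rewrite /A mulrCA [M ^+ n * _]mulrC divfK ?gt_eqF.
  have d1 : (\int[P]_x Num.max (centered_sum n x - 0) 0 -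
        \int[P]_x Num.max (centered_sum n x - e) 0) / e <= Q n.
    by rewrite ler_pdivrMr// [leRHS]mulrC.
  have d2 : Q n <= (\int[P]_x Num.max (centered_sum n x - 0) 0 -
        \int[P]_x Num.max (centered_sum n x - - e) 0) / - e.
    by rewrite invrN mulrN -mulNr opprB ler_pdivlMr// [leLHS]mulrC.
  move: F1 F2; set D1 := smoothed_inversion _ _ _ e; set D2 := smoothed_inversion _ _ _ (- e) => F1 F2.
  rewrite !ler_norml => /andP[a1 a2] /andP[a3 a4].
  (* Multiplication by C may reverse the bracketing; in either case A n lies between the two
     inversion integrals. *)
  have [C0|C0] := leP 0 C.
    have : D1 <= A n by rewrite -(ler_pM2l Mn0) AE -F1 ler_wpM2l.
    have : A n <= D2 by rewrite -(ler_pM2l Mn0) AE -F2 ler_wpM2l.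
    by move=> *; apply/andP; split; lra.
  have : A n <= D1 by rewrite -(ler_pM2l Mn0) AE -F1 ler_wnM2l// ltW.
  have : D2 <= A n by rewrite -(ler_pM2l Mn0) AE -F2 ler_wnM2l// ltW.
  by move=> *; apply/andP; split; lra.
have [c [c0 Hc]] := asymptotic_coefficients Hexp.
have v0 : 0 < h^-1 * gauss_moment 0 (tilt_var nu h m / 2).
  rewrite mulr_gt0 ?invr_gt0// gauss_moment0_gt0// divr_gt0//.
  exact: (tilt_var_gt0 b0 cramer tilt_int).
(* If C were <= 0, no A n would be positive, against the positive leading coefficient; so the
   expansion itself decides the sign of C. *)
have C0 : 0 < C.
  rewrite ltNge; apply/negP => C0.
  have [K HK] := Hc 1%N.
  have : c 0%N <= 0.
    apply: (@le0_of_le_natV _ _ K) => n n0; apply: le_trans (HK n n0).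
    rewrite big_ord1 expr0 divr1 distrC; apply: le_trans (ler_norm _).
    rewrite lerDl oppr_ge0 /A mulrCA mulr_le0_ge0// mulr_ge0 ?sqrtr_ge0//.
    by rewrite divr_ge0 ?fine_ge0 ?exprn_ge0// ltW.
  by rewrite c0 leNgt v0.
exists (fun i => c i / C); split; first by rewrite divr_gt0// c0.
move=> k; have [K HK] := Hc k; exists (K / C) => n n0.
have Ci : 0 < C^-1 by rewrite invr_gt0.
have -> : K / C / n%:R ^+ k = C^-1 * (K / n%:R ^+ k) by rewrite mulrAC mulrC.
have -> : \sum_(i < k) c i / C / n%:R ^+ i = C^-1 * \sum_(i < k) c i / n%:R ^+ i.
  by rewrite mulr_sumr; apply: eq_bigr => i _; rewrite mulrAC mulrC.
rewrite -/(Q n) (_ : Num.sqrt n%:R * (Q n / M ^+ n) = C^-1 * (Num.sqrt n%:R * A n)); last first.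
  by rewrite /A [X in _ = _ * X]mulrCA mulKf// gt_eqF.
by rewrite -mulrBr normrM (gtr0_norm Ci) ler_pM2l// HK.
Qed.

End large_deviation_expansion.

(** * The logarithmic derivative of the moment generating function *)

Section exponential_family.
Context {R : realType} (nu : probability R R).

Definition exp_conv (h : R) := nu.-integrable setT (EFin \o (fun y => expR (h * y))).

Definition exp_moment (k : nat) (h : R) : R := \int[nu]_y (y ^+ k * expR (h * y)).

Lemma measurable_expRM (h : R) : measurable_fun (setT : set R) (fun y => expR (h * y)).
Proof. by apply: measurableT_comp => //; exact: measurable_funM. Qed.

(** The parameter h keeps a distance c from both u and v, and exp (- c |y|) absorbs |y| ^ k; the
    sign of y decides which of the two exponentials dominates. The bound serves for the moments and
    for differentiation under the integral. *)
Lemma pow_expR_dominated (k : nat) (u u' v' v : R) : u < u' -> v' < v ->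
  exists2 K : R, 0 <= K & forall h y, u' <= h <= v' ->
  `|y| ^+ k * expR (h * y) <= K * (expR (u * y) + expR (v * y)).
Proof.
move=> uu vv; pose c := Num.min (u' - u) (v - v').
have c0 : 0 < c by rewrite lt_min !subr_gt0 uu.
have cu : c <= u' - u by rewrite ge_min lexx.
have cv : c <= v - v' by rewrite ge_min lexx orbT.
have [K K0 HK] := pow_expR_bounded k c0; exists K => // h y /andP[h1 h2].
have key z : h * y <= z * y - c * `|y| -> `|y| ^+ k * expR (h * y) <= K * expR (z * y).
  move=> hz; apply: (@le_trans _ _ (`|y| ^+ k * expR (- (c * `|y|)) * expR (z * y))).
    rewrite -mulrA ler_wpM2l ?exprn_ge0// -expRD ler_expR; lra.
  by rewrite ler_wpM2r ?expR_ge0// HK.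
have eu := expR_ge0 (u * y); have ev := expR_ge0 (v * y).
have [y0|y0] := leP 0 y.
  apply: (le_trans (key v _)); first by rewrite ger0_norm//; nra.
  by rewrite ler_wpM2l// lerDr.
apply: (le_trans (key u _)); first by rewrite ltr0_norm//; nra.
by rewrite ler_wpM2l// lerDl.
Qed.

Lemma integrable_pow_expR k (u h v : R) : exp_conv u -> exp_conv v -> u < h < v ->
  nu.-integrable setT (EFin \o (fun y => `|y| ^+ k * expR (h * y))).
Proof.
move=> cu cv /andP[uh hv]; have [K K0 HK] := pow_expR_dominated k uh hv.
apply: (@integrable_le _ _ R nu setT _ (fun y => K * expR (u * y) + K * expR (v * y))) => //.
- apply: measurable_funM; last exact: measurable_expRM.
  by apply: measurable_funX; exact: normr_measurable.
- move=> y _; rewrite ger0_norm ?mulr_ge0 ?expR_ge0 ?exprn_ge0// -mulrDr.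
  by apply: HK; rewrite !lexx.
- exact: integrable_lin.
Qed.

Lemma integrable_exp_moment k (u h v : R) : exp_conv u -> exp_conv v -> u < h < v ->
  nu.-integrable setT (EFin \o (fun y => y ^+ k * expR (h * y))).
Proof.
move=> cu cv uhv; apply: (@integrable_le _ _ R nu setT _ (fun y => `|y| ^+ k * expR (h * y))) => //.
- by apply: measurable_funM; [exact: measurable_funX|exact: measurable_expRM].
- by move=> y _; rewrite normrM normrX (ger0_norm (expR_ge0 _)).
- exact: integrable_pow_expR cu cv uhv.
Qed.

Lemma is_derive_exp_moment k (u h v : R) : exp_conv u -> exp_conv v -> u < h < v ->
  is_derive h (1 : R) (exp_moment k) (exp_moment k.+1 h).
Proof.
move=> cu cv /andP[uh hv]; pose a := (u + h) / 2; pose b := (h + v) / 2.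
have ua : u < a by rewrite /a; lra.
have bv : b < v by rewrite /b; lra.
have [K K0 HK] := pow_expR_dominated k.+1 ua bv.
pose f (x y : R) := y ^+ k * expR (x * y).
pose G y := K * (expR (u * y) + expR (v * y)).
have G0 y : 0 <= G y by rewrite mulr_ge0 ?addr_ge0 ?expR_ge0.
have iG : nu.-integrable setT (EFin \o G).
  by have := integrable_lin K K measurableT cu cv; apply: eq_integrable => // y _ /=; rewrite /G mulrDr.
have Ih : `]a, b[%classic h by rewrite /= in_itv/= /a /b; apply/andP; split; lra.
have fi x : `]a, b[%classic x -> nu.-integrable setT (EFin \o f x).
  rewrite /= in_itv/= => /andP[ax xb]; apply: integrable_exp_moment cu cv _.
  by rewrite (lt_trans ua ax) (lt_trans xb bv).
have dfE x y : is_derive x (1 : R) (f ^~ y) (y ^+ k.+1 * expR (x * y)).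
  apply: trigger_derive; rewrite /GRing.scale /= exprS; ring.
have df x y : `]a, b[%classic x -> setT y -> derivable (f ^~ y) x 1.
  by move=> _ _; have := dfE x y => -[].
have pE x y : partial1of2 f x y = y ^+ k.+1 * expR (x * y).
  by rewrite partial1of2E; have H := dfE x y; rewrite derive_val.
have fG x y : `]a, b[%classic x -> setT y -> `|partial1of2 f x y| <= G y.
  rewrite /= in_itv/= => /andP[ax xb] _; rewrite pE normrM normrX (ger0_norm (expR_ge0 _)).
  by apply: HK; rewrite !ltW.
apply: DeriveDef.
  exact: (derivable_under_integral measurableT Ih fi df G0 iG fG).
rewrite -derive1E (differentiation_under_integral measurableT Ih fi df G0 iG fG).
by apply: eq_Rintegral => y _; exact: pE.
Qed.

Lemma exp_conv_between (u h v : R) : exp_conv u -> exp_conv v -> u <= h <= v -> exp_conv h.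
Proof.
move=> cu cv /andP[uh hv].
apply: (@integrable_le _ _ R nu setT _ (fun y => 1 * expR (u * y) + 1 * expR (v * y))) => //.
- exact: measurable_expRM.
- move=> y _; rewrite ger0_norm ?expR_ge0// !mul1r.
  have eu := expR_ge0 (u * y); have ev := expR_ge0 (v * y).
  have [y0|y0] := leP 0 y.
    by apply: (@le_trans _ _ (expR (v * y))); [rewrite ler_expR; nra|lra].
  by apply: (@le_trans _ _ (expR (u * y))); [rewrite ler_expR; nra|lra].
- exact: integrable_lin.
Qed.

Context (b : R) (b0 : 0 < b) (cramer : cramer_condition nu b).

Section tilt.
Context (u h v : R) (cu : exp_conv u) (cv : exp_conv v) (uhv : u < h < v) (m : R).

Lemma integrable_tilt_pow k :
  nu.-integrable setT (EFin \o (fun y => tilt h m y * `|y - m| ^+ k)).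
Proof.
have /andP[uh hv] := uhv; have [K K0 HK] := pow_expR_dominated k uh hv.
apply: (@integrable_le _ _ R nu setT _ (fun y => (K * expR (- (u * m))) * expR (u * y) +
   (K * expR (- (v * m))) * expR (v * y))) => //.
- apply: measurable_funM; first exact: measurable_tilt.
  by apply: measurable_funX; apply: measurableT_comp => //; exact: measurable_centered.
- move=> y _; rewrite ger0_norm ?mulr_ge0 ?tilt_ge0 ?exprn_ge0// mulrC.
  have := HK h (y - m); rewrite !lexx => /(_ isT)/le_trans; apply.
  by rewrite -!mulrA -!expRD -mulrDr !mulrBr ![- _ + _]addrC.
- exact: integrable_lin.
Qed.

Lemma tiltE y : tilt h m y = expR (- (h * m)) * expR (h * y).
Proof. by rewrite /tilt -expRD; congr expR; ring. Qed.

Lemma tilt_massE : tilt_mass nu h m = expR (- (h * m)) * exp_moment 0 h.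
Proof.
rewrite -RintegralZl//; last exact: integrable_exp_moment cu cv uhv.
by apply: eq_Rintegral => y _; rewrite tiltE expr0 mul1r.
Qed.

Lemma exp_moment0_gt0 : 0 < exp_moment 0 h.
Proof.
have := tilt_mass_gt0 b0 cramer integrable_tilt_pow.
by rewrite tilt_massE pmulr_rgt0// expR_gt0.
Qed.

Lemma tilt_meanE : \int[nu]_y (tilt h m y * (y - m)) =
  expR (- (h * m)) * (exp_moment 1 h - m * exp_moment 0 h).
Proof.
have i k := integrable_exp_moment k cu cv uhv.
rewrite mulrBr mulrA -[X in _ = X - _]addr0.
rewrite -[RHS](_ : expR (- (h * m)) * exp_moment 1 h +
  (- (expR (- (h * m)) * m)) * exp_moment 0 h = _); last by ring.
rewrite -Rintegral_lin//; apply: eq_Rintegral => y _.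
by rewrite tiltE expr0 expr1; ring.
Qed.

End tilt.

(** The quantity is the squared moment generating function times the variance of the tilted law:
    with m the tilted mean, expanding (y - m) ^ 2 reduces the claim to [tilt_var_gt0]. *)
Lemma exp_variance_gt0 (u h v : R) : exp_conv u -> exp_conv v -> u < h < v ->
  0 < exp_moment 2 h * exp_moment 0 h - exp_moment 1 h ^+ 2.
Proof.
move=> cu cv uhv; have M0 := exp_moment0_gt0 cu cv uhv 0.
pose m := exp_moment 1 h / exp_moment 0 h.
have := tilt_var_gt0 b0 cramer (integrable_tilt_pow cu cv uhv m).
rewrite /tilt_var pmulr_lgt0 ?invr_gt0 ?(tilt_mass_gt0 b0 cramer (integrable_tilt_pow cu cv uhv m))//.
have i k := integrable_exp_moment k cu cv uhv.
have i2 := integrable_lin 1 (- (2 * m)) measurableT (i 2%N) (i 1%N).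
have -> : \int[nu]_y (tilt h m y * (y - m) ^+ 2) = expR (- (h * m)) *
    ((exp_moment 2 h - 2 * m * exp_moment 1 h) + m ^+ 2 * exp_moment 0 h).
  rewrite (_ : exp_moment 2 h - _ = 1 * exp_moment 2 h + (- (2 * m)) * exp_moment 1 h); last by ring.
  rewrite -Rintegral_lin// -[X in X + _]mul1r -Rintegral_lin// -RintegralZl//; last first.
    exact: (integrable_lin 1 (m ^+ 2) measurableT i2 (i 0%N)).
  by apply: eq_Rintegral => y _; rewrite tiltE expr0 expr1; ring.
rewrite pmulr_rgt0 ?expR_gt0// => H.
have -> : exp_moment 2 h * exp_moment 0 h - exp_moment 1 h ^+ 2 =
  exp_moment 0 h * (exp_moment 2 h - 2 * m * exp_moment 1 h + m ^+ 2 * exp_moment 0 h).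
  by rewrite /m; field; rewrite gt_eqF.
exact: mulr_gt0.
Qed.

Definition exp_mean (h : R) : R := exp_moment 1 h / exp_moment 0 h.

Lemma is_derive_exp_mean (u h v : R) : exp_conv u -> exp_conv v -> u < h < v ->
  is_derive h (1 : R) exp_mean
    ((exp_moment 2 h * exp_moment 0 h - exp_moment 1 h ^+ 2) / exp_moment 0 h ^+ 2).
Proof.
move=> cu cv uhv; have M0 := exp_moment0_gt0 cu cv uhv 0.
have M0' : exp_moment 0 h != 0 by rewrite gt_eqF.
have d0 := is_derive_exp_moment 0 cu cv uhv; have d1 := is_derive_exp_moment 1 cu cv uhv.
have dV := @is_deriveV R (exp_moment 0) h _ 1 M0' d0.
apply: (@is_derive_eq _ _ _ _ _ _ _ _ (is_deriveM d1 dV)).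
by rewrite /GRing.scale /=; field.
Qed.

Lemma exp_mean_increasing (u x y v : R) : exp_conv u -> exp_conv v -> u < x -> x < y -> y < v ->
  exp_mean x < exp_mean y.
Proof.
move=> cu cv ux xy yv.
have D z : x <= z <= y -> is_derive z (1 : R) exp_mean
    ((exp_moment 2 z * exp_moment 0 z - exp_moment 1 z ^+ 2) / exp_moment 0 z ^+ 2).
  by move=> /andP[xz zy]; apply: (is_derive_exp_mean cu cv); rewrite (lt_le_trans ux xz) (le_lt_trans zy yv).
have [||c cxy] := MVT xy (f := exp_mean)
    (df := fun z => (exp_moment 2 z * exp_moment 0 z - exp_moment 1 z ^+ 2) / exp_moment 0 z ^+ 2).
- by move=> z; rewrite in_itv /= => /andP[xz zy]; apply: D; rewrite !ltW.
- apply: derivable_within_continuous => z; rewrite in_itv /= => zxy.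
  by have [] := D z zxy.
move: cxy; rewrite in_itv /= => /andP[xc cy] E; rewrite -subr_gt0 E mulr_gt0 ?subr_gt0//.
have ucv : u < c < v by rewrite (lt_trans ux xc) (lt_trans cy yv).
by rewrite divr_gt0 ?exprn_gt0 ?(exp_variance_gt0 cu cv ucv) ?(exp_moment0_gt0 cu cv ucv 0).
Qed.

Lemma exp_mean_IVT (u x y v s : R) : exp_conv u -> exp_conv v -> u < x -> x <= y -> y < v ->
  exp_mean x <= s <= exp_mean y -> exists2 z, x <= z <= y & exp_mean z = s.
Proof.
move=> cu cv ux xy yv /andP[xs sy].
have cf : {within `[x, y], continuous exp_mean}.
  apply: derivable_within_continuous => z; rewrite in_itv /= => /andP[xz zy].
  have uzv : u < z < v by rewrite (lt_le_trans ux xz) (le_lt_trans zy yv).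
  by have [] := is_derive_exp_mean cu cv uzv.
have [|z zxy <-] := IVT xy cf (v := s).
  by rewrite ge_min xs le_max sy orbT.
by exists z.
Qed.

Lemma derive1_ln_exp_moment (u h v : R) : exp_conv u -> exp_conv v -> u < h < v ->
  derive1 (fun x => ln (exp_moment 0 x)) h = exp_mean h.
Proof.
move=> cu cv uhv; have M0 := exp_moment0_gt0 cu cv uhv 0.
have d0 := is_derive_exp_moment 0 cu cv uhv.
have dl := is_derive1_ln M0.
rewrite derive1E.
have := @is_derive1_comp R (@ln R) (exp_moment 0) h _ _ dl d0.
by move=> H; rewrite derive_val mulrC.
Qed.

End exponential_family.

(** * The law determined by a cumulative distribution function *)

Section law_of_cdf.
Context d (T : measurableType d) (R : realType) (P : probability T R).
Context (V : cumulativeBounded (0 : R) (1 : R)).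

Lemma law_itv (X : {RV P >-> R}) : (forall x, cdf X x = (V x)%:E) ->
  forall a b : R, a <= b -> distribution P X (`]a, b]%classic : set R) = (V b - V a)%:E.
Proof.
move=> XV a b ab.
have -> : `]a, b]%classic = `]-oo, b]%classic `\` (`]-oo, a]%classic : set R).
  apply/seteqP; split => x /=; rewrite !in_itv /=.
    by move=> /andP[ax xb]; split => //; apply/negP; rewrite -ltNge.
  by move=> [xb /negP]; rewrite -ltNge => ->.
rewrite measureD//; last by rewrite ltey_eq fin_num_measure.
rewrite (_ : _ `&` _ = `]-oo, a]%classic); last first.
  apply/seteqP; split => x /=; rewrite !in_itv /=; first by move=> [].
  by move=> xa; split => //; exact: le_trans ab.
by have := congr2 (fun x y => x - y)%E (XV b) (XV a).
Qed.

Lemma law_lebesgue_stieltjes (X : {RV P >-> R}) : (forall x, cdf X x = (V x)%:E) ->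
  forall A : set R, measurable A -> lebesgue_stieltjes_measure V A = distribution P X A.
Proof.
move=> XV A mA.
have mX : measurable_fun setT (X : T -> measurableTypeR R) := measurable_funPT X.
pose nu := pushforward P (X : T -> measurableTypeR R).
have nuE (B : set R) : nu B = distribution P X B by [].
have -> : distribution P X A = nu A by [].
apply: (@lebesgue_stieltjes_measure_unique R V nu _ A mA) => _ [[a b] _ <-].
rewrite /lebesgue_stieltjes_measure /measure_extension/=.
rewrite measurable_mu_extE/=; last exact: is_ocitv.
have [ab|ba] := leP a b; last first.
  by rewrite set_itv_ge ?wlength0 ?measure0// bnd_simp -leNgt ltW.
by rewrite wlength_itv_bnd//; apply/esym; exact: law_itv.
Qed.

Lemma exp_integral_law (X : {RV P >-> R}) : (forall x, cdf X x = (V x)%:E) ->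
  forall h, exp_integral V h = (\int[distribution P X]_y (expR (h * y))%:E)%E.
Proof.
move=> XV h; rewrite /exp_integral.
have mX : measurable_fun setT (X : T -> measurableTypeR R) := measurable_funPT X.
rewrite (eq_measure_integral (pushforward P (X : T -> measurableTypeR R))); last first.
  by move=> A mA _; exact: law_lebesgue_stieltjes.
have mE : measurable_fun (setT : set (measurableTypeR R)) (fun y : R => (expR (h * y))%:E).
  by apply/measurable_EFinP; exact: measurable_expRM.
have E0 (y : R) : (0 <= (expR (h * y))%:E)%E by rewrite lee_fin expR_ge0.
rewrite (ge0_integral_pushforward mX)//.
by rewrite ge0_integral_distribution.
Qed.

End law_of_cdf.

(** * The range of the tilted mean below [A1] *)

Section mean_range.
Context {R : realType} (nu : probability R R) (V : cumulativeBounded (0 : R) (1 : R)).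
Context (VE : forall h, exp_integral V h = (\int[nu]_y (expR (h * y))%:E)%E).

Lemma exp_convE h : exp_conv nu h <-> (exp_integral V h < +oo)%E.
Proof.
rewrite VE; split => [/integrable_lty|H].
  by rewrite /=; apply.
apply/integrableP; split; first by apply/measurable_EFinP; exact: measurable_expRM.
by under eq_integral do rewrite /= ger0_norm ?expR_ge0//.
Qed.

Lemma RtransformE : Rtransform V = exp_moment nu 0.
Proof.
apply/funext => h; rewrite /Rtransform VE; apply: eq_Rintegral => y _.
by rewrite expr0 mul1r.
Qed.

Context (u : R) (u0 : u < 0) (u_conv : exp_conv nu u).
Context (A1_gt0 : (0 < A1 V)%E).
Context (b : R) (b0 : 0 < b) (cramer : cramer_condition nu b).

Lemma lt_A1_conv h : (h%:E < A1 V)%E -> exists2 v, h < v & exp_conv nu v.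
Proof.
move=> /ereal_sup_gt[_ [v vc <-]]; rewrite lte_fin => hv.
by exists v => //; apply/exp_convE.
Qed.

Lemma le_lt_A1 (h k : R) : h <= k -> (k%:E < A1 V)%E -> (h%:E < A1 V)%E.
Proof. by move=> hk; apply: le_lt_trans; rewrite lee_fin. Qed.

Lemma mbarE h : 0 <= h -> (h%:E < A1 V)%E -> mbar V h = exp_mean nu h.
Proof.
move=> h0 /lt_A1_conv[v hv cv]; rewrite /mbar RtransformE.
by apply: (derive1_ln_exp_moment b0 cramer u_conv cv); rewrite hv (lt_le_trans u0).
Qed.

Lemma mean_increasing x y : 0 <= x -> x < y -> (y%:E < A1 V)%E ->
  exp_mean nu x < exp_mean nu y.
Proof.
move=> x0 xy /lt_A1_conv[v yv cv].
exact: (exp_mean_increasing b0 cramer u_conv cv (lt_le_trans u0 x0) xy yv).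
Qed.

(** The quantity sigma C1: as the mean is increasing, its left limit at [A1] is this supremum. *)
Definition mean_sup : \bar R :=
  ereal_sup [set (exp_mean nu h)%:E | h in [set h : R | 0 < h /\ (h%:E < A1 V)%E]].

(** A description of the neighbourhoods that is the same for a finite and an infinite end point. *)
Lemma at_left_A1 (a : \bar R) (X : set R) (k : R) : (k%:E < a)%E ->
  (forall h, k < h -> (h%:E < a)%E -> X h) -> at_left_ereal a X.
Proof.
case: a => [r| |//] ka H.
  rewrite /at_left_ereal; near=> h; apply: H; first by near: h; exact: nbhs_left_gt.
  by rewrite lte_fin; near: h; exact: nbhs_left_lt.
by exists k; split => [|h kh]; [exact: num_real|apply: H; rewrite ?ltry].
Unshelve. all: by end_near. Qed.

Lemma mean_cvg : (mbar V h)%:E @[h --> at_left_ereal (A1 V)] --> mean_sup.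
Proof.
have Ff : Filter (at_left_ereal (A1 V)).
  by move: A1_gt0; case: (A1 V) => [r| |]//= _; exact: _.
have up h : 0 < h -> (h%:E < A1 V)%E -> ((exp_mean nu h)%:E <= mean_sup)%E.
  by move=> h0 hA; apply: ereal_sup_ubound; exists h.
have low a : (a < mean_sup)%E -> exists2 k, 0 < k & (k%:E < A1 V)%E /\
    forall h, k < h -> (h%:E < A1 V)%E -> (a < (mbar V h)%:E)%E.
  move=> /ereal_sup_gt[_ [k [k0 kA] <-]] ak; exists k => //; split => // h kh hA.
  rewrite mbarE ?(ltW (lt_trans k0 kh))//; apply: (lt_trans ak); rewrite lte_fin.
  exact: (mean_increasing (ltW k0)).
move E : mean_sup => s; case: s E => [s| |] E.
- apply: cvg_EFin; first by apply: nearW.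
  apply/cvgrPdist_le => e e0.
  have [|k k0 [kA Hk]] := low (s - e)%:E; first by rewrite E lte_fin ltrBlDr ltrDl.
  apply: (at_left_A1 kA) => h kh hA /=; have := Hk h kh hA; have := up h (lt_trans k0 kh) hA.
  rewrite mbarE ?(ltW (lt_trans k0 kh))// E lee_fin lte_fin => h1 h2.
  by rewrite ger0_norm; lra.
- apply/cvgeyPgt => a; have [|k k0 [kA Hk]] := low a%:E; first by rewrite E ltry.
  exact: (at_left_A1 kA).
- have [h h0 hA] : exists2 h : R, 0 < h & (h%:E < A1 V)%E.
    move: A1_gt0; case: (A1 V) => [r| |]//; last by exists 1; rewrite ?ltry.
    by rewrite lte_fin => r0; exists (r / 2); rewrite ?lte_fin; lra.
  by have := up h h0 hA; rewrite E leeNy_eq.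
Qed.

Context (mean0 : exp_mean nu 0 = 0).

Lemma mean_sup_gt0 : (0 < mean_sup)%E.
Proof.
have [h h0 hA] : exists2 h : R, 0 < h & (h%:E < A1 V)%E.
  move: A1_gt0; case: (A1 V) => [r| |]//; last by exists 1; rewrite ?ltry.
  by rewrite lte_fin => r0; exists (r / 2); rewrite ?lte_fin; lra.
apply: (@lt_le_trans _ _ (exp_mean nu h)%:E).
  by rewrite lte_fin -mean0; exact: mean_increasing.
by apply: ereal_sup_ubound; exists h.
Qed.

Lemma mean_root (s : R) : 0 < s -> (s%:E < mean_sup)%E ->
  exists h, unique (fun h => [/\ 0 < h, (h%:E < A1 V)%E & mbar V h = s]) h.
Proof.
move=> s0 /ereal_sup_gt[_ [k [k0 kA] <-]]; rewrite lte_fin => sk.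
have [v kv cv] := lt_A1_conv kA.
have [|h /andP[h0 hk] hs] := @exp_mean_IVT _ nu b b0 cramer u 0 k v s u_conv cv u0 (ltW k0) kv.
  by rewrite mean0 !ltW.
have hA := le_lt_A1 hk kA.
have {}h0 : 0 < h.
  by rewrite lt_neqAle h0 andbT; apply/eqP => h0'; move: s0; rewrite -hs -h0' mean0 ltxx.
exists h; split=> [|x [x0 xA xs]]; first by split => //; rewrite mbarE// ltW.
rewrite mbarE ?(ltW x0)// in xs.
have [hx|xh|//] := ltgtP h x.
  by have := mean_increasing (ltW h0) hx xA; rewrite hs xs ltxx.
by have := mean_increasing (ltW x0) xh hA; rewrite hs xs ltxx.
Qed.

End mean_range.

(** * Large deviations of sums of independent variables with a common law *)

Theorem theorem6 (R : realType) (d : measure_display) (T : measurableType d)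
    (P : probability T R) (Z : nat -> {RV P >-> R})
    (V : cumulativeBounded (0 : R) (1 : R)) (sigma : R)
    (Z_indep : mutually_independent Z)
    (Z_cdf : forall n x, cdf (Z n) x = (V x)%:E)
    (sigma_gt0 : 0 < sigma)
    (Z_mean : forall n, ('E_P[Z n] = 0)%E)
    (Z_var : forall n, ('E_P[fun t => (Z n t ^+ 2)%R] = (sigma ^+ 2)%:E)%E)
    (condA : exists2 A : R, 0 < A &
       forall h : R, `|h| < A -> (exp_integral V h < +oo)%E)
    (condB : exists (beta : R) (U1 U2 : cumulativeBounded (0 : R) (1 : R)),
       ac_singular_decomposition V beta U1 U2 /\ 0 < beta) :
  exists C1 : \bar R,
    [/\ (0 < C1)%E,
        (mbar V h)%:E @[h --> at_left_ereal (A1 V)] --> (sigma%:E * C1)%E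
      & forall c : R, 0 < c -> (c%:E < C1)%E ->
        exists h : R,
          unique (fun h => [/\ 0 < h, (h%:E < A1 V)%E
                             & mbar V h = sigma * c]) h /\
          let alpha := h * mbar V h - ln (Rtransform V h) in
          exists b : nat -> R, 0 < b 0%N /\
            forall k : nat, (0 < k)%N ->
            exists2 r : nat -> R,
              r =O_\oo (fun n : nat => (n%:R ^+ k)^-1 : R) &
              forall n : nat, (0 < n)%N ->
                1 - cdf_sum Z sigma n (c * Num.sqrt n%:R) =
                (Num.sqrt n%:R)^-1 * expR (- (alpha * n%:R)) *
                (\sum_(i < k) b i / n%:R ^+ i + r n)].
Proof.
pose nu := distribution P (Z 0%N).
have Z_law n (A : set R) : measurable A -> P (Z n @^-1` A) = nu A.
  move=> mA; rewrite /nu -(law_lebesgue_stieltjes (Z_cdf 0%N) mA).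
  by rewrite (law_lebesgue_stieltjes (Z_cdf n) mA).
have VE := exp_integral_law (Z_cdf 0%N).
have [A A0 HA] := condA.
have conv h : `|h| < A -> exp_conv nu h by move=> hA; apply/(exp_convE VE); exact: HA.
(* The points - A / 2 and A / 2 of convergence enclose 0; the first remains the left end of the
   interval of convergence for every h > 0 considered below. *)
have conv_neg : exp_conv nu (- (A / 2)).
  by apply: conv; rewrite normrN gtr0_norm ?divr_gt0//; lra.
have conv_pos : exp_conv nu (A / 2).
  by apply: conv; rewrite gtr0_norm ?divr_gt0//; lra.
have u0 : - (A / 2) < 0 by rewrite oppr_lt0 divr_gt0.
have A1_gt0 : (0 < A1 V)%E.
  apply: (@lt_le_trans _ _ (A / 2)%:E); first by rewrite lte_fin divr_gt0.
  by apply: ereal_sup_ubound; exists (A / 2) => //; apply/(exp_convE VE).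
have [beta [U1 [U2 [[/andP[_ beta1] VU acU _ _] beta0]]]] := condB.
have b0 : 0 < beta / 2 by rewrite divr_gt0.
have cramer : cramer_condition nu (beta / 2).
  move=> de de0; apply: (cramer_set _ _ VU acU de0); last by rewrite beta0.
  exact: law_itv (Z_cdf 0%N).
have mean0 : exp_mean nu 0 = 0.
  have uv : - (A / 2) < 0 < A / 2 by rewrite u0 divr_gt0.
  have i1 := integrable_exp_moment 1 conv_neg conv_pos uv.
  have i2 : nu.-integrable setT (EFin \o (fun y : R => y)).
    by apply: eq_integrable i1 => // y _ /=; rewrite expr1 mul0r expR0 mulr1.
  have [_ E] := integrable_law Z_law 0%N (@measurable_id _ _ setT) i2.
  have Z0 : \int[P]_t Z 0%N t = 0.
    by have := Z_mean 0%N; rewrite unlock /Rintegral => ->.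
  have m0 : exp_moment nu 1 0 = 0.
    transitivity (\int[P]_t Z 0%N t) => //; rewrite E.
    by apply: eq_Rintegral => y _; rewrite expr1 mul0r expR0 mulr1.
  by rewrite /exp_mean m0 mul0r.
have s_neq0 : sigma != 0 by rewrite gt_eqF.
(* Dividing by sigma turns the condition c < C1 into sigma c < [mean_sup]. *)
exists (sigma^-1%:E * mean_sup nu V)%E; split.
- rewrite mule_gt0 ?lte_fin ?invr_gt0//.
  exact: (mean_sup_gt0 VE u0 conv_neg A1_gt0 b0 cramer mean0).
- rewrite muleA -EFinM mulfV// mul1e.
  exact: (mean_cvg VE u0 conv_neg A1_gt0 b0 cramer).
move=> c c0 cC1; have sc0 : 0 < sigma * c by rewrite mulr_gt0.
have [|h hu] := mean_root VE u0 conv_neg b0 cramer mean0 sc0.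
  have : (sigma%:E * c%:E < sigma%:E * (sigma^-1%:E * mean_sup nu V))%E.
    by rewrite lte_pmul2l ?lte_fin.
  by rewrite muleA -!EFinM mulfV// mul1e.
exists h; split => //.
have [[h0 hA mh] _] := hu.
(* As h is strictly below the supremum [A1], the transform converges at some v > h, whatever happens
   at [A1] itself. *)
have [v hv cv] := lt_A1_conv VE hA.
have uhv : - (A / 2) < h < v by rewrite (lt_trans u0 h0).
have mean_h : exp_mean nu h = sigma * c.
  by rewrite -(mbarE VE u0 conv_neg b0 cramer (ltW h0) hA).
have R0 := exp_moment0_gt0 b0 cramer conv_neg cv uhv 0.
have tilt_mean : \int[nu]_y (tilt h (sigma * c) y * (y - sigma * c)) = 0.
  rewrite (tilt_meanE conv_neg cv uhv) -mean_h /exp_mean divfK ?gt_eqF// subrr mulr0.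
  by [].
have h_conv : exp_conv nu h.
  by apply: (exp_conv_between conv_neg cv); rewrite !ltW//; case/andP: uhv.
have [b [b_gt0 Hb]] := large_deviation_expansion Z_indep Z_law h0 b0 cramer h_conv
  (integrable_tilt_pow conv_neg cv uhv (sigma * c)) tilt_mean.
move=> alpha; exists b; split => // k k0; have [K HK] := Hb k.
pose Q n := fine (P [set x | 0 < partial_sum Z n x - n%:R * (sigma * c)]).
pose M := tilt_mass nu h (sigma * c).
(* The error term is taken to be the exact residue, so that the identity is algebraic and only its
   size is at stake. *)
exists (fun n => Num.sqrt n%:R * (Q n / M ^+ n) - \sum_(i < k) b i / n%:R ^+ i).
  apply/eqO_exP; exists (`|K| + 1); first by rewrite ltr_wpDl.
  near=> n; have n0 : (0 < n)%N by near: n; exact: nbhs_infty_gt.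
  apply: (le_trans (HK n n0)).
  rewrite [X in _ <= _ * X]ger0_norm ?invr_ge0 ?exprn_ge0//.
  rewrite ler_wpM2r ?invr_ge0 ?exprn_ge0//.
  by rewrite (le_trans (ler_norm K))// lerDl.
move=> n n0; rewrite subrKC.
have n0R : 0 <= n%:R :> R by [].
have sn : Num.sqrt n%:R != 0 :> R by rewrite gt_eqF// sqrtr_gt0 ltr0n.
(* Here [mbar V h = sigma * c] identifies exp (- alpha) with exp (- h sigma c) times the transform
   at h, which is the tilted mass. *)
have ME : expR (- (alpha * n%:R)) = M ^+ n.
  rewrite /M (tilt_massE conv_neg cv uhv) /alpha mh (RtransformE VE).
  rewrite -[X in _ = (_ * X) ^+ _](lnK (x := exp_moment nu 0 h)) ?posrE// -expRD -expRM_natl.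
  by congr expR; ring.
have M0 : M ^+ n != 0 by rewrite -ME gt_eqF// expR_gt0.
rewrite ME (_ : _ * _ * _ = Q n); last by field; rewrite sn M0.
have mS : measurable [set x | 0 < partial_sum Z n x - n%:R * (sigma * c)].
  have mf := measurable_centered_sum Z (sigma * c) n.
  have := mf measurableT _ (measurable_itv `]0, +oo[); rewrite setTI.
  rewrite (_ : _ @^-1` _ = [set x | 0 < partial_sum Z n x - n%:R * (sigma * c)])//.
  by apply/seteqP; split => x /=; rewrite in_itv /= andbT.
(* As sigma (c sqrt n) sqrt n = n sigma c, one minus the distribution function is the probability of
   the strict event S_n > n sigma c. *)
rewrite /cdf_sum (_ : [set t | _] = ~` [set x | 0 < partial_sum Z n x - n%:R * (sigma * c)]).
  by rewrite probability_setC// fineB ?fin_num_measure// opprB addrC subrK.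
apply/seteqP; split => x /=; rewrite -partial_sumE.
  rewrite -mulrA -[c * _ * _]mulrA -expr2 sqr_sqrtr// => H; apply/negP; rewrite -leNgt; lra.
move/negP; rewrite -leNgt -mulrA -[c * _ * _]mulrA -expr2 sqr_sqrtr//; lra.
Unshelve. all: by end_near. Qed.
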